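(* Suppose that $\mathbb M$ has definable Skolem functions. Let $X$ be a Hausdorff definable space. Then the following are equivalent: (1) $X$ is definably compact. (2) Every definable type on $X$ has a limit in $X$.
   Context: $\mathbb M=(M,<,\ldots)$ is an arbitrary o-minimal structure; ''definable'' means definable in $\mathbb M$, possibly with parameters. $\mathbb M$ has definable Skolem functions if for every uniformly definable family $\{F_t\}_{t\in T}$ of nonempty definable sets there is a definable map $f:T\to\bigcup_t F_t$ with $f(t)\in F_t$ for all $t\in T$. A definable space is a set $X=\bigcup_{i\le k}X_i$ with injections (definable charts) $\theta_i:X_i\to M^{n_i}$ ($i\le k$, $k$ finite) such that each $\theta_i(X_i)$ is a definable subset of $M^{n_i}$ (with the induced topology), each $\theta_i(X_i\cap X_j)$ is an open definable subset of $\theta_i(X_i)$, and each transition map $\theta_j\circ\theta_i^{-1}:\theta_i(X_i\cap X_j)\to\theta_j(X_i\cap X_j)$ is a definable homeomorphism. $X$ carries the topology in which each $X_i$ is open and each $\theta_i$ is a homeomorphism. A subset $A\subseteq X$ is definable if each $\theta_i(A\cap X_i)$ is definable. A map $f:X\to Y$ between definable spaces with charts $(X_i,\theta_i)$, $(Y_j,\delta_j)$ is definable if each $\delta_j\circ f\circ\theta_i^{-1}$ (on its natural domain) is a definable map between definable sets. A definable curve in $X$ is a continuous definable map $\alpha:(a,b)\to X$, with $a<b$ in $M\cup\{-\infty,+\infty\}$; it is completable in $X$ if both limits $\lim_{t\to a^+}\alpha(t)$ and $\lim_{t\to b^-}\alpha(t)$ exist in $X$. $X$ is definably compact if every definable curve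 in $X$ is completable in $X$. A type on $X$ is an ultrafilter $\alpha$ of definable subsets of $X$. It is a definable type on $X$ if for every uniformly definable family $\{F_t\}_{t\in T}$ of definable subsets of $X$, with $T\subseteq M^n$ for some $n$, there is a definable subset $T(\alpha)\subseteq T$ such that $F_t\in\alpha$ if and only if $t\in T(\alpha)$. A point $x\in X$ is a limit of $\alpha$ if $U\in\alpha$ for every open definable subset $U$ of $X$ with $x\in U$. *)

(* Defs.v *)
From HB Require Import structures.
From mathcomp Require Import all_boot all_order all_algebra.
From mathcomp Require Import all_classical.
From mathcomp Require Import topology.

Set Implicit Arguments.
Unset Strict Implicit.
Unset Printing Implicit Defensive.

Import Order.TTheory.

Local Open Scope classical_set_scope.
Local Open Scope ring_scope.
Local Open Scope order_scope.

(* A first-order structure (M, <, ...) on the ordered set M, constants being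
   0-ary functions. An [orderTopologicalType] carries the order topology, and
   'rV[M]_n = M^n then carries the product topology. *)
Record structure d (M : orderTopologicalType d) := Structure {
  fsym : Type;
  farity : fsym -> nat;
  finterp : forall f, 'rV[M]_(farity f) -> M;
  rsym : Type;
  rarity : rsym -> nat;
  rinterp : forall r, set 'rV[M]_(rarity r) }.

Section Formulas.
Context d (M : orderTopologicalType d) (S : structure M).

(* Terms and formulas whose free variables are indexed by 'I_n. *)
Inductive term (n : nat) : Type :=
| Var (i : 'I_n)
| App (f : fsym S) (args : 'I_(farity f) -> term n).

Inductive formula (n : nat) : Type :=
| Eq (t u : term n)
| Lt (t u : term n)
| Rel (r : rsym S) (args : 'I_(rarity r) -> term n)
| Neg (p : formula n)
| And (p q : formula n)
| Ex (p : formula n.+1).  (* binds the variable 0 *)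

Fixpoint eval n (e : 'rV[M]_n) (t : term n) : M :=
  match t with
  | Var i => e ord0 i
  | App f args => finterp (\row_(i < farity f) eval e (args i))
  end.

Fixpoint sat n (p : formula n) : 'rV[M]_n -> Prop :=
  match p with
  | Eq t u => fun e => eval e t = eval e u
  | Lt t u => fun e => eval e t < eval e u
  | Rel r args =>
      fun e => rinterp (\row_(i < rarity r) eval e (args i))
  | Neg p => fun e => ~ sat p e
  | And p q => fun e => sat p e /\ sat q e
  | Ex p => fun e =>
      exists x : M, sat p (row_mx (const_mx x : 'rV[M]_1) e : 'rV[M]_(1 + _))
  end.

(* The entries of [a] are the parameters. *)
Definition definable n (A : set 'rV[M]_n) : Prop :=
  exists (k : nat) (a : 'rV[M]_k) (p : formula (n + k)),
    A = [set x | sat p (row_mx x a)].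

(* [f] matters only on [A]; its graph is a subset of M^(m + n). *)
Definition definable_map m n (A : set 'rV[M]_m) (f : 'rV[M]_m -> 'rV[M]_n) :=
  definable [set z : 'rV[M]_(m + n) | A (lsubmx z) /\ rsubmx z = f (lsubmx z)].

Definition uniformly_definable m n
    (T : set 'rV[M]_m) (F : 'rV[M]_m -> set 'rV[M]_n) :=
  definable T /\
  definable [set z : 'rV[M]_(m + n) | T (lsubmx z) /\ F (lsubmx z) (rsubmx z)].

Definition definable_skolem_functions :=
  forall m n (T : set 'rV[M]_m) (F : 'rV[M]_m -> set 'rV[M]_n),
    uniformly_definable T F -> (forall t, T t -> F t !=set0) ->
    exists f : 'rV[M]_m -> 'rV[M]_n,
      definable_map T f /\ (forall t, T t -> F t (f t)).

(* The usual convention: the underlying order is nonempty, dense and without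
   endpoints. In [o_minimal_union] the intervals may be open, closed or
   half-open, with endpoints in M or infinite; points are the intervals
   `[x, x]. *)
Record o_minimal : Prop := OMinimal {
  o_minimal_nonempty : [set: M] !=set0;
  o_minimal_dense : forall x y : M, x < y -> exists z, x < z < y;
  o_minimal_no_min : forall x : M, exists y, y < x;
  o_minimal_no_max : forall x : M, exists y, x < y;
  o_minimal_union : forall A : set M,
    definable [set x : 'rV[M]_1 | A (x ord0 ord0)] ->
    exists s : seq (interval M), A = \bigcup_(i in [set` s]) [set` i] }.

End Formulas.

(* Charts are total functions used only on their domains. In [transition_homeo]
   the function [g] is theta_j o theta_i^-1 on theta_i (X_i `&` X_j); its
   inverse is obtained by exchanging i and j. *)
Record definable_space d (M : orderTopologicalType d) (S : structure M) :=
  DefinableSpace {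
  carrier :> Type;
  ncharts : nat;
  chart_dim : 'I_ncharts -> nat;
  chart_dom : 'I_ncharts -> set carrier;
  chart : forall i, carrier -> 'rV[M]_(chart_dim i);
  chart_cover : \bigcup_i chart_dom i = [set: carrier];
  chart_inj : forall i, set_inj (chart_dom i) (chart i);
  chart_definable : forall i, definable S (chart i @` chart_dom i);
  overlap_definable : forall i j,
    definable S (chart i @` (chart_dom i `&` chart_dom j));
  overlap_open : forall i j,
    open (chart i @` (chart_dom i `&` chart_dom j) :
            set (subspace (chart i @` chart_dom i)));
  transition_homeo : forall i j,
    exists g : 'rV[M]_(chart_dim i) -> 'rV[M]_(chart_dim j),
      [/\ forall x, chart_dom i x -> chart_dom j x -> g (chart i x) = chart j x,
          definable_map S (chart i @` (chart_dom i `&` chart_dom j)) g &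
          {within chart i @` (chart_dom i `&` chart_dom j), continuous g}] }.

Section SpaceTopology.
Context d (M : orderTopologicalType d) (S : structure M).
Variable X : definable_space S.

HB.instance Definition _ := gen_eqMixin (carrier X).
HB.instance Definition _ := gen_choiceMixin (carrier X).

(* The topology in which each X_i is open and each theta_i is a homeomorphism
   onto theta_i(X_i). *)
Definition space_open (U : set X) : Prop :=
  forall i, open (chart i @` (U `&` chart_dom i) :
                    set (subspace (chart i @` chart_dom i))).

Lemma space_openT : space_open setT.
Proof. by move=> i; rewrite setTI; exact: open_subspaceT. Qed.

Lemma space_openI : setI_closed space_open.
Proof.
move=> U V oU oV i; have := openI (oU i) (oV i).
congr (open _); apply/seteqP; split => y /=.
- move=> [[x [Ux Xx] <-] [x' [Vx' Xx'] xx']]; exists x => //; split => //.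
  split => //; rewrite -(@chart_inj _ _ _ X i x' x) ?inE//.
- by move=> [x [[Ux Vx] Xx] <-]; split; exists x.
Qed.

Lemma space_open_bigU (I : Type) (f : I -> set X) :
  (forall i, space_open (f i)) -> space_open (\bigcup_i f i).
Proof.
move=> of_ i; rewrite setI_bigcupl image_bigcup.
by apply: bigcup_open => j _; exact: of_.
Qed.

HB.instance Definition _ := isOpenTopological.Build (carrier X)
  space_openT space_openI space_open_bigU.

End SpaceTopology.

Section SpaceNotions.
Context d (M : orderTopologicalType d) (S : structure M).
Variable X : definable_space S.

Definition definable_subset (A : set X) :=
  forall i, definable S (chart i @` (A `&` chart_dom i)).

(* Definability of f : A -> X, where A `<=` M^n has the inclusion as its
   single chart. *)
Definition definable_map_to n (A : set 'rV[M]_n) (f : 'rV[M]_n -> X) :=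
  forall j, definable_map S (A `&` f @^-1` chart_dom j) (chart j \o f).

Definition uniformly_definable_in m
    (T : set 'rV[M]_m) (F : 'rV[M]_m -> set X) :=
  definable S T /\
  forall i, definable S [set z : 'rV[M]_(m + chart_dim i) |
    T (lsubmx z) /\ (chart i @` (F (lsubmx z) `&` chart_dom i)) (rsubmx z)].

(* The open interval (a, b) is [Interval a b], where a is BRight x or -oo
   and b is BLeft y or +oo. *)
Definition definable_curve (a b : itv_bound M) (f : M -> X) :=
  [/\ itv_open_ends (Interval a b), a < b,
      {within [set` Interval a b], continuous f} &
      definable_map_to [set x : 'rV[M]_1 | x ord0 ord0 \in Interval a b]
                       (fun x => f (x ord0 ord0))].

(* The filters of t --> a+ and of t --> b-. *)
Definition after (a : itv_bound M) : set_system M :=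
  filter_from [set c | a < BLeft c] (fun c => [set` Interval a (BLeft c)]).

Definition before (b : itv_bound M) : set_system M :=
  filter_from [set c | BRight c < b] (fun c => [set` Interval (BRight c) b]).

Definition completable (a b : itv_bound M) (f : M -> X) :=
  (exists x : X, f @ after a --> x) /\ (exists x : X, f @ before b --> x).

Definition definably_compact :=
  forall (a b : itv_bound M) (f : M -> X),
    definable_curve a b f -> completable a b f.

Record is_type (alpha : set_system X) : Prop := IsType {
  type_definable : alpha `<=` definable_subset;
  type_setT : alpha setT;
  type_set0 : ~ alpha set0;
  type_setI : forall A B, alpha A -> alpha B -> alpha (A `&` B);
  type_subset : forall A B,
    alpha A -> definable_subset B -> A `<=` B -> alpha B;
  type_ultra : forall A, definable_subset A -> alpha A \/ alpha (~` A) }.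

Definition definable_type (alpha : set_system X) :=
  is_type alpha /\
  forall m (T : set 'rV[M]_m) (F : 'rV[M]_m -> set X),
    uniformly_definable_in T F ->
    exists Ta : set 'rV[M]_m,
      [/\ Ta `<=` T, definable S Ta &
          forall t, T t -> (alpha (F t) <-> Ta t)].

Definition is_limit (alpha : set_system X) (x : X) :=
  forall U : set X, open U -> definable_subset U -> U x -> alpha U.

End SpaceNotions.

(* Main.v *)
Require Import Defs.
From mathcomp Require Import all_boot all_order all_algebra.
From mathcomp Require Import all_classical.
From mathcomp Require Import topology.

Set Implicit Arguments.
Unset Strict Implicit.
Unset Printing Implicit Defensive.

Import Order.TTheory.

(* A definable curve determines the definable type of its germ at an endpoint,
   and a limit of that type is the missing limit of the curve.

   Conversely, assume that every definable map M -> X has limits along all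
   germs, let h : M^n x M -> X be definable and alpha a definable type on
   M^n x M with projection beta. If h_*alpha had no limit, Skolem functions
   would give a definable family of basic open sets U_x containing x and outside
   h_*alpha. If t = f(y) holds alpha-almost everywhere for a definable f, apply
   the induction hypothesis to beta and y |-> h(y, f(y)). Otherwise uniform
   finiteness yields p_x(y) < t in M or equal to -oo, definable in (x, y), such that
   almost everywhere h(y, e) is outside U_x for all e in (p_x(y), t]. Let k(x, y) be the limit of h(y, e) as e tends to p_x(y) from the
   right, and Z(x) the limit of k(x, .)_*beta, by induction. Preorder X by
   x <= x' iff p_x <= p_x' almost everywhere; then Z(x') is outside U_x whenever
   x <= x'. A definable total preorder has a cofinal definable curve, and the
   limit z of Z along it has U_z as a neighbourhood, which Z should avoid.

   Uniform finiteness is proved by induction on the number of parameters, as in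
   the cell decomposition theorem but without cells: the parameters u at which a
   family of finite sets A_u fails to vary nicely are finitely many, the
   cardinality of A_u is constant between them, and Skolem functions choose a
   sample u in each gap. *)

Local Open Scope classical_set_scope.
Local Open Scope ring_scope.
Local Open Scope order_scope.

(** * Definability calculus *)

Section Calculus.
Context d (M : orderTopologicalType d) (S : structure M).

(** The obstacle in the second half is that a candidate limit depends on the neighbourhood it is
    meant to contradict: each U_x yields its own p_x and its own Z(x). Moving p_x to the right is
    harmless: if p_x <= p_x', the points just after p_x'(y) still lie in (p_x(y), t], where h avoids
    U_x, so the later candidate also avoids the earlier neighbourhood. As no largest p_x need exist,
    the candidates are followed along a cofinal curve, and the hypothesis on maps from M is used
    once more to give them a limit. The induction runs on the source of h and not on X, so X enters
    only as a sort with a definable family of sets. Uniform finiteness makes p_x(y) a choice among a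
    fixed finite number of definable functions. Of the theory of functions of one variable, only
    continuity near every germ is required. It is obtained from one-sided semicontinuity in the four
    combinations of directions, so that the monotonicity theorem is not proved. *)

Fixpoint rename_term n m (r : 'I_n -> 'I_m) (t : term S n) : term S m :=
  match t with
  | Var i => Var S (r i)
  | App f args => App (fun j => rename_term r (args j))
  end.

Definition lift_renaming n m (r : 'I_n -> 'I_m) (i : 'I_(1 + n)) : 'I_(1 + m) :=
  match fintype.split i with inl j => lshift m j | inr j => rshift 1 (r j) end.

Fixpoint rename n m (r : 'I_n -> 'I_m) (p : formula S n) : formula S m :=
  match p with
  | Eq t u => Eq (rename_term r t) (rename_term r u)
  | Lt t u => Lt (rename_term r t) (rename_term r u)
  | Rel R args => Rel (fun j => rename_term r (args j))
  | Neg p => Neg (rename r p)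
  | And p q => And (rename r p) (rename r q)
  | Ex p => Ex (@rename _ (1 + m)%N (lift_renaming r) p)
  end.

Lemma eval_rename n m (r : 'I_n -> 'I_m) (t : term S n) (e : 'rV[M]_m) :
  Defs.eval e (rename_term r t) = Defs.eval (\row_i e ord0 (r i)) t.
Proof.
elim: t => [i|f args IH] /=; first by rewrite mxE.
by congr finterp; apply/rowP => j; rewrite !mxE.
Qed.

Lemma sat_rename n (p : formula S n) : forall m (r : 'I_n -> 'I_m) (e : 'rV[M]_m),
  sat (rename r p) e <-> sat p (\row_i e ord0 (r i)).
Proof.
elim: p => {n} [n t u|n t u|n R args|n p IH|n p IHp q IHq|n p IH] m r e /=.
- by rewrite !eval_rename.
- by rewrite !eval_rename.
- rewrite (_ : (\row_i _) = \row_i Defs.eval (\row_i0 e ord0 (r i0)) (args i)) //.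
  by apply/rowP => j; rewrite !mxE eval_rename.
- by rewrite IH.
- by rewrite IHp IHq.
- have E x : \row_i (row_mx (const_mx x : 'rV[M]_1) e : 'rV_(1 + m)) ord0
     (lift_renaming r i) =
     row_mx (const_mx x : 'rV[M]_1) (\row_i e ord0 (r i)) :> 'rV_(1 + n).
    apply/rowP => i; rewrite !mxE /lift_renaming.
    case: (@split_ordP 1 n i) => j _.
      by rewrite (unsplitK (inl j)) !mxE.
    by rewrite (unsplitK (inr (r j))) mxE.
  by split=> -[x]; [move/IH|move=> H]; exists x; [|apply/IH]; rewrite ?E// -E.
Qed.

(* A sort is a set in definable bijection with a definable subset of some M^n. *)
Class dsort (E : Type) := DSort {
  dim : nat;
  enc : E -> 'rV[M]_dim;
  enc_inj : injective enc;
  enc_range : definable S (range enc) }.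

Arguments dim {E} dsort.

(* The constants provide the parameters of definable sets. *)
Definition coordinate (E : Type) (s : dsort E) (c : E -> M) :=
  (exists j, forall x, c x = enc x ord0 j) \/ (exists a, forall x, c x = a).

(** The variables of [p] are filled by coordinate functions, instead of requiring that the image
    under [enc] be definable. Substituting a [bmap] then only composes the functions [c i], without
    a new formula; [ddef_encP] shows that both notions agree. *)
Definition ddef (E : Type) (s : dsort E) (P : E -> Prop) :=
  exists N (p : formula S N) (c : 'I_N -> E -> M),
    (forall i, coordinate s (c i)) /\ forall x, P x <-> sat p (\row_i c i x).

(** These maps pull coordinates back to coordinates, so [ddef] pulls back along them without a
    quantifier. General definable functions are the [dfun] below; substituting one costs an
    existential quantifier. *)
Definition bmap (E F : Type) (s : dsort E) (t : dsort F) (f : E -> F) :=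
  forall c, coordinate t c -> coordinate s (c \o f).

Section Boolean.
Context (E : Type) (s : dsort E).
Implicit Types P Q : E -> Prop.

Lemma ddef_iff P Q : (forall x, P x <-> Q x) -> ddef s P -> ddef s Q.
Proof.
move=> PQ [N [p [c [cb cP]]]]; exists N, p, c; split=> // x.
by rewrite -PQ.
Qed.

Lemma ddef_not P : ddef s P -> ddef s (fun x => ~ P x).
Proof.
move=> [N [p [c [cb cP]]]]; exists N, (Neg p), c; split=> // x /=.
by rewrite cP.
Qed.

Lemma ddef_and P Q : ddef s P -> ddef s Q -> ddef s (fun x => P x /\ Q x).
Proof.
move=> [N [p [c [cb cP]]]] [N' [p' [c' [cb' cP']]]].
pose c2 (i : 'I_(N + N')) := match fintype.split i with inl j => c j | inr j => c' j end.
exists (N + N')%N, (And (rename (lshift N') p) (rename (@rshift N N') p')), c2.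
split; first by move=> i; rewrite /c2; case: fintype.split.
move=> x /=; rewrite !sat_rename cP cP'.
rewrite (_ : \row_i (\row_i0 c2 i0 x) ord0 (lshift N' i) = \row_i c i x).
  rewrite (_ : \row_i (\row_i0 c2 i0 x) ord0 (rshift N i) = \row_i c' i x) //.
  by apply/rowP => i; rewrite !mxE /c2 (unsplitK (inr i)).
by apply/rowP => i; rewrite !mxE /c2 (unsplitK (inl i)).
Qed.

Lemma ddef_or P Q : ddef s P -> ddef s Q -> ddef s (fun x => P x \/ Q x).
Proof.
move=> dP dQ; apply: (ddef_iff (P := fun x => ~ (~ P x /\ ~ Q x))).
  by move=> x; rewrite -not_orP notK.
by apply/ddef_not/ddef_and; apply: ddef_not.
Qed.

Lemma ddef_imp P Q : ddef s P -> ddef s Q -> ddef s (fun x => P x -> Q x).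
Proof.
move=> dP dQ; apply: (ddef_iff (P := fun x => ~ P x \/ Q x)).
  by move=> x; rewrite implyE.
by apply/ddef_or => //; apply/ddef_not.
Qed.

Lemma ddef_equiv P Q : ddef s P -> ddef s Q -> ddef s (fun x => P x <-> Q x).
Proof. by move=> dP dQ; apply: ddef_and; apply: ddef_imp. Qed.

Lemma coordinate_const a : coordinate s (fun=> a).
Proof. by right; exists a. Qed.

Lemma ddef_coord_eq c1 c2 : coordinate s c1 -> coordinate s c2 ->
  ddef s (fun x => c1 x = c2 x).
Proof.
move=> b1 b2; exists 2, (Eq (Var S ord0) (Var S ord_max)).
exists (fun i => if i == ord0 then c1 else c2); split.
  by move=> i; case: eqP.
by move=> x /=; rewrite !mxE.
Qed.

Lemma ddef_coord_lt c1 c2 : coordinate s c1 -> coordinate s c2 ->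
  ddef s (fun x => c1 x < c2 x).
Proof.
move=> b1 b2; exists 2, (Lt (Var S ord0) (Var S ord_max)).
exists (fun i => if i == ord0 then c1 else c2); split.
  by move=> i; case: eqP.
by move=> x /=; rewrite !mxE.
Qed.

Lemma ddef_const (Q : Prop) : ddef s (fun=> Q).
Proof.
have dF : ddef s (fun=> False).
  (* Formulas have no symbol for falsity; a closed formula and its negation supply it. *)
  exists 0, (And (Ex (Eq (Var S ord0) (Var S ord0)))
                 (Neg (Ex (Eq (Var S ord0) (Var S ord0))))).
  exists (fun i : 'I_0 => False_rect (E -> M) (notF (ltn_ord i))).
  by split=> [[]|x] //=; split=> [[]|[h nh]]; apply: nh h.
have [q|q] := pselect Q.
  by apply: ddef_iff (ddef_not dF) => x; tauto.
by apply: ddef_iff dF => x; tauto.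
Qed.

Lemma ddef_comp_bmap F (t : dsort F) (f : E -> F) (P : F -> Prop) :
  bmap s t f -> ddef t P -> ddef s (P \o f).
Proof.
move=> bf [N [p [c [cb cP]]]]; exists N, p, (fun i => c i \o f).
by split=> [i|x] /=; [apply: bf|rewrite cP].
Qed.

Lemma ddef_forall_ord n (P : 'I_n -> E -> Prop) :
  (forall i, ddef s (P i)) -> ddef s (fun x => forall i, P i x).
Proof.
elim: n P => [|n IH] P dP.
  by apply: ddef_iff (ddef_const True) => x; split=> // _ [].
have dP' : ddef s (fun x => forall i : 'I_n, P (lift ord0 i) x) by apply: IH.
apply: ddef_iff (ddef_and (dP ord0) dP') => x; split=> [[P0 PS] i|H]; last by split.
by have [j ->|->] := unliftP ord0 i.
Qed.

Lemma ddef_exists_ord n (P : 'I_n -> E -> Prop) :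
  (forall i, ddef s (P i)) -> ddef s (fun x => exists i, P i x).
Proof.
move=> dP; apply: ddef_iff (ddef_not (@ddef_forall_ord n (fun i x => ~ P i x) _)).
  by move=> x; split=> [/existsNP[i /contrapT]|[i Pi /(_ i)]//]; exists i.
by move=> i; apply: ddef_not.
Qed.

End Boolean.

Lemma definable_ddef n (s : dsort 'rV[M]_n) (A : set 'rV[M]_n) :
  (forall j, coordinate s (fun x => x ord0 j)) -> definable S A -> ddef s A.
Proof.
move=> cs [k [a [p ->]]]; exists (n + k)%N, p.
exists (fun i x => row_mx x a ord0 i); split.
  move=> i; case: (split_ordP i) => j ->.
    have [[l H]|[b H]] := cs j; [left; exists l|right; exists b] => x;
      by rewrite row_mxEl H.
  by right; exists (a ord0 j) => x; rewrite row_mxEr.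
move=> x /=; rewrite (_ : \row_i _ = row_mx x a) //.
by apply/rowP => i; rewrite mxE.
Qed.

Lemma definable_of_coord n (A : set 'rV[M]_n) N (p : formula S N)
    (c : 'I_N -> 'rV[M]_n -> M) :
  (forall i, (exists j, forall x, c i x = x ord0 j) \/ exists a, forall x, c i x = a) ->
  (forall x, A x <-> sat p (\row_i c i x)) -> definable S A.
Proof.
move=> cb cP.
pose J i : option 'I_n := match pselect (exists j, forall x, c i x = x ord0 j) with
  | left H => Some (projT1 (cid H)) | right _ => None end.
have JS i j : J i = Some j -> forall x, c i x = x ord0 j.
  by rewrite /J; case: pselect => // H [<-] x; case: (cid H) => /=.
have JN i : J i = None -> exists a, forall x, c i x = a.
  by rewrite /J; case: pselect => // H _; case: (cb i).
(* Parameter slots need a value. Over an empty M there is none, but M^n then has at most one point,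
   so A is empty or everything and the sentence that M has a point, or its negation, defines it. *)
have [[m0]|nM] := pselect (inhabited M); last first.
  exists 0, (\row_(i < 0) False_rect M (notF (ltn_ord i))) => /=.
  have exF q : ~ exists x : M, q x by move=> [x _]; apply: nM (inhabits x).
  have [|/forallNP A0] := pselect (exists x, A x).
    case=> x Ax; exists (Neg (Ex (Eq (Var S ord0) (Var S ord0)))).
    apply/seteqP; split=> y /= _; first by move=> H; apply: exF H.
    suff -> : y = x by [].
    by apply/rowP => i; exfalso; apply: nM; exact: (inhabits (y ord0 i)).
  exists (Ex (Eq (Var S ord0) (Var S ord0))).
  by apply/seteqP; split=> y /= H; [case: (A0 _ H)|case: (exF _ H)].
(* Each variable owns a parameter slot; the slots of variables that are coordinates of x hold the
   dummy [m0]. *)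
pose a i := if J i is Some _ then m0 else c i (const_mx m0).
pose r (i : 'I_N) : 'I_(n + N) := if J i is Some j then lshift N j else rshift n i.
exists N, (\row_i a i), (rename r p); apply/seteqP.
have E x : \row_i (row_mx x (\row_i0 a i0) ord0 (r i)) = \row_i c i x.
  apply/rowP => i; rewrite !mxE /r; case Ji: (J i) => [j|].
    by rewrite (unsplitK (inl j)) (JS _ _ Ji).
  by rewrite (unsplitK (inr i)) mxE /a Ji; have [b H] := JN _ Ji; rewrite !H.
by split=> x /=; rewrite sat_rename E -cP.
Qed.

Lemma range_id n : definable S (range (id : 'rV[M]_n -> 'rV[M]_n)).
Proof.
have [N [p [c [cb cP]]]] : exists N (p : formula S N) (c : 'I_N -> 'rV[M]_n -> M),
    (forall i, exists j, forall x, c i x = x ord0 j) /\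
    forall x : 'rV[M]_n, True <-> sat p (\row_i c i x).
  exists 0, (Neg (Ex (Neg (Eq (Var S ord0) (Var S ord0))))).
  exists (fun i : 'I_0 => False_rect _ (notF (ltn_ord i))).
  by split=> [[]|x] //=; split=> // _ [].
apply: (definable_of_coord (p := p) (c := c)); first by move=> i; left.
by move=> x; rewrite -cP; split=> // _; exists x.
Qed.

#[local] Instance dsort_rV n : dsort 'rV[M]_n :=
  DSort (fun x y (e : id x = id y) => e) (range_id n).

Lemma coord_rV n j : coordinate (dsort_rV n) (fun x : 'rV[M]_n => x ord0 j).
Proof. by left; exists j. Qed.

Lemma definableP n (A : set 'rV[M]_n) : definable S A <-> ddef (dsort_rV n) A.
Proof.
split; first by apply: definable_ddef => j; apply: coord_rV.
by move=> [N [p [c [cb cP]]]]; apply: (definable_of_coord (p := p) (c := c)).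
Qed.

Lemma bmap_rV E (s : dsort E) n (f : E -> 'rV[M]_n) :
  (forall j, coordinate s (fun x => f x ord0 j)) -> bmap s (dsort_rV n) f.
Proof.
move=> H c [[j cj]|[a ca]]; last by right; exists a => x /=.
by have [[l Hl]|[b Hb]] := H j; [left; exists l|right; exists b] => x;
  rewrite /comp cj; [exact: Hl|exact: Hb].
Qed.

Lemma bmap_comp E F G (s : dsort E) (t : dsort F) (u : dsort G) (f : E -> F) (g : F -> G) :
  bmap s t f -> bmap t u g -> bmap s u (fun x => g (f x)).
Proof. by move=> bf bg c cc; apply: bf (bg _ cc). Qed.

Lemma definable_preimage m n (f : 'rV[M]_m -> 'rV[M]_n) (A : set 'rV[M]_n) :
  bmap (dsort_rV m) (dsort_rV n) f -> definable S A -> definable S (A \o f).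
Proof. by move=> bf /definableP dA; apply/definableP; apply: ddef_comp_bmap bf dA. Qed.

Lemma bmap_lsubmx m n : bmap (dsort_rV (m + n)) (dsort_rV m) lsubmx.
Proof. by apply: bmap_rV => j; left; exists (lshift n j) => x; rewrite mxE. Qed.

Lemma bmap_rsubmx m n : bmap (dsort_rV (m + n)) (dsort_rV n) rsubmx.
Proof. by apply: bmap_rV => j; left; exists (rshift m j) => x; rewrite mxE. Qed.

Section Product.
Context (E F : Type) (s : dsort E) (t : dsort F).

Definition enc_prod (z : E * F) : 'rV[M]_(dim s + dim t) := row_mx (enc z.1) (enc z.2).

Lemma enc_prod_inj : injective enc_prod.
Proof.
move=> [x y] [x' y'] /eq_row_mx[/= ex ey].
by congr (_, _); apply: enc_inj.
Qed.

Lemma enc_prod_range : definable S (range enc_prod).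
Proof.
have -> : range enc_prod =
   [set v | range (@enc _ s) (lsubmx v) /\ range (@enc _ t) (rsubmx v)].
  apply/seteqP; split=> [_ [[x y] _ <-]|v [[x _ ex] [y _ ey]]] /=.
    by rewrite /enc_prod row_mxKl row_mxKr; split; [exists x|exists y].
  by exists (x, y) => //; rewrite /enc_prod /= ex ey hsubmxK.
have dl := definable_preimage (@bmap_lsubmx (dim s) (dim t)) (enc_range (dsort := s)).
have dr := definable_preimage (@bmap_rsubmx (dim s) (dim t)) (enc_range (dsort := t)).
by apply/definableP; apply: ddef_and; apply/definableP.
Qed.

#[local] Instance dsort_prod : dsort (E * F) := DSort enc_prod_inj enc_prod_range.

Lemma bmap_fst : bmap dsort_prod s fst.
Proof.
move=> c [[j cj]|[a ca]]; last by right; exists a => x /=.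
by left; exists (lshift _ j) => x /=; rewrite /enc_prod row_mxEl cj.
Qed.

Lemma bmap_snd : bmap dsort_prod t snd.
Proof.
move=> c [[j cj]|[a ca]]; last by right; exists a => x /=.
by left; exists (rshift _ j) => x /=; rewrite /enc_prod row_mxEr cj.
Qed.

Lemma coordinate_prod c : coordinate dsort_prod c ->
  (exists2 c1, coordinate s c1 & c = c1 \o fst) \/
  (exists2 c1, coordinate t c1 & c = c1 \o snd).
Proof.
move=> [[j]|[a ca]].
  case: (split_ordP j) => i -> H.
    left; exists (fun x => enc x ord0 i); first by left; exists i.
    by apply: funext => x; rewrite H /= /enc_prod row_mxEl.
  right; exists (fun x => enc x ord0 i); first by left; exists i.
  by apply: funext => x; rewrite H /= /enc_prod row_mxEr.
left; exists (fun=> a); first by apply: coordinate_const.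
by apply: funext.
Qed.

Lemma bmap_pair G (u : dsort G) (f : G -> E) (g : G -> F) :
  bmap u s f -> bmap u t g -> bmap u dsort_prod (fun x => (f x, g x)).
Proof.
by move=> bf bg c /coordinate_prod[] [c1 cc ->]; [apply: (bf c1)|apply: (bg c1)].
Qed.

End Product.

Arguments bmap_fst {E F} s t c _ : rename.
Arguments bmap_snd {E F} s t c _ : rename.
Arguments bmap_pair {E F s t G u f g} _ _ c _ : rename.
Arguments bmap_comp {E F G s t u f g} _ _ c _ : rename.
Arguments bmap_rV {E s n f} _ c _ : rename.

Lemma bmap_const E F (s : dsort E) (t : dsort F) (y : F) : bmap s t (fun=> y).
Proof. by move=> c _; right; exists (c y). Qed.

Lemma bmap_id E (s : dsort E) : bmap s s id.
Proof. by move=> c. Qed.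

Lemma const_mx1_inj : injective (const_mx : M -> 'rV[M]_1).
Proof. by move=> x y /rowP/(_ ord0); rewrite !mxE. Qed.

Lemma const_mx1_range : definable S (range (const_mx : M -> 'rV[M]_1)).
Proof.
have := range_id 1; congr definable; apply/seteqP; split=> v //= [x _ <-].
  by exists (x ord0 ord0) => //; apply/rowP => i; rewrite mxE !ord1.
by exists (const_mx x).
Qed.

#[local] Instance dsort_base : dsort M := DSort const_mx1_inj const_mx1_range.

Lemma coordinate_base : coordinate dsort_base id.
Proof. by left; exists ord0 => x /=; rewrite mxE. Qed.

Lemma coordinate_bmap E (s : dsort E) (c : E -> M) :
  coordinate s c <-> bmap s dsort_base c.
Proof.
split=> [cc c' [[j H]|[a H]]|]; last 1 first.
- by move=> bc; apply: (bc id); apply: coordinate_base.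
- have -> : c' \o c = c by apply: funext => x /=; rewrite H mxE.
  by [].
- by right; exists a => x /=.
Qed.

(** A coordinate of E * M is either the last component, which becomes the variable bound by [Ex], or
    depends on E alone and is shifted past that variable. *)
Lemma ddef_ex_base E (s : dsort E) (P : E * M -> Prop) :
  ddef (dsort_prod s dsort_base) P -> ddef s (fun x => exists t, P (x, t)).
Proof.
move=> [N [p [c [cb cP]]]].
have [[m0]|nM] := pselect (inhabited M); last first.
  apply: ddef_iff (ddef_const s False) => x; split=> // -[m _].
  by apply: nM (inhabits m).
have cE i : (forall z, c i z = z.2) \/
    (exists2 c1, coordinate s c1 & forall z, c i z = c1 z.1).
  have [[c1 cc H]|[c1 [[j H']|[a H']] H]] := coordinate_prod (cb i).
  - by right; exists c1 => // z; rewrite H.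
  - by left=> z; rewrite H /= H' mxE.
  - right; exists (fun=> a); first by apply: coordinate_const.
    by move=> z; rewrite H /= H'.
have cE' i : {b : bool & {c1 | coordinate s c1 /\
    forall z, c i z = if b then z.2 else c1 z.1}}.
  have [H|H] := pselect (forall z, c i z = z.2).
    by exists true, (fun=> m0); split=> //; apply: coordinate_const.
  have /cid2[c1 cc H'] : exists2 c1, coordinate s c1 & forall z, c i z = c1 z.1.
    by have [] := cE i.
  by exists false, c1.
pose b i := projT1 (cE' i); pose c1 i := sval (projT2 (cE' i)).
have c1b i : coordinate s (c1 i) by case: (svalP (projT2 (cE' i))).
have c1E i z : c i z = if b i then z.2 else c1 i z.1.
  by case: (svalP (projT2 (cE' i))).
pose r (i : 'I_N) : 'I_(1 + N) := if b i then lshift N ord0 else rshift 1 i.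
exists N, (Ex (@rename N (1 + N)%N r p)), c1; split=> // x /=.
have E0 m : \row_i (row_mx (const_mx m : 'rV_1) (\row_i c1 i x) : 'rV_(1 + N)) ord0 (r i)
   = \row_i c i (x, m).
  apply/rowP => i; rewrite !mxE c1E /r; case: (b i) => /=.
    by rewrite (unsplitK (inl ord0)) mxE.
  by rewrite (unsplitK (inr i)) mxE.
split=> -[m H]; exists m.
  by apply/sat_rename; rewrite E0 -cP.
by move/sat_rename: H; rewrite E0 -cP.
Qed.

Lemma ddef_ex_rV n : forall E (s : dsort E) (P : E * 'rV[M]_n -> Prop),
  ddef (dsort_prod s (dsort_rV n)) P -> ddef s (fun x => exists w, P (x, w)).
Proof.
elim: n => [|n IH] E s P dP.
  pose w0 : 'rV[M]_0 := \row_(i < 0) False_rect M (notF (ltn_ord i)).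
  apply: (ddef_iff (P := P \o (fun x => (x, w0)))) => [x|].
    split=> [H|[w]]; first by exists w0.
    by rewrite (_ : w = w0) //; apply/rowP => -[].
  apply: (ddef_comp_bmap _ dP).
  by apply: bmap_pair; [apply: bmap_id|apply: bmap_const].
pose f (z : (E * M) * 'rV[M]_n) : E * 'rV[M]_(n.+1) :=
  (z.1.1, row_mx (const_mx z.1.2 : 'rV_1) z.2 : 'rV_(1 + n)).
have dPf : ddef (dsort_prod (dsort_prod s dsort_base) (dsort_rV n)) (P \o f).
  apply: (ddef_comp_bmap _ dP); apply: bmap_pair.
    refine (bmap_comp (bmap_fst (dsort_prod s dsort_base) (dsort_rV n))
                      (bmap_fst s dsort_base)).
  apply: bmap_rV => j; case: (@split_ordP 1 n j) => i -> /=.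
    have := bmap_comp (bmap_fst (dsort_prod s dsort_base) (dsort_rV n))
                      (bmap_snd s dsort_base) _ coordinate_base.
    congr coordinate; apply: funext => z /=.
    by apply: esym; apply: (etrans (@row_mxEl _ 1 1 n _ _ _ _)); rewrite mxE.
  have := bmap_snd (dsort_prod s dsort_base) (dsort_rV n) _ (coord_rV i).
  by congr coordinate; apply: funext => z /=; apply: esym; apply: (@row_mxEr _ 1 1 n).
apply: ddef_iff (ddef_ex_base (IH _ _ _ dPf)) => x; split.
  by move=> [t [w]]; exists (row_mx (const_mx t : 'rV_1) w).
move=> [w Pw]; exists (w ord0 ord0), (rsubmx (w : 'rV_(1 + n))).
suff E0 : (x, w) = f (x, w ord0 ord0, rsubmx (w : 'rV_(1 + n))).
  by rewrite /comp -E0.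
congr (_, _) => /=; apply: (etrans (esym (@hsubmxK _ 1 1 n w))).
congr row_mx.
by apply/rowP => i; rewrite !mxE ord1; congr (w _ _); apply: val_inj.
Qed.

Lemma ddef_range E (s : dsort E) : ddef (dsort_rV (dim s)) (range enc).
Proof. exact/definableP/enc_range. Qed.

Lemma ddef_encP E (s : dsort E) (P : E -> Prop) :
  ddef s P <-> ddef (dsort_rV (dim s)) (enc @` P).
Proof.
split=> [[N [p [c [cb cP]]]]|dP]; last first.
  have be : bmap s (dsort_rV (dim s)) enc by apply: bmap_rV => j; left; exists j.
  apply: ddef_iff (ddef_comp_bmap be dP) => x; split=> [[y Py e]|Px]; [by rewrite -(enc_inj e)|].
  by exists x.
have cE i : exists c1, coordinate (dsort_rV (dim s)) c1 /\ forall x, c i x = c1 (enc x).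
  case: (cb i) => [[j H]|[a H]]; last by exists (fun=> a); split=> //; apply: coordinate_const.
  by exists (fun v => v ord0 j); split=> //; apply: coord_rV.
pose c1 i := sval (cid (cE i)).
have c1P i : coordinate (dsort_rV (dim s)) (c1 i) /\ forall x, c i x = c1 i (enc x).
  exact: (svalP (cid (cE i))).
have dQ : ddef (dsort_rV (dim s)) (fun v => sat p (\row_i c1 i v)).
  by exists N, p, c1; split=> // i; case: (c1P i).
apply: ddef_iff (ddef_and (ddef_range s) dQ) => v /=.
have cEx x : \row_i c i x = \row_i c1 i (enc x).
  by apply/rowP => i; rewrite !mxE; case: (c1P i).
split=> [[[x _ <-]]|[x Px <-]]; last by split; [exists x|rewrite -cEx -cP].
by rewrite -cEx -cP; exists x.
Qed.

(** Quantification over F becomes quantification over rows of length [dim t]; membership in the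
    image under [enc] already forces the row to be a code. *)
Lemma ddef_ex E F (s : dsort E) (t : dsort F) (P : E -> F -> Prop) :
  ddef (dsort_prod s t) (fun z => P z.1 z.2) -> ddef s (fun x => exists y, P x y).
Proof.
move=> /ddef_encP dP.
pose f (z : E * 'rV[M]_(dim t)) := row_mx (enc z.1) z.2 : 'rV[M]_(dim s + dim t).
have bf : bmap (dsort_prod s (dsort_rV (dim t))) (dsort_rV (dim s + dim t)) f.
  apply: bmap_rV => j; case: (split_ordP j) => i -> /=.
    have := bmap_fst s (dsort_rV (dim t)) _ (or_introl (ex_intro _ i (fun x => erefl (enc x ord0 i)))).
    by congr coordinate; apply: funext => z /=; rewrite row_mxEl.
  have := bmap_snd s (dsort_rV (dim t)) _ (coord_rV i).
  by congr coordinate; apply: funext => z /=; rewrite row_mxEr.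
apply: ddef_iff (ddef_ex_rV (ddef_comp_bmap bf dP)) => x.
split=> [[w [[x' y]] /= Pxy /eq_row_mx[/= ex _]]|[y Pxy]].
  by exists y; rewrite -(enc_inj ex).
by exists (enc y); exists (x, y).
Qed.

Lemma ddef_all E F (s : dsort E) (t : dsort F) (P : E -> F -> Prop) :
  ddef (dsort_prod s t) (fun z => P z.1 z.2) -> ddef s (fun x => forall y, P x y).
Proof.
move=> dP; apply: (ddef_iff (P := fun x => ~ exists y, ~ P x y)).
  move=> x; split=> [H y|H [y]]; last by apply; apply: H.
  by apply: contrapT => nP; apply: H; exists y.
by apply/ddef_not/(ddef_ex (P := fun x y => ~ P x y))/ddef_not.
Qed.

Definition dfun E F (s : dsort E) (t : dsort F) (f : E -> F) :=
  ddef (dsort_prod s t) (fun z => z.2 = f z.1).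

Section Functions.
Context (E F G : Type) (s : dsort E) (t : dsort F) (u : dsort G).

Lemma ddef_eq0 : ddef (dsort_prod t t) (fun z => z.1 = z.2).
Proof.
have := @ddef_forall_ord _ (dsort_prod t t) (dim t)
  (fun j z => enc z.1 ord0 j = enc z.2 ord0 j) _.
have H : forall j, coordinate t (fun x => enc x ord0 j) by move=> j; left; exists j.
move=> /(_ (fun j => ddef_coord_eq (bmap_fst t t _ (H j)) (bmap_snd t t _ (H j)))).
apply: ddef_iff => -[x y] /=; split=> [e|-> //].
by apply: enc_inj; apply/rowP => i.
Qed.

Lemma dfun_bmap (f : E -> F) : bmap s t f -> dfun s t f.
Proof.
move=> bf; apply: (ddef_comp_bmap (f := fun z : E * F => (z.2, f z.1)) _ ddef_eq0).
apply: bmap_pair; first by apply: bmap_snd.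
exact: bmap_comp (bmap_fst _ _) bf.
Qed.

Lemma ddef_comp (f : E -> F) (P : F -> Prop) :
  dfun s t f -> ddef t P -> ddef s (fun x => P (f x)).
Proof.
move=> df dP; apply: (ddef_iff (P := fun x => exists y, y = f x /\ P y)).
  by move=> x; split=> [[y [->]]//|]; exists (f x).
apply: ddef_ex; apply: ddef_and => //.
exact: (ddef_comp_bmap (bmap_snd s t) dP).
Qed.

Lemma dfun_pair (f : E -> F) (g : E -> G) :
  dfun s t f -> dfun s u g -> dfun s (dsort_prod t u) (fun x => (f x, g x)).
Proof.
move=> df dg.
pose h1 (z : E * (F * G)) := (z.1, z.2.1); pose h2 (z : E * (F * G)) := (z.1, z.2.2).
have b1 : bmap (dsort_prod s (dsort_prod t u)) (dsort_prod s t) h1.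
  by apply: bmap_pair; [apply: bmap_fst|apply: bmap_comp (bmap_snd _ _) (bmap_fst _ _)].
have b2 : bmap (dsort_prod s (dsort_prod t u)) (dsort_prod s u) h2.
  by apply: bmap_pair; [apply: bmap_fst|apply: bmap_comp (bmap_snd _ _) (bmap_snd _ _)].
apply: ddef_iff (ddef_and (ddef_comp_bmap b1 df) (ddef_comp_bmap b2 dg)).
by move=> [x [y z]] /=; split=> [[-> ->]|[]].
Qed.

End Functions.

Section Substitution.
Context (E F G : Type) (s : dsort E) (t : dsort F) (u : dsort G).

Lemma dfun_comp (f : E -> F) (g : F -> G) :
  dfun s t f -> dfun t u g -> dfun s u (fun x => g (f x)).
Proof.
move=> df dg; apply: (ddef_comp (f := fun z : E * G => (f z.1, z.2)) _ dg).
apply: dfun_pair; last by apply/dfun_bmap/bmap_snd.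
apply: (ddef_iff (P := fun z : (E * G) * F => (z.1.1, z.2).2 = f (z.1.1, z.2).1)) => //.
apply: (ddef_comp_bmap (f := fun z : (E * G) * F => (z.1.1, z.2)) _ df).
by apply: bmap_pair; [apply: bmap_comp (bmap_fst _ _) (bmap_fst _ _)|apply: bmap_snd].
Qed.

Lemma ddef_eq (f g : E -> F) :
  dfun s t f -> dfun s t g -> ddef s (fun x => f x = g x).
Proof.
move=> df dg; exact: (ddef_comp (dfun_pair df dg) (ddef_eq0 t)).
Qed.

Lemma ddef_lt (f g : E -> M) :
  dfun s dsort_base f -> dfun s dsort_base g -> ddef s (fun x => f x < g x).
Proof.
move=> df dg; apply: (ddef_comp (f := fun x => (f x, g x))
  (P := fun z : M * M => z.1 < z.2) (dfun_pair df dg)).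
by apply: ddef_coord_lt; apply/coordinate_bmap; [apply: bmap_fst|apply: bmap_snd].
Qed.

Lemma ddef_le (f g : E -> M) :
  dfun s dsort_base f -> dfun s dsort_base g -> ddef s (fun x => f x <= g x).
Proof.
move=> df dg; apply: (ddef_iff (P := fun x => ~ (g x < f x))).
  by move=> x; rewrite leNgt; split=> /negP.
by apply/ddef_not/ddef_lt.
Qed.

End Substitution.

End Calculus.

Arguments dim {d M S E} dsort.
Arguments enc {d M S E dsort} _.
Arguments ddef {d M} S {E s} P.
Arguments dfun {d M} S {E F s t} f.
#[global] Existing Instance dsort_rV.
#[global] Existing Instance dsort_prod.
#[global] Existing Instance dsort_base.

(** * Automatic proofs of definability *)

Section Rules.
Context d (M : orderTopologicalType d) (S : structure M).

Definition ddef2 E F (s : dsort S E) (t : dsort S F) (R : E -> F -> Prop) :=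
  ddef S (fun z => R z.1 z.2).
Definition ddef3 E F G (s : dsort S E) (t : dsort S F) (u : dsort S G)
  (R : E -> F -> G -> Prop) := ddef S (fun z => R z.1.1 z.1.2 z.2).
Definition dfun2 E F G (s : dsort S E) (t : dsort S F) (u : dsort S G)
  (f : E -> F -> G) := dfun S (fun z => f z.1 z.2).

Lemma dfun_id E (s : dsort S E) : dfun S (fun x : E => x).
Proof. by apply: dfun_bmap; apply: bmap_id. Qed.

Lemma dfun_const E F (s : dsort S E) (t : dsort S F) y : dfun S (fun x : E => y : F).
Proof. by apply: dfun_bmap; apply: bmap_const. Qed.

Section Composition.
Context E F G K (s : dsort S E) (t : dsort S F) (u : dsort S G) (v : dsort S K).

Lemma dfun_fst (f : E -> F * G) : dfun S f -> dfun S (fun x => (f x).1).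
Proof.
by move=> df; apply: (dfun_comp (g := fst) df); apply: dfun_bmap; apply: bmap_fst.
Qed.

Lemma dfun_snd (f : E -> F * G) : dfun S f -> dfun S (fun x => (f x).2).
Proof.
by move=> df; apply: (dfun_comp (g := snd) df); apply: dfun_bmap; apply: bmap_snd.
Qed.

Lemma ddef2_comp (R : F -> G -> Prop) (f : E -> F) (g : E -> G) :
  ddef2 _ _ R -> dfun S f -> dfun S g -> ddef S (fun x => R (f x) (g x)).
Proof. by move=> dR df dg; apply: (ddef_comp (dfun_pair df dg) dR). Qed.

Lemma ddef3_comp (R : F -> G -> K -> Prop) (f : E -> F) (g : E -> G) (h : E -> K) :
  ddef3 _ _ _ R -> dfun S f -> dfun S g -> dfun S h -> ddef S (fun x => R (f x) (g x) (h x)).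
Proof.
by move=> dR df dg dh; apply: (ddef_comp (dfun_pair (dfun_pair df dg) dh) dR).
Qed.

Lemma dfun2_comp (k : F -> G -> K) (f : E -> F) (g : E -> G) :
  dfun2 _ _ _ k -> dfun S f -> dfun S g -> dfun S (fun x => k (f x) (g x)).
Proof. by move=> dR df dg; apply: (dfun_comp (dfun_pair df dg) dR). Qed.

Lemma ddef_all_bool (P : bool -> E -> Prop) :
  (forall b, ddef S (P b)) -> ddef S (fun x => forall b, P b x).
Proof.
move=> dP; apply: ddef_iff (ddef_and (dP true) (dP false)) => x.
by split=> [[? ?] []|H]; last split.
Qed.

End Composition.

End Rules.

Arguments ddef2 {d M} S {E F s t} R.
Arguments ddef3 {d M} S {E F G s t u} R.
Arguments dfun2 {d M} S {E F G s t u} f.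

(** The rules follow the syntax of the goal, and hypotheses of the context act as the symbols of the
    language. Hence proofs collect facts such as [ddef2 S R] or [dfun S f] before calling the
    tactic. *)
Ltac definability_step :=
  match goal with
  | |- ddef2 _ _ => unfold ddef2
  | |- ddef3 _ _ => unfold ddef3
  | |- dfun2 _ _ => unfold dfun2
  | |- ddef _ (fun _ => ?Q) => refine (ddef_const _ Q)
  | H : ddef _ ?P |- ddef _ ?P => exact H
  | |- ddef _ (fun x => @?P x /\ @?Q x) => refine (@ddef_and _ _ _ _ _ P Q _ _)
  | |- ddef _ (fun x => @?P x \/ @?Q x) => refine (@ddef_or _ _ _ _ _ P Q _ _)
  | |- ddef _ (fun x => @?P x <-> @?Q x) => refine (@ddef_equiv _ _ _ _ _ P Q _ _)
  | |- ddef _ (fun x => ~ @?P x) => refine (@ddef_not _ _ _ _ _ P _)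
  | |- ddef _ (fun x => @?P x -> @?Q x) => refine (@ddef_imp _ _ _ _ _ P Q _ _)
  | |- ddef _ (fun x => forall b : bool, @?P b x) =>
      refine (@ddef_all_bool _ _ _ _ _ P _); intro
  | |- ddef _ (fun x => forall b : 'I_?n, @?P b x) =>
      refine (@ddef_forall_ord _ _ _ _ _ n P _); intro
  | |- ddef _ (fun x => exists b : 'I_?n, @?P b x) =>
      refine (@ddef_exists_ord _ _ _ _ _ n P _); intro
  | |- ddef _ (fun x => exists y : ?F, @?P x y) => refine (@ddef_ex _ _ _ _ F _ _ P _)
  | |- ddef _ (fun x => forall y : ?F, @?P x y) => refine (@ddef_all _ _ _ _ F _ _ P _)
  | |- ddef _ (fun x => is_true (Order.lt (@?f x) (@?g x))) =>
      refine (@ddef_lt _ _ _ _ _ f g _ _)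
  | |- ddef _ (fun x => is_true (Order.le (@?f x) (@?g x))) =>
      refine (@ddef_le _ _ _ _ _ f g _ _)
  | |- ddef _ (fun x => @?f x = @?g x) => refine (@ddef_eq _ _ _ _ _ _ _ f g _ _)
  | H : ddef3 _ ?R |- ddef _ (fun x => ?R (@?f x) (@?g x) (@?h x)) =>
      refine (@ddef3_comp _ _ _ _ _ _ _ _ _ _ _ R f g h H _ _ _)
  | H : ddef2 _ ?R |- ddef _ (fun x => ?R (@?f x) (@?g x)) =>
      refine (@ddef2_comp _ _ _ _ _ _ _ _ _ R f g H _ _)
  | H : ddef _ ?R |- ddef _ (fun x => ?R (@?f x)) =>
      refine (@ddef_comp _ _ _ _ _ _ _ f R _ H)
  | H : forall i, ddef _ (?R i) |- ddef _ (fun x => ?R ?j (@?f x)) =>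
      refine (@ddef_comp _ _ _ _ _ _ _ f (R j) _ (H j))
  | H : forall i, ddef2 _ (?R i) |- ddef _ (fun x => ?R ?j (@?f x) (@?g x)) =>
      refine (@ddef2_comp _ _ _ _ _ _ _ _ _ (R j) f g (H j) _ _)
  | H : forall i, dfun _ (?k i) |- dfun _ (fun x => ?k ?j (@?f x)) =>
      refine (@dfun_comp _ _ _ _ _ _ _ _ _ f (k j) _ (H j))
  | |- dfun _ (fun x => x) => refine (dfun_id _)
  | |- dfun _ (fun _ => ?y) => refine (dfun_const _ _ y)
  | H : dfun _ ?f |- dfun _ ?f => exact H
  | |- dfun _ (fun x => (@?f x).1) => refine (@dfun_fst _ _ _ _ _ _ _ _ _ f _)
  | |- dfun _ (fun x => (@?f x).2) => refine (@dfun_snd _ _ _ _ _ _ _ _ _ f _)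
  | |- dfun _ (fun x => (@?f x, @?g x)) => refine (@dfun_pair _ _ _ _ _ _ _ _ _ f g _ _)
  | H : dfun2 _ ?k |- dfun _ (fun x => ?k (@?f x) (@?g x)) =>
      refine (@dfun2_comp _ _ _ _ _ _ _ _ _ _ _ k f g H _ _)
  | H : dfun _ ?k |- dfun _ (fun x => ?k (@?f x)) =>
      refine (@dfun_comp _ _ _ _ _ _ _ _ _ f k _ H)
  | |- dfun _ fst => refine (dfun_fst (dfun_id _))
  | |- dfun _ snd => refine (dfun_snd (dfun_id _))
  | |- ddef _ (fun x => ?R (@?f x)) =>
      refine (@ddef_comp _ _ _ _ _ _ _ f R _ _); [|solve [auto]]
  end; cbv beta.

Ltac definability := repeat definability_step.

(** * One-variable definable sets *)

Section Directions.
Context d (M : orderTopologicalType d).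
Implicit Types (b : bool) (x y z t : M) (o : option M) (A : M -> Prop).

(* Most one-sided statements are needed on both sides and, for functions, for
   both orders of the values; the boolean b selects < or >. *)
Definition dlt b x y := if b then x < y else y < x.
Definition dle b x y := if b then x <= y else y <= x.
Definition olt b o y := if o is Some x then dlt b x y else true.

Lemma dlt_trans b y x z : dlt b x y -> dlt b y z -> dlt b x z.
Proof. by case: b => /= H1 H2; [apply: lt_trans H2|apply: lt_trans H1]. Qed.
Lemma dle_trans b y x z : dle b x y -> dle b y z -> dle b x z.
Proof. by case: b => /= H1 H2; [apply: le_trans H2|apply: le_trans H1]. Qed.
Lemma dlt_dle_trans b y x z : dlt b x y -> dle b y z -> dlt b x z.
Proof. by case: b => /= H1 H2; [apply: lt_le_trans H2|apply: le_lt_trans H1]. Qed.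
Lemma dle_dlt_trans b y x z : dle b x y -> dlt b y z -> dlt b x z.
Proof. by case: b => /= H1 H2; [apply: le_lt_trans H2|apply: lt_le_trans H1]. Qed.
Lemma dltxx b x : dlt b x x -> False.
Proof. by case: b => /=; rewrite ltxx. Qed.
Lemma dlexx b x : dle b x x.
Proof. by case: b => /=. Qed.
Lemma dltW b x y : dlt b x y -> dle b x y.
Proof. by case: b => /= /ltW. Qed.
Lemma dltNge b x y : ~ dlt b x y <-> dle b y x.
Proof. by case: b => /=; rewrite leNgt; split=> /negP. Qed.
Lemma dleNgt b x y : ~ dle b x y <-> dlt b y x.
Proof. by case: b => /=; rewrite ltNge; split=> /negP. Qed.
Lemma dlt_total b x y : dlt b x y \/ x = y \/ dlt b y x.
Proof. by case: b => /=; case: (ltgtP x y); auto. Qed.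
Lemma dle_eqVlt b x y : dle b x y <-> x = y \/ dlt b x y.
Proof.
case: b => /=; rewrite le_eqVlt.
  by split=> [/orP[/eqP|]|[->|->]]; rewrite ?eqxx ?orbT; auto.
by split=> [/orP[/eqP|]|[->|->]]; rewrite ?eqxx ?orbT; auto.
Qed.
Lemma dltN b x y : dlt (~~ b) x y = dlt b y x.
Proof. by case: b. Qed.
Lemma dleN b x y : dle (~~ b) x y = dle b y x.
Proof. by case: b. Qed.

(* The germ on the b-side of o, where None is the infinite endpoint: near true
   (Some a) is t -> a+, near true None is t -> -oo, near false None is t -> +oo. *)
Definition near b o A := exists c, olt b o c /\ forall t, olt b o t -> dlt b t c -> A t.

Lemma near_mono b o A B : (forall t, olt b o t -> A t -> B t) -> near b o A -> near b o B.
Proof. by move=> AB [c [oc cA]]; exists c; split=> // t ot tc; apply: AB (cA _ ot tc). Qed.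

Lemma near_and b o A B : near b o A -> near b o B -> near b o (fun t => A t /\ B t).
Proof.
move=> [c [oc cA]] [c' [oc' cB]].
have [cc'|[e|cc']] := dlt_total b c c'; [exists c|exists c|exists c']; split=> // t ot tc.
- by split; [apply: cA|apply: cB => //; apply: dlt_trans tc cc'].
- by split; [apply: cA|apply: cB; rewrite -?e].
- by split; [apply: cA => //; apply: dlt_trans tc cc'|apply: cB].
Qed.

Lemma near_olt b o c : olt b o c -> near b o (fun t => olt b o t /\ dlt b t c).
Proof. by move=> oc; exists c. Qed.

Lemma near_all b o A : (exists c, olt b o c) -> (forall t, A t) -> near b o A.
Proof. by move=> [c oc] H; exists c; split. Qed.

End Directions.

(* A decision procedure for the order: saturation under transitivity. *)
Ltac ordstep :=
  match goal with
  | H : is_true (dlt false ?x ?y) |- _ => change (is_true (dlt true y x)) in H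
  | H : is_true (dle false ?x ?y) |- _ => change (is_true (dle true y x)) in H
  | H : is_true (dlt _ ?x ?x) |- _ => case: (dltxx H)
  | H : is_true (?x < ?y) |- _ => change (is_true (dlt true x y)) in H
  | H : is_true (?x <= ?y) |- _ => change (is_true (dle true x y)) in H
  | H1 : ~ is_true (dlt ?b ?x ?y) |- _ => move/dltNge in H1
  | H1 : ~ is_true (dle ?b ?x ?y) |- _ => move/dleNgt in H1
  | H1 : is_true (dlt ?b ?x ?y), H2 : is_true (dlt ?b ?y ?z) |- _ =>
     lazymatch goal with H : is_true (dlt b x z) |- _ => fail
     | _ => have ? := dlt_trans H1 H2 end
  | H1 : is_true (dlt ?b ?x ?y), H2 : is_true (dle ?b ?y ?z) |- _ =>
     lazymatch goal with H : is_true (dlt b x z) |- _ => fail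
     | _ => have ? := dlt_dle_trans H1 H2 end
  | H1 : is_true (dle ?b ?x ?y), H2 : is_true (dlt ?b ?y ?z) |- _ =>
     lazymatch goal with H : is_true (dlt b x z) |- _ => fail
     | _ => have ? := dle_dlt_trans H1 H2 end
  | H1 : is_true (dle ?b ?x ?y), H2 : is_true (dle ?b ?y ?z) |- _ =>
     lazymatch goal with H : is_true (dle b x z) |- _ => fail
     | _ => have ? := dle_trans H1 H2 end
  end.

Ltac ord_goal :=
  match goal with
  | |- is_true (dlt ?b ?x ?y) => apply/dleNgt => ?
  | |- is_true (dle ?b ?x ?y) => apply/dltNge => ?
  | |- ?G => exfalso
  end.
Ltac ord := cbn [olt] in *; try done; subst; ord_goal; repeat ordstep.

Lemma ddef_dlt d (M : orderTopologicalType d) (S : structure M) b E (s : dsort S E) (f g : E -> M) :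
  dfun S f -> dfun S g -> ddef S (fun x => dlt b (f x) (g x)).
Proof. by move=> df dg; case: b => /=; definability. Qed.
Lemma ddef_dle d (M : orderTopologicalType d) (S : structure M) b E (s : dsort S E) (f g : E -> M) :
  dfun S f -> dfun S g -> ddef S (fun x => dle b (f x) (g x)).
Proof. by move=> df dg; case: b => /=; definability. Qed.
Lemma ddef_near d (M : orderTopologicalType d) (S : structure M) b E (s : dsort S E) (f : E -> M)
   (R : E -> M -> Prop) :
  dfun S f -> ddef2 S R -> ddef S (fun x => near b (Some (f x)) (R x)).
Proof.
by move=> df dR; rewrite /near /olt /dlt; case: b; definability.
Qed.
Lemma ddef_near_inf d (M : orderTopologicalType d) (S : structure M) b E (s : dsort S E)
   (R : E -> M -> Prop) :
  ddef2 S R -> ddef S (fun x => near b None (R x)).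
Proof. by move=> dR; rewrite /near /olt /dlt; case: b; definability. Qed.

Ltac definability_order_step :=
  match goal with
  | |- ddef _ (fun x => is_true (dlt ?b (@?f x) (@?g x))) =>
      refine (@ddef_dlt _ _ _ b _ _ f g _ _)
  | |- ddef _ (fun x => is_true (dle ?b (@?f x) (@?g x))) =>
      refine (@ddef_dle _ _ _ b _ _ f g _ _)
  | |- ddef _ (fun x => near ?b (Some (@?f x)) (@?R x)) =>
      refine (@ddef_near _ _ _ b _ _ f R _ _)
  | |- ddef _ (fun x => near ?b None (fun t => @?R x t)) =>
      refine (@ddef_near_inf _ _ _ b _ _ R _)
  end; cbv beta.
Ltac definability ::= repeat (first [definability_order_step | definability_step]).

Section OneDim.
Context d (M : orderTopologicalType d) (S : structure M) (om : o_minimal S).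
Implicit Types (b : bool) (x y z t : M) (o : option M) (A : M -> Prop).

Lemma dense b x y : dlt b x y -> exists z, dlt b x z /\ dlt b z y.
Proof.
by case: b => /= /(o_minimal_dense om)[z /andP[? ?]]; exists z.
Qed.

Lemma unbounded b x : exists y, dlt b x y.
Proof.
by case: b => /=; [have [y] := o_minimal_no_max om x|have [y] := o_minimal_no_min om x]; exists y.
Qed.

Lemma olt_ex b o : exists c, olt b o c.
Proof.
case: o => [x|] /=; first exact: unbounded.
by have [x _] := o_minimal_nonempty om; exists x.
Qed.

Lemma olt_dense b o c : olt b o c -> exists z, olt b o z /\ dlt b z c.
Proof.
case: o => [x|_] /=; first exact: dense.
by have [z] := unbounded (~~ b) c; rewrite dltN; exists z.
Qed.

Lemma near_ex b o A : near b o A -> exists t, olt b o t /\ A t.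
Proof. by move=> [c [/[dup] oc /olt_dense[z [oz zc]] cA]]; exists z; split=> //; apply: cA. Qed.

Lemma near_contra b o A : near b o A -> near b o (fun t => ~ A t) -> False.
Proof. by move=> nA nB; have [t [_ []]] := near_ex (near_and nA nB). Qed.

Lemma intervals A : ddef S A -> exists s : seq (interval M),
  forall t, A t <-> exists2 i, i \in s & t \in i.
Proof.
move=> dA; have dA1 : definable S [set x : 'rV[M]_1 | A (x ord0 ord0)].
  apply/definableP; apply: (ddef_comp (f := fun x : 'rV[M]_1 => x ord0 ord0) _ dA).
  by apply: dfun_bmap; apply/coordinate_bmap/coord_rV.
have [s ->] := o_minimal_union om dA1; exists s => t.
by split=> -[i]; exists i.
Qed.

Lemma near_side b o x : near b o (fun t => dlt b t x) \/ near b o (fun t => dlt b x t).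
Proof.
case E : (olt b o x).
  by left; apply: near_mono (near_olt E) => t _ [].
right; have [c oc] := olt_ex b o; apply: near_mono (near_olt oc) => t _ [].
by case: o E {oc} => [a|]//= /negP ? ? ?; ord.
Qed.

Lemma near_itv b o (i : interval M) :
  near b o (fun t => t \in i) \/ near b o (fun t => t \notin i).
Proof.
have near_true : near b o (fun=> true) by apply: near_all => //; apply: olt_ex.
have K x : (near b o (fun t => t < x) \/ near b o (fun t => x < t)).
  by have := near_side b o x; case: b {near_true}; tauto.
have Kl u : near b o (fun t => u <= BLeft t) \/ near b o (fun t => ~~ (u <= BLeft t)).
  case: u => [l x|[]]; [|by left|by right].
  by have [tx|tx] := K x; [right; apply: near_mono tx|left; apply: near_mono tx] => t _ h;
    case: l; rewrite bnd_simp ?(ltW h) // -?ltNge -?leNgt // ltW.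
have Kr u : near b o (fun t => BRight t <= u) \/ near b o (fun t => ~~ (BRight t <= u)).
  case: u => [l x|[]]; [|by right|by left].
  by have [tx|tx] := K x; [left; apply: near_mono tx|right; apply: near_mono tx] => t _ h;
    case: l; rewrite bnd_simp ?(ltW h) // -?ltNge -?leNgt // ltW.
case: i => l r; have [nl|nl] := Kl l; last first.
  by right; apply: near_mono nl => t _; rewrite itv_boundlr => /negPf ->.
have [nr|nr] := Kr r; last first.
  by right; apply: near_mono nr => t _; rewrite itv_boundlr andbC => /negPf ->.
by left; apply: near_mono (near_and nl nr) => t _ []; rewrite itv_boundlr => -> ->.
Qed.

(** An interval eventually contains or eventually misses a one-sided germ, and this passes to finite
    unions. So germs behave like complete types, and a definable condition met arbitrarily close to
    an end holds on a whole interval there. *)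
Lemma near_dich b o A : ddef S A -> near b o A \/ near b o (fun t => ~ A t).
Proof.
move=> /intervals[s]; elim: s A => [|i s IH] A sA.
  right; apply: near_all; first exact: olt_ex.
  by move=> t; rewrite sA => -[].
pose B t := exists2 i, i \in s & t \in i.
have AB t : A t <-> t \in i \/ B t.
  rewrite sA; split=> [[j]|[ti|[j js tj]]].
  - by rewrite inE => /orP[/eqP ->|js tj]; [left|right; exists j].
  - by exists i; rewrite ?mem_head.
  - by exists j; rewrite // inE js orbT.
have [ni|ni] := near_itv b o i.
  by left; apply: near_mono ni => t _ ti; apply/AB; left.
have [nB|nB] := IH B (fun t => conj id id).
  by left; apply: near_mono nB => t _ ti; apply/AB; right.
right; apply: near_mono (near_and ni nB) => t _ [ti nBt] /AB[]//.
by apply/negP.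
Qed.

(** This trichotomy holds for intervals and passes to finite unions, which gives every nonempty
    bounded definable set a supremum. *)
Definition sup_spec A :=
  (forall t, ~ A t) \/ (forall u, exists t, A t /\ u < t) \/
  exists m, (forall t, A t -> t <= m) /\ forall m', m' < m -> exists t, A t /\ m' < t.

Lemma sup_itv (i : interval M) : sup_spec (fun t => t \in i).
Proof.
have [[t0 ti0]|/forallNP ni] := pselect (exists t, t \in i); last by left.
right; case: i ti0 => l r; rewrite itv_boundlr => /andP[lt0 t0r].
have up t : t0 <= t -> l <= BLeft t.
  by move=> t0t; apply: (le_trans lt0); rewrite bnd_simp.
case: r t0r => [c x|[]]; last 2 first.
- by [].
- move=> _; left=> u; have [v] := unbounded true (Order.max t0 u).
  rewrite /= gt_max => /andP[t0v uv]; exists v; split=> //.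
  by rewrite itv_boundlr up ?ltW.
move=> t0r; right; exists x; split.
  by move=> t; rewrite itv_boundlr => /andP[_]; case: c {t0r}; rewrite bnd_simp // => /ltW.
move=> m' m'x; have [m't0|t0m'] := ltP m' t0.
  by exists t0; rewrite itv_boundlr lt0 t0r.
have [z [/= m'z zx]] := dense (b := true) m'x.
exists z; split=> //; rewrite itv_boundlr up /=; last exact: le_trans t0m' (ltW m'z).
by case: c {t0r}; rewrite bnd_simp ?ltW.
Qed.

Lemma sup_specU A B : sup_spec A -> sup_spec B -> sup_spec (fun t => A t \/ B t).
Proof.
have key A' B' : sup_spec A' -> (forall t, ~ B' t) -> sup_spec (fun t => A' t \/ B' t).
  move=> sA nB; suff -> : (fun t => A' t \/ B' t) = A' by [].
  by apply: funext => t; apply: propext; split=> [[//|/nB]|]; [|left].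
move=> sA sB; have [nA|[uA|[m [Am mA]]]] := sA.
- rewrite (_ : (fun t => _) = (fun t => B t \/ A t)); first exact: key.
  by apply: funext => t; apply: propext; tauto.
- by right; left=> u; have [t [At ut]] := uA u; exists t; split=> //; left.
have [nB|[uB|[n [Bn nB]]]] := sB; first exact: key.
  by right; left=> u; have [t [Bt ut]] := uB u; exists t; split=> //; right.
right; right; exists (Order.max m n); split.
  by move=> t [/Am|/Bn] H; rewrite le_max H ?orbT.
move=> u; rewrite lt_max => /orP[/mA|/nB] [t [Ht ut]]; exists t; split=> //; [left|right]; done.
Qed.

Lemma sup_true A x0 u : ddef S A -> A x0 -> (forall t, A t -> t <= u) ->
  exists m, (forall t, A t -> t <= m) /\ forall m', m' < m -> exists t, A t /\ m' < t.
Proof.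
move=> /intervals[s sA] A0 uA.
suff [nA|[ubA|//]] : sup_spec A; first by case: (nA x0).
  by have [t [/uA tu ut]] := ubA u; move: (le_lt_trans tu ut); rewrite ltxx.
have -> : A = fun t => exists2 i, i \in s & t \in i by apply: funext => t; apply: propext.
elim: s {A sA A0 uA} => [|i s IH]; first by left=> t [].
rewrite (_ : (fun t => _) = fun t => t \in i \/ exists2 j, j \in s & t \in j).
  by apply: sup_specU => //; apply: sup_itv.
apply: funext => t; apply: propext; split=> [[j]|[ti|[j js tj]]].
- by rewrite inE => /orP[/eqP ->|js tj]; [left|right; exists j].
- by exists i; rewrite ?mem_head.
- by exists j; rewrite // inE js orbT.
Qed.

Lemma dsup b A x0 u : ddef S A -> A x0 -> (forall t, A t -> dle b t u) ->
  exists m, (forall t, A t -> dle b t m) /\ forall m', dlt b m' m -> exists t, A t /\ dlt b m' t.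
Proof.
case: b => /= dA A0 uA; first exact: sup_true dA A0 uA.
(* An infimum is the supremum of the definable set of lower bounds. *)
pose L v := forall t, A t -> v <= t.
have dL : ddef S L by rewrite /L; definability.
have [|v Lv|m [Lm mL]] := @sup_true L u x0 dL; first by move=> t /uA.
  by apply: Lv.
exists m; split=> [t At|m' mm'].
  by rewrite leNgt; apply/negP => /mL[v [Lv]]; rewrite ltNge => /negP; apply; apply: Lv.
have /existsNP[t /not_implyP[At /negP]] : ~ L m'.
  by move/Lm; rewrite leNgt mm'.
by rewrite -ltNge; exists t.
Qed.

(** Real induction. The supremum m of the points up to which P holds satisfies P by the last
    hypothesis, and the one before it carries P past m, so no failure can remain. This takes the
    place of connectedness of segments. *)
Lemma connected_ind b P p q : ddef S P -> P p ->
  (forall t, dle b p t -> dlt b t q -> P t -> near b (Some t) P) ->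
  (forall t, dlt b p t -> dle b t q -> (forall s, dle b p s -> dlt b s t -> P s) -> P t) ->
  forall t, dle b p t -> dle b t q -> P t.
Proof.
move=> dP Pp Pr Pl t0 pt0 t0q; apply: contrapT => nPt.
pose B t := dle b p t /\ forall s, dle b p s -> dle b s t -> P s.
have dB : ddef S B by rewrite /B; definability.
have Bp : B p.
  split=> [|s ps sp]; first exact: dlexx.
  by suff -> : s = p; have [|[]] := dlt_total b s p => // ?; ord.
have Bt0 t : B t -> dle b t t0.
  by move=> [_ Bt]; apply/dltNge => /dltW ?; apply: nPt; apply: Bt.
have [m [Bm mB]] := dsup dB Bp Bt0.
have Pm s : dle b p s -> dlt b s m -> P s.
  by move=> ps /mB[t [[_ Bt] st]]; apply: Bt => //; apply: dltW.
have pm : dle b p m by apply: Bm.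
have mt0 : dle b m t0 by apply/dltNge => /mB[t [/Bt0 ? ?]]; ord.
have {}Pm : P m.
  move/dle_eqVlt: (pm) => [<- //|pm']; apply: Pl => //.
  exact: dle_trans mt0 t0q.
have mt0' : dlt b m t0 by move/dle_eqVlt: mt0 => [mt|//]; case: nPt; rewrite -mt.
have mq : dlt b m q by ord.
have [c [/= mc cP]] := Pr m pm mq Pm.
have [z [mz zc]] := dense mc.
have : B z.
  split=> [|s ps sz]; first by ord.
  have [sm|[->//|ms]] := dlt_total b s m; last by apply: cP => //=; ord.
  have [t [[_ Bt] st]] := mB _ sm.
  by apply: Bt => //; apply: dltW.
move=> /Bm ?; ord.
Qed.

End OneDim.

(** * Finite subsets of M *)

Section Cardinality.
Context d (M : orderTopologicalType d) (S : structure M).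
Implicit Types (b : bool) (x y z t : M) (o : option M) (A B : M -> Prop).

(** For each fixed k this is a first-order condition on B, which is what makes [ddef_card_le]
    possible. *)
Fixpoint card_le k B : Prop :=
  if k is k'.+1 then exists x, card_le k' (fun t => B t /\ t <> x) else forall t, ~ B t.

Lemma card_le_mono k A B : (forall t, A t -> B t) -> card_le k B -> card_le k A.
Proof.
elim: k A B => [|k IH] A B AB /=; first by move=> nB t /AB /nB.
by move=> [x H]; exists x; apply: IH H => t [/AB].
Qed.

Lemma ddef_card_le k E (s : dsort S E) (R : E -> M -> Prop) :
  ddef2 S R -> ddef S (fun e => card_le k (R e)).
Proof.
elim: k E s R => [|k IH] E s R dR /=; first by definability.
refine (@ddef_ex _ _ _ _ _ _ _ (fun e x => card_le k (fun t => R e t /\ t <> x)) _).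
by apply: (IH _ _ (fun (z : E * M) t => R z.1 t /\ t <> z.2)); definability.
Qed.

Lemma card_le_rem k B x : card_le k.+1 B -> B x -> card_le k (fun t => B t /\ t <> x).
Proof.
elim: k B x => [|k IH] B x [y Hy] Bx.
  have [xy|xy] := pselect (x = y); first by rewrite xy.
  by case: (Hy x).
have [->//|xy] := pselect (x = y).
by exists y; apply: card_le_mono (IH _ x Hy _) => // t [[? ?] ?].
Qed.

Lemma card_leD1 k B x : ~ B x -> card_le k.+1 (fun t => B t \/ t = x) -> card_le k B.
Proof.
move=> nBx /card_le_rem/(_ (or_intror erefl)); apply: card_le_mono => t Bt.
by split; [left|move=> tx; apply: nBx; rewrite -tx].
Qed.

Lemma card_le_max b k A t0 : card_le k A -> A t0 -> exists m, A m /\ forall t, A t -> dle b t m.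
Proof.
elim: k A t0 => [|k IH] A t0; first by move=> /= /(_ t0).
move=> kA A0; have {}kA := card_le_rem kA A0.
have [[t1 At1]|/forallNP nA] := pselect (exists t, A t /\ t <> t0); last first.
  exists t0; split=> // t At; apply/dltNge => ?.
  by apply: (nA t); split=> // e; subst; ord.
have [m [[Am _] mA]] := IH _ _ kA At1.
have [m0|] := pselect (dle b m t0).
  exists t0; split=> // t At; have [->|tt0] := pselect (t = t0); first exact: dlexx.
  by apply: dle_trans m0; apply: mA.
move=> m0; exists m; split=> // t At; have [->|tt0] := pselect (t = t0); last exact: mA.
by ord.
Qed.

Lemma card_le_inj k A B (f : M -> M) : card_le k B -> (forall t, A t -> B (f t)) ->
  (forall t u, A t -> A u -> f t = f u -> t = u) -> card_le k A.
Proof.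
elim: k A B => [|k IH] A B; first by move=> nB AB _ t /AB /nB.
move=> [y Hy] AB fi.
have {Hy} kA' : card_le k (fun t => A t /\ f t <> y).
  by apply: IH Hy _ _ => [t [At ?]|t u [At _] [Au _]]; [split=> //; apply: AB|apply: fi].
have [[x [Ax fx]]|/forallNP nA] := pselect (exists x, A x /\ f x = y).
  exists x; apply: card_le_mono kA' => t [At tx]; split=> // ft; apply: tx.
  by apply: fi => //; rewrite fx.
exists y; apply: card_le_mono kA' => t [At _]; split=> // ft.
by apply: (nA t).
Qed.

Definition fin A := exists k, card_le k A.

Section Omin.
Hypothesis om : o_minimal S.

Lemma near_neq b o x : near b o (fun t => t <> x).
Proof.
have [tx|tx] := near_side om b o x; apply: near_mono tx => t _ tx e; subst; ord.
Qed.

Lemma card_le_near b o k A : card_le k A -> near b o (fun t => ~ A t).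
Proof.
elim: k A => [|k IH] A; first by move=> nA; apply: near_all => //; apply: (olt_ex om).
move=> [x /IH nA]; apply: near_mono (near_and (near_neq b o x) nA) => t _ [tx nAt] At.
by apply: nAt.
Qed.

Lemma card_le_interval b p q k A :
  dlt b p q -> (forall t, dlt b p t -> dlt b t q -> A t) -> ~ card_le k A.
Proof.
move=> pq pqA /(card_le_near b (Some p)) nA.
have [t [pt [[_ tq] nAt]]] := near_ex om (near_and (near_olt (o := Some p) pq) nA).
by apply: nAt; apply: pqA.
Qed.

(** An interval of the decomposition with two points would put a whole interval into A, so each of
    them has at most one point. *)
Lemma no_interval_fin b A : ddef S A ->
  (forall p q, dlt b p q -> exists t, dlt b p t /\ dlt b t q /\ ~ A t) -> fin A.
Proof.
move=> /(intervals om)[s sA] nA.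
have one (i : interval M) t u : i \in s -> t \in i -> u \in i -> t = u.
  move=> si; wlog tu : t u / dlt b t u.
    move=> H; have [tu|[->//|ut]] := dlt_total b t u; first exact: H.
    by move=> ti ui; apply: esym; apply: H.
  case: i si => l r si; rewrite !itv_boundlr => /andP[lt tr] /andP[lu ur].
  have [v [tv [vu nAv]]] := nA _ _ tu; case: nAv; apply/sA; exists (Interval l r) => //.
  rewrite itv_boundlr; case: b tv vu {nA tu} => /= tv vu.
    by rewrite (le_trans lt) ?(le_trans _ ur) ?bnd_simp ?ltW.
  by rewrite (le_trans lu) ?(le_trans _ tr) ?bnd_simp ?ltW.
suff [k kA] : fin (fun t => exists2 i, i \in s & t \in i).
  by exists k; apply: card_le_mono kA => t /sA.
elim: s one {nA sA} => [|i s IH] one; first by exists 0%N => t [].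
have [|k kA] := IH; first by move=> j t u js; apply: (one j); rewrite inE js orbT.
have [[x xi]|/forallNP ni] := pselect (exists x, x \in i).
  exists k.+1, x; apply: card_le_mono kA => t [[j]].
  rewrite inE => /orP[/eqP ->|js tj _]; last by exists j.
  by move=> ti []; apply: (one i _ _ _ ti xi); rewrite mem_head.
exists k; apply: card_le_mono kA => t [j].
by rewrite inE => /orP[/eqP -> /ni//|js tj]; exists j.
Qed.

End Omin.

End Cardinality.

(** * Skolem functions between sorts *)

Section Skolem.
Context d (M : orderTopologicalType d) (S : structure M).
Hypothesis sk : definable_skolem_functions S.

(** Rows that are not codes are avoided by taking the range of [enc] as the index set. As R has to
    be total, conditions on x are put into R as premises in the applications, with an arbitrary
    value where they fail. *)
Lemma skolem E F (s : dsort S E) (t : dsort S F) (R : E -> F -> Prop) :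
  ddef2 S R -> (forall x, exists y, R x y) -> exists f : E -> F, dfun S f /\ forall x, R x (f x).
Proof.
move=> dR Rx.
pose A (v : 'rV[M]_(dim s)) (w : 'rV[M]_(dim t)) :=
  exists z : E * F, R z.1 z.2 /\ row_mx v w = enc_prod s t z.
have AE x y : A (enc x) (enc y) <-> R x y.
  split=> [[[x' y'] /= [Rxy]] /eq_row_mx[ex ey]|Rxy].
    by rewrite (enc_inj ex) (enc_inj ey).
  by exists (x, y).
have dA : definable S [set z : 'rV[M]_(dim s + dim t) | range enc (lsubmx z) /\ A (lsubmx z) (rsubmx z)].
  move/ddef_encP/definableP: dR; congr definable; apply/seteqP.
  split=> [v [[x y] /= Rxy <-]|v [_ [[x y] [Rxy]]]] /=; last first.
    by rewrite hsubmxK => ->; exists (x, y).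
  by rewrite /enc_prod row_mxKl row_mxKr; split; [exists x|exists (x, y)].
have [||g [dg gA]] := @sk _ _ (range enc) A.
- by split=> //; apply: enc_range.
- by move=> _ [x _ <-]; have [y Rxy] := Rx x; exists (enc y); apply/AE.
have fE x : exists y, enc y = g (enc x).
  have [|[x' y] [Rxy /eq_row_mx[_ ->]]] := gA (enc x); first by exists x.
  by exists y.
pose f x := projT1 (cid (fE x)); have fP x : enc (f x) = g (enc x) := projT2 (cid (fE x)).
exists f; split; last by move=> x; apply/AE; rewrite fP; apply: gA; exists x.
apply/ddef_encP/definableP; move: dg; rewrite /definable_map.
congr definable; apply/seteqP; split=> v /=.
  move=> [[x _ ex] ev]; exists (x, f x) => //=.
  by rewrite /enc_prod /= fP ex -ev hsubmxK.
by move=> [[x y] /= -> <-]; rewrite /enc_prod /= row_mxKl row_mxKr fP; split=> //; exists x.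
Qed.

End Skolem.

(** * Continuity of definable functions of one variable *)

Section Continuity.
Context d (M : orderTopologicalType d) (S : structure M).
Hypotheses (om : o_minimal S) (sk : definable_skolem_functions S).
Implicit Types (b c : bool) (p q x y z t : M) (o : option M) (A : M -> Prop).

Definition iv b p q t := dlt b p t /\ dlt b t q.

(* One-sided upper semicontinuity, for the direction b of the source and the
   direction c of the target. *)
Definition usc b c (f : M -> M) x :=
  forall v, dlt c (f x) v -> near b (Some x) (fun t => dlt c (f t) v).

Lemma ddef_usc b c f : dfun S f -> ddef S (usc b c f).
Proof. by move=> df; rewrite /usc; definability. Qed.

Lemma near_le b p q : dlt b p q -> near b (Some p) (fun t => dlt b p t /\ dlt b t q).
Proof. by move=> pq; exists q. Qed.

Lemma near_seg b o A (c : M) : near b o A -> olt b o c ->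
  exists e, olt b o e /\ dle b e c /\ forall t, olt b o t -> dlt b t e -> A t.
Proof.
move=> [e [oe eA]] oc; have [ec|/dleNgt ce] := pselect (dle b e c); first by exists e.
exists c; split=> //; split; first exact: dlexx.
by move=> t ot tc; apply: eA => //; ord.
Qed.

Lemma near_pick b o A (c : M) : near b o A -> olt b o c -> exists t, olt b o t /\ dlt b t c /\ A t.
Proof.
move=> nA /(near_seg nA)[e [/[dup] oe /(olt_dense om)[t [ot te]] [ec eA]]].
by exists t; split=> //; split; [ord|apply: eA].
Qed.

Lemma near_segN b q A (c : M) : near (~~ b) (Some q) A -> dlt b c q ->
  exists e, dle b c e /\ dlt b e q /\ forall t, dlt b e t -> dlt b t q -> A t.
Proof.
move=> nA cq; have [|e [qe [ec eA]]] := near_seg nA (c := c); first by rewrite /= dltN.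
exists e; rewrite -dleN -(dltN b); split=> //; split=> // t et tq.
by apply: eA; rewrite /= dltN.
Qed.

Lemma near_pickN b q A (c : M) : near (~~ b) (Some q) A -> dlt b c q ->
  exists t, dlt b c t /\ dlt b t q /\ A t.
Proof.
move=> nA cq; have [|t [qt [tc At]]] := near_pick nA (c := c); first by rewrite /= dltN.
by exists t; rewrite -dltN -(dltN b).
Qed.

Lemma loc_incr b c g p q : dfun S g ->
  (forall x, iv b p q x -> near b (Some x) (fun t => dlt c (g x) (g t))) ->
  (forall x, iv b p q x -> near (~~ b) (Some x) (fun t => dlt c (g t) (g x))) ->
  forall x y, iv b p q x -> iv b p q y -> dlt b x y -> dlt c (g x) (g y).
Proof.
move=> dg gr gl x y [px xq] [py yq] xy.
pose P t := t = x \/ dlt c (g x) (g t).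
have dP : ddef S P by rewrite /P; definability.
suff [yx|//] : P y by subst; ord.
apply: (connected_ind om (b := b) dP (p := x) (q := y)) => //; try by [left|apply: dlexx|apply: dltW].
- move=> t xt ty Pt; apply: near_mono (gr t _); last by split; ord.
  by move=> s _ ts; right; case: Pt => [<-//|gt]; ord.
- move=> t xt ty IH; right.
  have [|s [xs [st gs]]] := near_pickN (gl t _) xt; first by split; ord.
  by have [sx|?] := IH s (dltW xs) st; [subst; ord|ord].
Qed.

(** Strict monotonicity makes g injective, so its image is infinite and contains an interval of
    values. If [g x] lies in that interval, values just beyond [g x] are attained at points x' after
    x, and monotonicity keeps g below them between x and x'. *)
Lemma incr_usc b c g p q : dfun S g -> dlt b p q ->
  (forall x y, iv b p q x -> iv b p q y -> dlt b x y -> dlt c (g x) (g y)) ->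
  exists x, iv b p q x /\ usc b c g x.
Proof.
move=> dg pq gm.
have inj x y : iv b p q x -> iv b p q y -> g x = g y -> x = y.
  move=> xi yi e; have [xy|[//|xy]] := dlt_total b x y.
    by have := gm _ _ xi yi xy; rewrite e => ?; ord.
  by have := gm _ _ yi xi xy; rewrite e => ?; ord.
pose G v := exists x, iv b p q x /\ v = g x.
have dG : ddef S G by rewrite /G /iv; definability.
have [|nG] := pselect (forall u w, dlt c u w -> exists t, dlt c u t /\ dlt c t w /\ ~ G t).
  move=> /(no_interval_fin om dG)[k kG].
  have kI : card_le k (iv b p q).
    by apply: (card_le_inj kG (f := g)) => // t ti; exists t.
  by case: (card_le_interval om pq _ kI) => t ? ?; split.
have [u [w [uw Guw]]] : exists u w, dlt c u w /\ forall t, dlt c u t -> dlt c t w -> G t.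
  apply: contrapT => /forallNP H; apply: nG => u w uw.
  apply: contrapT => /forallNP nt; apply: (H u); exists w; split=> // t ut tw.
  by apply: contrapT => nGt; apply: (nt t).
have [v [uv vw]] := dense om uw.
have [x [xi vx]] := Guw _ uv vw; subst v.
exists x; split=> // v gv.
have [z [gz zv zw]] : exists z, [/\ dlt c (g x) z, dle c z v & dlt c z w].
  have [vw'|vw'] := pselect (dlt c v w).
    by exists v; split=> //; apply: dlexx.
  have [z [gz zw]] := dense om vw; exists z; split=> //; ord.
have [|x' [xi' zx']] := Guw z _ zw; first by ord.
subst z; have xx' : dlt b x x'.
  have [//|[e|h]] := dlt_total b x x'; first by subst; ord.
  by have := gm _ _ xi' xi h => ?; ord.
exists x'; split=> // t /= xt tx'.
have ti : iv b p q t by case: xi xi' => ? ? [? ?]; split; ord.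
by have := gm _ _ ti xi' tx' => ?; ord.
Qed.

Definition loc_min c (g : M -> M) x := forall b, near b (Some x) (fun t => dlt c (g x) (g t)).

(* In the direction b the function g crosses some level w downwards at x. *)
Definition drop b c (g : M -> M) x := exists w,
  near (~~ b) (Some x) (fun t => dlt c w (g t)) /\ near b (Some x) (fun t => dle c (g t) w).

Lemma ddef_drop b c g : dfun S g -> ddef S (drop b c g).
Proof. by move=> dg; rewrite /drop; definability. Qed.

(** In the orders given by b and c: if g stayed above [g x0] just before q, let m be the first point
    from x0 on after which it does. Then [g m] is at most [g x0], since a strict local minimum above
    that level would let m move back. The last hypothesis now gives a point after m that is at or
    below the level. *)
Lemma loc_min_level b c g p q x0 : dfun S g -> iv b p q x0 ->
  (forall x, iv b p q x -> loc_min c g x) ->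
  (forall x, iv b p q x -> exists y, [/\ dlt b x y, dlt b y q & dle c (g y) (g x)]) ->
  near (~~ b) (Some q) (fun y => dle c (g y) (g x0)).
Proof.
move=> dg [px0 x0q] gmin gB.
have dA : ddef S (fun y => dle c (g y) (g x0)) by definability.
have [//|/near_segN/(_ x0q)[e [xe [eq eg]]]] := near_dich om (~~ b) (Some q) dA.
pose D d0 := dle b x0 d0 /\ dlt b d0 q /\ forall y, iv b d0 q y -> dlt c (g x0) (g y).
have dD : ddef S D by rewrite /D /iv; definability.
have De : D e.
  by split=> //; split=> // y [ey yq]; apply/dleNgt; apply: eg.
have [|m [Dm mD]] := @dsup _ _ _ om (~~ b) D e x0 dD De.
  by move=> t [h _]; rewrite dleN.
have x0m : dle b x0 m.
  by apply/dltNge => h; have [|t [[h1 _]]] := mD x0; rewrite dltN // => ?; ord.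
have me : dle b m e by rewrite -dleN; apply: Dm.
have gm y : iv b m q y -> dlt c (g x0) (g y).
  move=> [my yq]; have [|t [[_ [_ h]] ty]] := mD y; first by rewrite dltN.
  by apply: h; split=> //; rewrite dltN in ty.
have gmx : dle c (g m) (g x0).
  have [->|mx0] := pselect (m = x0); first exact: dlexx.
  have {}x0m : dlt b x0 m by move/dle_eqVlt: x0m => [e1|//]; case: mx0.
  apply/dltNge => gxm.
  have [|e1 [x0e1 [e1m e1P]]] := near_segN (gmin m _ (~~ b)) x0m; first by split; ord.
  have [e2 [e12 e2m]] := dense om e1m.
  suff /Dm : D e2 by rewrite dleN => ?; ord.
  split; first by ord.
  split; first by ord.
  move=> y [e2y yq]; have [ym|[->//|my]] := dlt_total b y m; last by apply: gm.
  by have h := e1P y (dlt_trans e12 e2y) ym; ord.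
have [|y [my yq gy]] := gB m; first by split; ord.
by have := gm y (conj my yq) => ?; ord.
Qed.

(** By [loc_min_level], g is at most [g x0] near q. The first point m after which this holds comes
    after x0, because x0 is a strict local minimum, and g exceeds the level just before m; hence m
    is a drop, with level [g x0]. *)
Lemma loc_min_drop b c g p q x0 : dfun S g -> iv b p q x0 ->
  (forall x, iv b p q x -> loc_min c g x) ->
  (forall x, iv b p q x -> exists y, [/\ dlt b x y, dlt b y q & dle c (g y) (g x)]) ->
  exists x, dlt b x0 x /\ dlt b x q /\ drop b c g x.
Proof.
move=> dg xi gmin gB; have [px0 x0q] := xi.
have /near_segN/(_ x0q)[e [xe [eq eg]]] := loc_min_level dg xi gmin gB.
pose D d0 := dle b x0 d0 /\ dlt b d0 q /\ forall y, iv b d0 q y -> dle c (g y) (g x0).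
have dD : ddef S D by rewrite /D /iv; definability.
have De : D e by split=> //; split=> // y [ey yq]; apply: eg.
have [|m [Dm mD]] := @dsup _ _ _ om (~~ b) D e x0 dD De.
  by move=> t [h _]; rewrite dleN.
have x0m : dle b x0 m.
  by apply/dltNge => h; have [|t [[h1 _]]] := mD x0; rewrite dltN // => ?; ord.
have me : dle b m e by rewrite -dleN; apply: Dm.
have mq : dlt b m q by ord.
have gm y : iv b m q y -> dle c (g y) (g x0).
  move=> [my yq]; have [|t [[_ [_ h]] ty]] := mD y; first by rewrite dltN.
  by apply: h; split=> //; rewrite dltN in ty.
have {x0m} x0m : dlt b x0 m.
  move/dle_eqVlt: x0m => [e1|//]; subst m.
  have [y [/= xy [yq gy]]] := near_pick (gmin x0 xi b) (c := q) x0q.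
  by have := gm y (conj xy yq) => ?; ord.
exists m; split=> //; split=> //; exists (g x0).
have nm : near b (Some m) (fun t => dle c (g t) (g x0)).
  by exists q; split=> // t /= mt tq; apply: gm.
split=> //.
have dA : ddef S (fun y => dlt c (g x0) (g y)) by definability.
have [//|/near_segN/(_ x0m)[e1 [x0e1 [e1m e1P]]]] := near_dich om (~~ b) (Some m) dA.
have gmx : dle c (g m) (g x0).
  apply/dltNge => gxm; have mi : iv b p q m by split; ord.
  by have [t [_ [? ?]]] := near_ex om (near_and (gmin m mi b) nm); ord.
have [e2 [e12 e2m]] := dense om e1m.
suff /Dm : D e2 by rewrite dleN => ?; ord.
split; first by ord.
split; first by ord.
move=> y [e2y yq]; have [ym|[->//|my]] := dlt_total b y m; last by apply: gm.
by have h := e1P y (dlt_trans e12 e2y) ym; ord.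
Qed.

(** If all points near q had only larger values after them, this would contradict the larger values
    just before a strict local minimum. So no point near q has this property, [loc_min_drop] finds
    drops arbitrarily close to q, and [near_dich] upgrades this to all points near q. *)
Lemma loc_min_drop_near b c g p q : dfun S g -> dlt b p q ->
  (forall x, iv b p q x -> loc_min c g x) -> near (~~ b) (Some q) (drop b c g).
Proof.
move=> dg pq gmin.
pose B x := forall y, iv b p q y -> dlt b x y -> dlt c (g x) (g y).
have dB : ddef S B by rewrite /B /iv; definability.
have [|] := near_dich om (~~ b) (Some q) dB => /near_segN/(_ pq)[e [pe [eq eB]]].
  have [x [ex xq]] := dense om eq.
  have xi : iv b p q x by split; ord.
  have [t [et [tx gt]]] := near_pickN (gmin x xi (~~ b)) ex.
  by have := eB t et (dlt_trans tx xq) x xi tx => ?; ord.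
have [//|/near_segN/(_ eq)[e1 [ee1 [e1q e1P]]]] := near_dich om (~~ b) (Some q) (ddef_drop b c dg).
have [x0 [e1x0 x0q]] := dense om e1q.
have [|||x [x0x [xq dx]]] := @loc_min_drop b c g e q x0 dg.
- by split; ord.
- by move=> x [ex xq]; apply: gmin; split; ord.
- move=> x [ex xq]; have /existsNP[y /not_implyP[[py yq] /not_implyP[xy /dltNge gy]]] := eB x ex xq.
  by exists y.
by case: (e1P x) => //; ord.
Qed.

(* By [loc_min_drop_near] in both directions, g would cross a level downwards and
   another one upwards at the same point. *)
Lemma loc_min_false b c g p q : dfun S g -> dlt b p q ->
  (forall x, iv b p q x -> loc_min c g x) -> False.
Proof.
move=> dg pq gmin.
have /near_segN/(_ pq)[e [pe [eq eP]]] := loc_min_drop_near dg pq gmin.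
have [|x [/= ex]] := @near_ex _ _ _ om b (Some e) (fun x => dlt b x q /\ drop (~~ b) c g x).
  apply: near_and; first by exists q.
  rewrite -[b in near b]negbK; apply: (loc_min_drop_near (p := q)) => //; first by rewrite dltN.
  by move=> x [h1 h2]; apply: gmin; rewrite !dltN in h1 h2; split; ord.
move=> [xq [w [nw nw']]]; have [w1 [nv nv']] := eP x ex xq; rewrite negbK in nw.
(* In the order c, the values on one side of x give w < w1, those on the other side w1 < w. *)
have [t [_ [? ?]]] := near_ex om (near_and nw nv').
by have [u [_ [? ?]]] := near_ex om (near_and nw' nv); ord.
Qed.

(* If upper semicontinuity failed everywhere, a Skolem function g would separate
   f x from the values of f just after x, so that g increases just after every
   point. Just before the points of a subinterval, g is smaller (then g is
   increasing, so upper semicontinuous somewhere, contradicting f < g), larger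
   (a strict local minimum everywhere) or equal (absurd). *)
Lemma usc_ex b c f p q : dfun S f -> dlt b p q -> exists x, iv b p q x /\ usc b c f x.
Proof.
move=> df pq; apply: contrapT => /forallNP nx.
have {}nx x : iv b p q x -> ~ usc b c f x by move=> xi ux; apply: (nx x).
(* The second level [v1] leaves a gap beyond [g x]. Were g upper semicontinuous at x, then just
   after x its values would be below [v1] and those of f above it, against f < g. *)
pose R x v := iv b p q x -> dlt c (f x) v /\
   exists v1, dlt c v v1 /\ near b (Some x) (fun t => dlt c v1 (f t)).
have dR : ddef2 S R by rewrite /R /iv; definability.
have [|g [dg gP]] := skolem sk dR.
  move=> x; have [xi|nxi] := pselect (iv b p q x); last by exists x.
  have /existsNP[v /not_implyP[fv nv]] := nx x xi.
  have dv : ddef S (fun t => dlt c (f t) v) by definability.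
  have {}nv : near b (Some x) (fun t => ~ dlt c (f t) v).
    by have [] := near_dich om b (Some x) dv.
  have [v1 [fv1 v1v]] := dense om fv; have [v0 [fv0 v01]] := dense om fv1.
  exists v0 => _; split=> //; exists v1; split=> //.
  by apply: near_mono nv => t _ /dltNge ?; ord.
have gr x : iv b p q x -> near b (Some x) (fun t => dlt c (g x) (g t)).
  move=> xi; have [fg [v1 [gv nv]]] := gP x xi; have [px xq] := xi.
  apply: near_mono (near_and nv (near_le xq)) => t _ [fv [xt tq]].
  by have [|h _] := gP t; [split; ord|ord].
pose L1 x := near (~~ b) (Some x) (fun t => dlt c (g t) (g x)).
pose L3 x := near (~~ b) (Some x) (fun t => dlt c (g x) (g t)).
have dL1 : ddef S L1 by rewrite /L1; definability.
have dL3 : ddef S L3 by rewrite /L3; definability.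
have [|nL1] := near_dich om b (Some p) dL1.
  move=> /near_seg/(_ pq)[e [/= pe [eq eP]]].
  have sub x : iv b p e x -> iv b p q x by move=> []; split; ord.
  have [|x [xi ux]] := @incr_usc b c g p e dg pe.
    apply: (loc_incr dg); first by move=> x /sub; apply: gr.
    by move=> x [px xe]; apply: eP.
  have [fg [v1 [gv nv]]] := gP x (sub _ xi); have [px xe] := xi.
  have [t [xt [[? ?] [_ te]]]] := near_ex om (near_and (near_and nv (ux _ gv)) (near_le xe)).
  by have [|h _] := gP t; [apply: sub; split; ord|ord].
have [|nL3] := near_dich om b (Some p) dL3.
  move=> /near_seg/(_ pq)[e [/= pe [eq eP]]].
  apply: (@loc_min_false b c g p e dg pe) => x [px xe] b'.
  have xi : iv b p q x by split; ord.
  have [<-|bb'] := eqVneq b b'; first exact: gr.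
  have -> : b' = ~~ b by case: (b) (b') bb' => [] [].
  exact: eP.
have /near_seg/(_ pq)[e [/= pe [eq eP]]] := near_and nL1 nL3.
have [x [px xe]] := dense om pe.
have [n1 n3] := eP x px xe.
have d1 : ddef S (fun t => dlt c (g t) (g x)) by definability.
have d3 : ddef S (fun t => dlt c (g x) (g t)) by definability.
have {}n1 : near (~~ b) (Some x) (fun t => ~ dlt c (g t) (g x)).
  by have [] := near_dich om (~~ b) (Some x) d1.
have {}n3 : near (~~ b) (Some x) (fun t => ~ dlt c (g x) (g t)).
  by have [] := near_dich om (~~ b) (Some x) d3.
have /near_segN/(_ px)[e' [pe' [e'x e'P]]] := near_and n1 n3.
have [y [e'y yx]] := dense om e'x.
have yi : iv b p q y by split; ord.
have [t [/= yt [tx gt]]] := near_pick (gr y yi) (c := x) yx.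
have [? ?] := e'P y e'y yx; have [? ?] := e'P t (dlt_trans e'y yt) tx.
by ord.
Qed.

Definition cont f x := forall b c, usc b c f x.

Lemma near_usc b' o b c f : dfun S f -> near b' o (usc b c f).
Proof.
move=> df; have [//|[e [oe eP]]] := near_dich om b' o (ddef_usc b c df).
have [y [oy ye]] := olt_dense om oe; have [z [oz zy]] := olt_dense om oy.
have : exists x, iv b' z y x /\ usc b c f x.
  have [e1|bb'] := eqVneq b b'; first by subst b'; exact: usc_ex.
  have E : b' = ~~ b by case: (b) (b') bb' => [] [].
  have yz : dlt b y z by move: zy; rewrite E dltN.
  have [x [[yx xz] ux]] := usc_ex c df yz.
  by exists x; rewrite /iv E !dltN.
move=> [x [[zx xy] ux]].
have ox : olt b' o x by move: oz; case: (o) => //= a ?; ord.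
by case: (eP x ox _ ux); ord.
Qed.

Lemma near_cont b o f : dfun S f -> near b o (cont f).
Proof.
move=> df; apply: near_mono (near_and (near_and (near_usc b o true true df)
  (near_usc b o true false df)) (near_and (near_usc b o false true df)
  (near_usc b o false false df))) => t _ [[? ?] [? ?]] [] [] //.
Qed.

End Continuity.

(** * Uniform finiteness *)

Section UniformFiniteness.
Context d (M : orderTopologicalType d) (S : structure M).
Hypotheses (om : o_minimal S) (sk : definable_skolem_functions S).
Implicit Types (b c : bool) (u v x y z t : M).

Definition nbd u (P : M -> Prop) := P u /\ forall b, near b (Some u) P.

Lemma nbd_mono u (P Q : M -> Prop) : (forall x, P x -> Q x) -> nbd u P -> nbd u Q.
Proof.
by move=> PQ [Pu nP]; split=> [|b]; [apply: PQ|apply: near_mono (nP b) => t _; apply: PQ].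
Qed.

Lemma nbd_and u (P Q : M -> Prop) : nbd u P -> nbd u Q -> nbd u (fun x => P x /\ Q x).
Proof. by move=> [Pu nP] [Qu nQ]; split=> // b; apply: near_and. Qed.

Lemma near_nbd b o (P : M -> Prop) : near b o P -> near b o (fun u => nbd u P).
Proof.
move=> [e [oe eP]]; exists e; split=> // t ot te; split; first exact: eP.
move=> b'; have [<-|bb'] := eqVneq b b'.
  exists e; split=> //= s ts se; apply: eP => //.
  by case: (o) ot => //= a ?; ord.
have -> : b' = ~~ b by case: (b) (b') bb' => [] [].
case: o oe ot eP => [a|] /= ae at_ eP.
  by exists a; split=> [|s] /=; rewrite !dltN // => ts sa; apply: eP => //; ord.
have [c tc] := unbounded om (~~ b) t.
by exists c; split=> //= s; rewrite !dltN => st cs; apply: eP => //; ord.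
Qed.

Lemma cont_nbd c f u v : cont f u -> dlt c (f u) v -> nbd u (fun x => dlt c (f x) v).
Proof. by move=> cf fv; split=> // b; apply: cf. Qed.

(* (u0, t0) has boxes of arbitrarily small height around it in which the fibres of A are all
   empty, or all singletons with t0 in the fibre over u0. *)
Definition normal (A : M -> M -> Prop) u0 t0 := forall l r, iv true l r t0 ->
  exists l' r', (dle true l l' /\ dle true r' r /\ iv true l' r' t0) /\
   (nbd u0 (fun u => forall t, iv true l' r' t -> ~ A u t) \/
    (A u0 t0 /\ nbd u0 (fun u => exists t, (iv true l' r' t /\ A u t) /\
       forall t', iv true l' r' t' -> A u t' -> t' = t))).

(* The first alternative at t0 = +oo (c = true) or t0 = -oo (c = false). *)
Definition norminf (A : M -> M -> Prop) c u0 :=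
  exists v, nbd u0 (fun u => forall t, dlt c v t -> ~ A u t).

Definition good (A : M -> M -> Prop) u :=
  (forall t, normal A u t) /\ (forall c, norminf A c u).

Lemma ddef_normal E (s : dsort S E) (A : E -> M -> M -> Prop) (f g : E -> M) :
  ddef3 S A -> dfun S f -> dfun S g -> ddef S (fun e => normal (A e) (f e) (g e)).
Proof. by move=> dA df dg; rewrite /normal /nbd /iv; definability. Qed.

Lemma ddef_norminf E (s : dsort S E) (A : E -> M -> M -> Prop) c (f : E -> M) :
  ddef3 S A -> dfun S f -> ddef S (fun e => norminf (A e) c (f e)).
Proof. by move=> dA df; rewrite /norminf /nbd; definability. Qed.

Lemma ddef_good E (s : dsort S E) (A : E -> M -> M -> Prop) :
  ddef3 S A -> ddef2 S (fun e u => good (A e) u).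
Proof.
move=> dA; rewrite /ddef2 /good; apply: ddef_and.
  refine (@ddef_all _ _ _ _ _ _ _ (fun (z : E * M) t => normal (A z.1) z.2 t) _).
  by apply: (@ddef_normal _ _ (fun z : E * M * M => A z.1.1) (fun z : E * M * M => z.1.2)
    (fun z : E * M * M => z.2)); definability.
refine (@ddef_all_bool _ _ _ _ _ (fun c (z : E * M) => norminf (A z.1) c z.2) _) => c.
by cbv beta; apply: (@ddef_norminf _ _ (fun z : E * M => A z.1) c (fun z : E * M => z.2)); definability.
Qed.

Section Fibers.
Variable A : M -> M -> Prop.
Hypothesis dA : ddef2 S A.

(** A definable bound [f u] of the fibre is continuous at some u near o, and there any v beyond
    [f u] bounds all neighbouring fibres. *)
Lemma near_norminf b o c : (forall u, fin (A u)) -> near b o (norminf A c).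
Proof.
move=> fA; have dN : ddef S (norminf A c) by rewrite /norminf /nbd; definability.
have [//|nN] := near_dich om b o dN.
pose R u v := forall t, dlt c v t -> ~ A u t.
have dR : ddef2 S R by rewrite /R; definability.
have [|f [df fP]] := skolem sk dR.
  move=> u; have [k kA] := fA u.
  have [[t0 At0]|/forallNP nA] := pselect (exists t, A u t); last by exists u.
  have [m [Am mA]] := card_le_max c kA At0; exists m => t mt /mA ?; ord.
have [u [_ [nu cu]]] := near_ex om (near_and nN (near_cont om sk b o df)).
have [v fv] := unbounded om c (f u).
by case: nu; exists v; apply: nbd_mono (cont_nbd cu fv) => x fx t vt; apply: fP; ord.
Qed.

(** Failures would be witnessed by a definable f, and [l u], [r u] can be chosen so that the fibre
    has no point other than [f u] strictly between them. Where all three functions are continuous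
    and membership of [f u] in the fibre is locally constant, a box between l and r shows that [f u]
    is normal after all. *)
Lemma near_normal b o : (forall u, fin (A u)) -> near b o (fun u => forall t, normal A u t).
Proof.
move=> fA; have dN : ddef2 S (normal A) by rewrite /normal /nbd /iv; definability.
have dN' : ddef S (fun u => forall t, normal A u t) by definability.
have [//|nN] := near_dich om b o dN'.
pose R u t := (exists t, ~ normal A u t) -> ~ normal A u t.
have dR : ddef2 S R by rewrite /R; definability.
have [|f [df fP]] := skolem sk dR.
  by move=> u; have [[t nt]|nt] := pselect (exists t, ~ normal A u t); [exists t|exists u].
pose R' c u r := dlt c (f u) r /\ forall t, iv c (f u) r t -> ~ A u t.
have dR' c : ddef2 S (R' c) by rewrite /R' /iv; definability.
have R'ex c u : exists r, R' c u r.
  have [k kA] := fA u; have [r [fr rP]] := card_le_near om c (Some (f u)) kA.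
  by exists r; split=> // t [? ?]; apply: rP.
have [r [dr rP]] := skolem sk (dR' true) (R'ex true).
have [l [dl lP]] := skolem sk (dR' false) (R'ex false).
have dQ : ddef S (fun u => A u (f u)) by definability.
have nc := near_and (near_cont om sk b o df)
  (near_and (near_cont om sk b o dr) (near_cont om sk b o dl)).
suff key u : ~ (forall t, normal A u t) -> cont f u -> cont r u -> cont l u ->
    nbd u (fun x => A x (f x)) \/ nbd u (fun x => ~ A x (f x)) -> False.
  have [] := near_dich om b o dQ => /near_nbd nQ;
  have [u [_ [nu [[? [? ?]] Qu]]]] := near_ex om (near_and nN (near_and nc nQ));
  by exfalso; apply: (key u) => //; auto.
move=> nu cf cr cl Qu; apply: (fP u); first exact/existsNP.
move=> l0 r0 [/= l0f fr0].
have [fr _] := rP u; have [lf _] := lP u.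
have [r' [fr' [r'r r'r0]]] : exists r', dlt true (f u) r' /\ dlt true r' (r u) /\ dle true r' r0.
  have [h|/dleNgt h] := pselect (dle true r0 (r u)).
    by have [r' [? ?]] := dense om (b := true) fr0; exists r'; split=> //; split; ord.
  by have [r' [? ?]] := dense om (b := true) fr; exists r'; split=> //; split; ord.
have [l' [fl' [l'l l'l0]]] : exists l', dlt false (f u) l' /\ dlt false l' (l u) /\ dle false l' l0.
  have [h|/dleNgt h] := pselect (dle false l0 (l u)).
    by have [r2 [? ?]] := dense om (b := false) l0f; exists r2; split=> //; split; ord.
  by have [r2 [? ?]] := dense om (b := false) lf; exists r2; split=> //; split; ord.
exists l', r'; split=> //.
have N := nbd_and (nbd_and (cont_nbd cf fr') (cont_nbd cf fl'))
  (nbd_and (cont_nbd (c := false) cr r'r) (cont_nbd (c := true) cl l'l)).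
have U x : dlt true (f x) r' /\ dlt false (f x) l' -> dlt false (r x) r' /\ dlt true (l x) l' ->
    forall t, iv true l' r' t -> A x t -> t = f x.
  move=> [h1 h2] [h3 h4] t [lt tr] Axt.
  have [h|[//|h]] := dlt_total true t (f x).
    have [_ H] := lP x; case: (H t) => //; split=> //.
    by ord.
  have [_ H] := rP x; case: (H t) => //; split=> //.
  by ord.
case: Qu => Qu; [right|left].
  split; first by case: Qu.
  apply: nbd_mono (nbd_and Qu N) => x [Qx [h1 h2]]; exists (f x).
  split; last exact: U.
  by split=> //; case: h1 => ? ?; split.
apply: nbd_mono (nbd_and Qu N) => x [Qx [h1 h2]] t ti Axt; apply: Qx.
by rewrite -(U x h1 h2 t).
Qed.

Lemma near_good b o : (forall u, fin (A u)) -> near b o (good A).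
Proof.
move=> fA; apply: near_mono (near_and (near_normal b o fA)
  (near_and (near_norminf b o true fA) (near_norminf b o false fA))) => t _ [nt [? ?]].
by split=> // -[].
Qed.

(** A compactness argument: [norminf] confines the nearby fibres to a segment, on which the boxes,
    all of the empty kind as [A u0] is empty, are glued by real induction. *)
Lemma nbd_empty u0 : good A u0 -> (forall t, ~ A u0 t) -> nbd u0 (fun u => forall t, ~ A u t).
Proof.
move=> [gA iA] nA.
have [v1 N1] := iA true; have [v2 N2] := iA false.
have {N1 v1} [v1 [v12 N1]] : exists v1', dlt true v2 v1' /\
    nbd u0 (fun u => forall t, dlt true v1' t -> ~ A u t).
  have [h|/dleNgt h] := pselect (dle true v1 v2); last by exists v1.
  have [w vw] := unbounded om true v2; exists w; split=> //.
  by apply: nbd_mono N1 => u H t wt; apply: H; ord.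
pose P t := nbd u0 (fun u => forall s, dle true v2 s -> dle true s t -> ~ A u s).
have dP : ddef S P by rewrite /P /nbd; definability.
have step t : exists l r, iv true l r t /\ nbd u0 (fun u => forall s, iv true l r s -> ~ A u s).
  have [l lt] := unbounded om false t; have [r tr] := unbounded om true t.
  have [//|l' [r' [[_ [_ ti]] [N|[/nA//]]]]] := gA t l r.
  by exists l', r'.
suff : P v1.
  move=> N; apply: nbd_mono (nbd_and N (nbd_and N1 N2)) => u [H [H1 H2]] t At.
  have [h|/dleNgt h] := pselect (dle true v2 t); last by apply: (H2 t).
  have [h'|/dleNgt h'] := pselect (dle true t v1); last by apply: (H1 t).
  by apply: (H t).
apply: (connected_ind om (b := true) dP (p := v2) (q := v1)) => //; try exact: dlexx; try exact: dltW.
- have [l [r [[lt tr] N]]] := step v2; apply: nbd_mono N => u H s h1 h2.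
  by apply: H; split; ord.
- move=> t v2t tv1 Pt; have [l [r [[lt tr] N]]] := step t.
  exists r; split=> // t' /= tt' t'r; apply: nbd_mono (nbd_and N Pt) => u [H1 H2] s h1 h2.
  have [h|/dleNgt h] := pselect (dle true s t); first exact: H2.
  by apply: H1; split; ord.
- move=> t v2t tv1 IH; have [l [r [[lt tr] N]]] := step t.
  have [t' [lt' [t't v2t']]] : exists t', dlt true l t' /\ dlt true t' t /\ dle true v2 t'.
    have [h|/dleNgt h] := pselect (dle true l v2).
      by have [t' [? ?]] := dense om v2t; exists t'; split; [ord|split; [|ord]].
    by have [t' [? ?]] := dense om lt; exists t'; split; [|split; [|ord]].
  apply: nbd_mono (nbd_and N (IH t' v2t' t't)) => u [H1 H2] s h1 h2.
  have [h|/dleNgt h] := pselect (dle true s t'); first exact: H2.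
  by apply: H1; split; ord.
Qed.

End Fibers.

Lemma card_le_split k (A B : M -> Prop) x : ~ B x -> (forall t, A t <-> B t \/ t = x) ->
  (card_le k.+1 A <-> card_le k B).
Proof.
move=> nBx AB; split.
  by move=> kA; apply: (card_leD1 nBx); apply: card_le_mono kA => t; rewrite AB.
by move=> kB; exists x; apply: card_le_mono kB => t [/AB[]].
Qed.

Lemma card_leS k (A : M -> Prop) : card_le k A -> card_le k.+1 A.
Proof.
elim: k A => [|k IH] A.
  by have [x _] := o_minimal_nonempty om => nA; exists x => t [/nA].
by move=> [x /IH H]; exists x.
Qed.

Lemma card_leq k l (A : M -> Prop) : (k <= l)%N -> card_le k A -> card_le l A.
Proof.
move=> /subnKC <-; elim: (l - k)%N => [|m IH]; first by rewrite addn0.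
by rewrite addnS => /IH; apply: card_leS.
Qed.

Lemma card_le_same k (A B : M -> Prop) : (forall t, A t <-> B t) -> (card_le k A <-> card_le k B).
Proof. by move=> AB; split; apply: card_le_mono => t; rewrite AB. Qed.

(** Induction by removing from A the whole box of one point x of [A u0]. Nearby fibres have exactly
    one point in this box, so each loses one point, and the remaining family is still good at u0. *)
Lemma card_locally_constant K (A : M -> M -> Prop) u0 : ddef2 S A -> good A u0 -> card_le K (A u0) ->
  nbd u0 (fun u => forall k, card_le k (A u) <-> card_le k (A u0)).
Proof.
elim: K A => [|K IH] A dA gA KA.
  apply: nbd_mono (nbd_empty dA gA KA) => u nu k; apply: card_le_same => t.
  by split=> [/nu|/KA].
have [[x Ax]|/forallNP nA] := pselect (exists x, A u0 x); last first.
  apply: nbd_mono (nbd_empty dA gA nA) => u nu k; apply: card_le_same => t.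
  by split=> [/nu|/nA].
have [r [xr rA]] := card_le_near om true (Some x) KA.
have [l [xl lA]] := card_le_near om false (Some x) KA.
have [r1 [xr1 r1r]] := dense om (b := true) xr.
have [l1 [xl1 l1l]] := dense om (b := false) xl.
(* The endpoints are included, so that every other point of [A u0] has a box disjoint from the one
   to be removed. At the endpoints of the removed box the fibre over u0 has no point, and the empty
   kind of box is available. *)
have only t : A u0 t -> dle true l1 t -> dle true t r1 -> t = x.
  move=> At h1 h2; have [h|[//|h]] := dlt_total true t x.
    by case: (lA t) => //; ord.
  by case: (rA t) => //; ord.
have [|l' [r' [[ll' [r'r [l'x xr']]] [[H _]|[_ N]]]]] := gA.1 x l1 r1.
- by split; ord.
- by case: (H x).
pose A' u t := A u t /\ ~ iv true l' r' t.
have dA' : ddef2 S A' by rewrite /A' /iv; definability.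
have sub l0 r0 t : iv true l0 r0 t -> iv true l' r' t -> exists l2 r2,
    (dle true l0 l2 /\ dle true r2 r0 /\ iv true l2 r2 t) /\ dle true l' l2 /\ dle true r2 r'.
  move=> [lt tr] [lt' tr'].
  have [l2 [? [? ?]]] : exists l2, dle true l0 l2 /\ dle true l' l2 /\ dlt true l2 t.
    have [h|/dleNgt h] := pselect (dle true l0 l').
      by exists l'; split=> //; split=> //; exact: dlexx.
    by exists l0; split; [exact: dlexx|split=> //; ord].
  have [r2 [? [? ?]]] : exists r2, dle true r2 r0 /\ dle true r2 r' /\ dlt true t r2.
    have [h|/dleNgt h] := pselect (dle true r' r0).
      by exists r'; split=> //; split=> //; exact: dlexx.
    by exists r0; split; [exact: dlexx|split=> //; ord].
  by exists l2, r2.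
have gA' : good A' u0.
  split=> [t|c]; last first.
    by have [v Nv] := gA.2 c; exists v; apply: nbd_mono Nv => u H t' vt' [At _]; exact: (H t' vt' At).
  move=> l0 r0 ti.
  have [ti'|nti'] := pselect (iv true l' r' t).
    have [l2 [r2 [H [h1 h2]]]] := sub _ _ _ ti ti'; exists l2, r2; split=> //; left.
    apply: (nbd_mono _ N) => u _ s [h3 h4] [_]; apply; split; ord.
  have [At|nAt] := pselect (A u0 t); last first.
    have [l2 [r2 [H [N'|[//]]]]] := gA.1 t _ _ ti; exists l2, r2; split=> //; left.
    by apply: (nbd_mono _ N') => u H' s si [As _]; apply: (H' s).
  have [l3 [r3 [h1 [h2 [h3 h4]]]]] : exists l3 r3, dle true l0 l3 /\ dle true r3 r0 /\ iv true l3 r3 t /\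
      forall s, iv true l3 r3 s -> ~ iv true l' r' s.
    case: ti => ti1 ti2; have [h|/dleNgt h] := pselect (dle true t r1).
      have [h'|/dleNgt h'] := pselect (dle true l1 t).
        by case: nti'; rewrite (only t).
      have [h5|/dleNgt h5] := pselect (dle true r0 l1).
        exists l0, r0; do 2![split; first exact: dlexx]; split; first by split.
        by move=> s [? ?] [? ?]; ord.
      exists l0, l1; split; [exact: dlexx|split; [ord|split; [by split; ord|]]].
      by move=> s [? ?] [? ?]; ord.
    have [h5|/dleNgt h5] := pselect (dle true r1 l0).
      exists l0, r0; do 2![split; first exact: dlexx]; split; first by split.
      by move=> s [? ?] [? ?]; ord.
    exists r1, r0; split; [ord|split; [exact: dlexx|split; [by split; ord|]]].
    by move=> s [? ?] [? ?]; ord.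
  have [l2 [r2 [[h5 [h6 h7]] N']]] := gA.1 t _ _ h3; exists l2, r2.
  split; first by split; [ord|split; [ord|]].
  have AA' u s : iv true l2 r2 s -> A' u s <-> A u s.
    by move=> [? ?]; split=> [[]//|As]; split=> //; apply: h4; split; ord.
  case: N' => [N'|[_ N']]; [left|right; split; first by apply/AA'].
    by apply: nbd_mono N' => u H s si /(AA' _ _ si); apply: H.
  apply: nbd_mono N' => u [s [[si As] sU]]; exists s; split; first by split=> //; apply/AA'.
  by move=> s' si' /(AA' _ _ si'); apply: sU.
have key u : (exists t, (iv true l' r' t /\ A u t) /\
      (forall t', iv true l' r' t' -> A u t' -> t' = t)) ->
    forall k, card_le k.+1 (A u) <-> card_le k (A' u).
  move=> [t [[ti At] tU]] k; apply: (@card_le_split k _ _ t); first by case.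
  move=> s; split=> [As|[[]//|->//]].
  by have [si|] := pselect (iv true l' r' s); [right; apply: tU|left].
have kA' : card_le K (A' u0) by rewrite -key //; case: N.
apply: nbd_mono (nbd_and N (IH _ dA' gA' kA')) => u [Hu HI] [|k].
  split=> [nA|/(_ x)//]; exfalso; case: Hu => t [[_ At] _]; exact: (nA t).
by rewrite !key //; case: N.
Qed.

Lemma card_connected b (A : M -> M -> Prop) g u k : ddef2 S A -> (forall u, fin (A u)) -> dlt b g u ->
  (forall s, dle b g s -> dle b s u -> good A s) -> (card_le k (A g) <-> card_le k (A u)).
Proof.
move=> dA fA gu gA.
pose P t := card_le k (A g) <-> card_le k (A t).
have dP : ddef S P.
  by rewrite /P; apply: ddef_equiv; [definability|apply: (ddef_card_le k dA)].
have loc s : dle b g s -> dle b s u -> nbd s (fun u => forall k, card_le k (A u) <-> card_le k (A s)).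
  by move=> h1 h2; have [K KA] := fA s; apply: card_locally_constant KA => //; apply: gA.
apply: (connected_ind om (b := b) dP (p := g) (q := u)) => //; try exact: dlexx; try exact: dltW.
  move=> t gt tu Pt; have [_ N] := loc t gt (dltW tu).
  by apply: near_mono (N b) => s _ H; rewrite /P H.
move=> t gt tu IH; have [_ N] := loc t (dltW gt) tu.
have [s [gs [st H]]] := near_pickN om (N (~~ b)) gt.
by rewrite /P -H; apply: IH => //; apply: dltW.
Qed.

Definition bounded_fibers E (s : dsort S E) := forall A : E -> M -> Prop, ddef2 S A ->
  (forall e, fin (A e)) -> exists k, forall e, card_le k (A e).

Lemma card_le_cover E (s : dsort S E) k : forall A : E -> M -> Prop, ddef2 S A ->
  (forall e, card_le k (A e)) -> exists f : 'I_k -> E -> M, (forall i, dfun S (f i)) /\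
    forall e t, A e t -> exists i, t = f i e.
Proof.
elim: k => [|k IH] A dA kA.
  exists (fun (i : 'I_0) e => False_rect M (notF (ltn_ord i))); split=> [[]//|e t At].
  by case: (kA e t).
pose R e x := card_le k (fun t => A e t /\ t <> x).
have dR : ddef2 S R.
  by apply: (ddef_card_le k (R := fun (z : E * M) t => A z.1 t /\ t <> z.2)); definability.
have [//|x [dx xP]] := skolem sk dR.
have [||f [df fP]] := IH (fun e t => A e t /\ t <> x e); [definability|exact: xP|].
exists (fun i => if unlift ord0 i is Some j then f j else x); split.
  by move=> i; case: unliftP => [j _|_].
move=> e t At; have [->|tx] := pselect (t = x e); first by exists ord0; rewrite unlift_none.
by have [i ->] := fP e t (conj At tx); exists (lift ord0 i); rewrite liftK.
Qed.

Lemma bounded_fibers_max E (s : dsort S E) n (A : 'I_n -> E -> M -> Prop) : bounded_fibers s ->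
  (forall i, ddef2 S (A i)) -> (forall i e, fin (A i e)) -> exists k, forall i e, card_le k (A i e).
Proof.
move=> ufE dA fA; have H i := cid (ufE _ (dA i) (fA i)).
exists (\max_i (projT1 (H i)))%N => i e; apply: card_leq (projT2 (H i) e).
exact: leq_bigmax.
Qed.

Lemma bounded_fibers_step E (s : dsort S E) :
  bounded_fibers s -> bounded_fibers (dsort_prod s (dsort_base S)).
Proof.
move=> ufE A dA fA.
pose A3 e u t := A (e, u) t.
have dA3 : ddef3 S A3 by rewrite /A3; definability.
pose Bad e u := ~ good (A3 e) u.
have dBad : ddef2 S Bad by have dg := ddef_good dA3; rewrite /Bad; apply: ddef_not; exact: dg.
have fBad e : fin (Bad e).
  have dBe : ddef S (fun u => Bad e u) by definability.
  apply: (no_interval_fin om (b := true) dBe) => p q pq.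
  have dAe : ddef2 S (A3 e) by rewrite /A3; definability.
  have [|t [pt [tq ng]]] := near_pick om (near_good dAe true (Some p) _) (c := q) pq.
    by move=> u; apply: fA.
  by exists t; do 2!split=> //; apply.
have [k0 kBad] := ufE _ dBad fBad.
have [bs [dbs bsP]] := card_le_cover dBad kBad.
(* The gap to the right of a bad parameter is sampled just after it. Parameters before all bad ones
   have no such left end and are sampled by [l] below. *)
pose R i e r := dlt true (bs i e) r /\ forall s, dlt true (bs i e) s -> dle true s r -> ~ Bad e s.
have dR i : ddef2 S (R i) by have dbi := dbs i; rewrite /R; definability.
have Rex i e : exists r, R i e r.
  have [c [bc cP]] := card_le_near om true (Some (bs i e)) (kBad e).
  have [r [br rc]] := dense om bc; exists r; split=> // t bt tr; apply: cP => //; ord.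
have H i := cid (skolem sk (dR i) (Rex i)).
pose rs i := projT1 (H i).
have drs i : dfun S (rs i) := (projT2 (H i)).1.
have rsP i : forall e, R i e (rs i e) := (projT2 (H i)).2.
pose L e r := forall s, dle true s r -> ~ Bad e s.
have dL : ddef2 S L by rewrite /L; definability.
have [|l [dl lP]] := skolem sk dL.
  move=> e; have [c [_ cP]] := card_le_near om true None (kBad e).
  have [r cr] := unbounded om false c; exists r => t tr; apply: cP => //; ord.
have [k1 K1] : exists k, forall i e, card_le k (A (e, bs i e)).
  apply: (bounded_fibers_max (A := fun i e => A (e, bs i e)) ufE) => // i.
  by have dbi := dbs i; definability.
have [k2 K2] : exists k, forall i e, card_le k (A (e, rs i e)).
  apply: (bounded_fibers_max (A := fun i e => A (e, rs i e)) ufE) => // i.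
  by have dri := drs i; definability.
have [k3 K3] : exists k, forall e, card_le k (A (e, l e)) by apply: ufE => //; definability.
exists (k1 + (k2 + k3))%N => -[e u].
have conn b g : dlt b g u -> (forall s, dle b g s -> dle b s u -> ~ Bad e s) ->
    forall k, card_le k (A (e, g)) -> card_le k (A (e, u)).
  move=> gu gs k; have dAe : ddef2 S (A3 e) by rewrite /A3; definability.
  apply: (card_connected k dAe (fun u => fA (e, u)) gu _).1 => t gt tu.
  by apply: contrapT; apply: gs.
have [Bu|nBu] := pselect (Bad e u).
  have [i ->] := bsP _ _ Bu; apply: card_leq (K1 i e); exact: leq_addr.
have [[s0 [Bs0 s0u]]|/forallNP nB] := pselect (exists s, Bad e s /\ dlt true s u).
  (* The last bad parameter before u: the sample after it lies in the same gap as u. *)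
  have [m [[Bm mu] mP]] := card_le_max true
    (card_le_mono (A := fun s => Bad e s /\ dlt true s u) (fun t => fun h => h.1) (kBad e)) (conj Bs0 s0u).
  have [i im] := bsP _ _ Bm; have [mr rP] := rsP i e; rewrite -im in mr rP.
  suff : card_le k2 (A (e, u)) by apply: card_leq; rewrite addnCA leq_addr.
  have := K2 i e; have [ru|[->//|ur]] := dlt_total true (rs i e) u.
    apply: (conn true) => // t rt tu Bt; have [ut|ut] := pselect (u = t); first by subst.
    have tu' : dlt true t u by move/dle_eqVlt: tu => [/esym//|].
    by have := mP t (conj Bt tu') => ?; ord.
  by apply: (conn false) => // t rt tu; apply: rP; ord.
suff : card_le k3 (A (e, u)) by apply: card_leq; rewrite addnA leq_addl.
have := K3 e; have [ru|[->//|ur]] := dlt_total true (l e) u.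
  apply: (conn true) => // t rt tu Bt; have [ut|ut] := pselect (u = t); first by subst.
  have tu' : dlt true t u by move/dle_eqVlt: tu => [/esym//|].
  exact: (nB t).
by apply: (conn false) => // t rt tu; apply: lP; ord.
Qed.

Lemma dfun_row E (s : dsort S E) n (f : E -> 'rV[M]_n) :
  (forall j, dfun S (fun x : E => f x ord0 j)) -> dfun S f.
Proof.
move=> df; apply: (ddef_iff (P := fun z : E * 'rV[M]_n => forall j, z.2 ord0 j = f z.1 ord0 j)).
  by move=> [x y] /=; split=> [H|-> //]; apply/rowP.
have dc j : dfun S (fun w : 'rV[M]_n => w ord0 j) by apply: dfun_bmap; apply/coordinate_bmap/coord_rV.
definability; [exact: dfun_comp (dfun_snd (dfun_id _)) (dc _)|].
exact: dfun_comp (dfun_fst (dfun_id _)) (df _).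
Qed.

Lemma dfun_coord n j : dfun S (fun w : 'rV[M]_n => w ord0 j).
Proof. by apply: dfun_bmap; apply/coordinate_bmap/coord_rV. Qed.

Lemma dfun_row_mx E (s : dsort S E) m n (f : E -> 'rV[M]_m) (g : E -> 'rV[M]_n) :
  dfun S f -> dfun S g -> dfun S (fun x : E => row_mx (f x) (g x)).
Proof.
move=> df dg; apply: dfun_row => j; case: (split_ordP j) => i ->.
  suff -> : (fun x : E => row_mx (f x) (g x) ord0 (lshift n i)) = fun x : E => f x ord0 i.
    exact: dfun_comp df (dfun_coord i).
  by apply: funext => x; rewrite row_mxEl.
suff -> : (fun x : E => row_mx (f x) (g x) ord0 (rshift m i)) = fun x : E => g x ord0 i.
  exact: dfun_comp dg (dfun_coord i).
by apply: funext => x; rewrite row_mxEr.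
Qed.

Lemma dfun_const_mx n : dfun S (const_mx : M -> 'rV[M]_n).
Proof.
apply: dfun_row => j; suff -> : (fun x : M => (const_mx x : 'rV_n) ord0 j) = id by apply: dfun_id.
by apply: funext => x; rewrite mxE.
Qed.

Definition rV_cons n (z : 'rV[M]_n * M) : 'rV[M]_(n.+1) := row_mx (const_mx z.2 : 'rV_1) z.1.

Lemma dfun_rV_cons n : dfun S (@rV_cons n).
Proof.
apply: (dfun_row_mx (f := fun z : 'rV[M]_n * M => const_mx z.2 : 'rV_1)); last exact: dfun_fst (dfun_id _).
exact: dfun_comp (dfun_snd (dfun_id _)) (dfun_const_mx 1).
Qed.

Lemma rV_cons_surj n (w : 'rV[M]_(n.+1)) : exists z : 'rV[M]_n * M, w = rV_cons z.
Proof.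
exists (rsubmx (w : 'rV_(1 + n)), w ord0 ord0); apply: (etrans (esym (@hsubmxK _ 1 1 n w))).
congr row_mx; by apply/rowP => i; rewrite !mxE ord1; congr (w _ _); apply: val_inj.
Qed.

Lemma bounded_fibers_rV n : bounded_fibers (dsort_rV S n).
Proof.
elim: n => [|n /bounded_fibers_step ufn] A dA fA.
  have [k kA] := fA (\row_(i < 0) False_rect M (notF (ltn_ord i))).
  by exists k => e; rewrite (_ : e = \row_(i < 0) False_rect M (notF (ltn_ord i))) //; apply/rowP => -[].
have dc := @dfun_rV_cons n.
have [||k kA] := ufn (fun z : 'rV[M]_n * M => A (rV_cons z)); [definability|by move=> z; apply: fA|].
by exists k => w; have [z ->] := rV_cons_surj w.
Qed.

Lemma dfun_enc E (s : dsort S E) : dfun S (enc : E -> 'rV[M]_(dim s)).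
Proof. by apply/dfun_bmap/bmap_rV => j; left; exists j. Qed.

Lemma uniform_finiteness E (s : dsort S E) : bounded_fibers s.
Proof.
move=> A dA fA; have denc := dfun_enc s.
have [||k kA] := bounded_fibers_rV (A := fun w t => exists e, w = enc e /\ A e t).
- by definability.
- move=> w; have [[e ->]|/forallNP nw] := pselect (exists e : E, w = enc e); last first.
    by exists 0%N => t [e [/nw]].
  by have [k kA] := fA e; exists k; apply: card_le_mono kA => t [e' [ee' At]]; rewrite (enc_inj ee').
by exists k => e; apply: card_le_mono (kA (enc e)) => t At; exists e.
Qed.

End UniformFiniteness.

(** * Limits of definable types *)

Section TypeLimits.
Context d (M : orderTopologicalType d) (S : structure M).
Hypotheses (om : o_minimal S) (sk : definable_skolem_functions S).

Inductive germ := Pt of M | Side of bool & option M.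

Definition ev (G : germ) (A : M -> Prop) :=
  match G with Pt x => A x | Side b o => near b o A end.

Lemma ev_mono G (A B : M -> Prop) : (forall t, A t -> B t) -> ev G A -> ev G B.
Proof. by case: G => [x|b o] AB /=; [apply: AB|apply: near_mono => t _; apply: AB]. Qed.

Lemma ev_and G (A B : M -> Prop) : ev G A -> ev G B -> ev G (fun t => A t /\ B t).
Proof. by case: G => [x|b o] //=; apply: near_and. Qed.

Lemma ev_ex G (A : M -> Prop) : ev G A -> exists t, A t.
Proof. by case: G => [x|b o] /= => [|/(near_ex om)[t []]]; [exists x|exists t]. Qed.

(** The germ sits at the supremum m of the points v below which some member of the chain has no
    point, or at an infinite end. It lies after m if some member is entirely beyond m, at m if all
    members contain m, and before m otherwise; in each case a member that misses the germ would,
    with a smaller member, move m. *)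
Lemma chain_germ E (s : dsort S E) (T : E -> Prop) (A : E -> M -> Prop) :
  ddef S T -> ddef2 S A -> (exists e, T e) -> (forall e, T e -> exists t, A e t) ->
  (forall e f, T e -> T f -> (forall t, A e t -> A f t) \/ (forall t, A f t -> A e t)) ->
  exists G, forall e, T e -> ev G (A e).
Proof.
move=> dT dA [e0 Te0] Ane ch.
have dAe e : ddef S (fun t => A e t) by definability.
pose V v := exists e, T e /\ forall t, A e t -> dlt true v t.
have dV : ddef S V by rewrite /V; definability.
have cap e f : T e -> T f -> exists g, T g /\ forall t, A g t -> A e t /\ A f t.
  by move=> Te Tf; have [H|H] := ch _ _ Te Tf; [exists e|exists f]; split=> // t At; split=> //; apply: H.
have [VT|/existsNP[v1 nV1]] := pselect (forall v, V v).
  exists (Side false None) => e Te /=.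
  have [//|[c [_ cA]]] := near_dich om false None (dAe e).
  have [f [Tf fc]] := VT c; have [g [Tg gP]] := cap _ _ Te Tf.
  by have [t /gP[At /fc ct]] := Ane _ Tg; case: (cA t).
have [[v0 V0]|/forallNP nV] := pselect (exists v, V v); last first.
  exists (Side true None) => e Te /=.
  have [//|[c [_ cA]]] := near_dich om true None (dAe e).
  have [t0 t0c] := unbounded om false c; case: (nV t0); exists e; split=> // t At.
  have [h|/dleNgt h] := pselect (dle true c t); first by ord.
  by case: (cA t).
have down v w : V w -> dle true v w -> V v.
  by move=> [e [Te eP]] vw; exists e; split=> // t /eP ?; ord.
have [|m [Vm mV]] := dsup om (b := true) dV V0 (u := v1).
  by move=> t Vt; apply/dltNge => h; apply: nV1; apply: down Vt _; apply: dltW.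
have [Vmm|nVm] := pselect (V m).
  exists (Side true (Some m)) => e Te /=.
  have [//|[c [/= mc cA]]] := near_dich om true (Some m) (dAe e).
  have [f [Tf fm]] := Vmm; have [g [Tg gP]] := cap _ _ Te Tf.
  have [t [mt tc]] := dense om (b := true) mc.
  have /Vm ? : V t.
    exists g; split=> // u /gP[Au /fm mu].
    have [h|/dleNgt h] := pselect (dle true c u); first by ord.
    by case: (cA u).
  by ord.
have [Am|/existsNP[e1 /not_implyP[Te1 nA1]]] := pselect (forall e, T e -> A e m).
  by exists (Pt m).
exists (Side false (Some m)) => e Te /=.
have [//|[c [/= cm cA]]] := near_dich om false (Some m) (dAe e).
have [c' [/down Vc' cc']] := mV c cm.
have [f [Tf fc]] := Vc' _ (dltW cc').
have [g [Tg gP]] := cap _ _ Te Tf; have [g' [Tg' gP']] := cap _ _ Tg Te1.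
case: nVm; exists g'; split=> // t /gP'[/gP[Aet /fc ct] A1t].
have [h|[h|//]] := dlt_total true t m; last by subst.
by case: (cA t).
Qed.

Definition has_cofinal_curve E (s : dsort S E) := forall (T : E -> Prop) (le : E -> E -> Prop),
  ddef S T -> ddef2 S le -> (exists e, T e) ->
  (forall e f, T e -> T f -> le e f \/ le f e) ->
  (forall e f g, T e -> T f -> T g -> le e f -> le f g -> le e g) ->
  exists (c : M -> E) (G : germ), dfun S c /\ forall e, T e -> ev G (fun t => T (c t) /\ le e (c t)).

Lemma cofinal_curve_surj E F (s : dsort S E) (t : dsort S F) (f : F -> E) :
  dfun S f -> (forall e, exists x, e = f x) -> has_cofinal_curve t -> has_cofinal_curve s.
Proof.
move=> df fs ccF T le dT dle [e0 Te0] tot tr.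
have [|||||c [G [dc cG]]] := ccF (fun x => T (f x)) (fun x y => le (f x) (f y)).
- by definability.
- by definability.
- by have [x0 ex] := fs e0; exists x0; rewrite -ex.
- by move=> x y; apply: tot.
- by move=> x y z; apply: tr.
exists (fun t => f (c t)), G; split; first by definability.
by move=> e Te; have [x ex] := fs e; subst e; apply: cG.
Qed.

(* If no fibre of the last coordinate is cofinal, a Skolem function g bounds each
   of them, and {t | e <= g t} is a chain of nonempty subsets of M. *)
Lemma cofinal_curve_step E (s : dsort S E) :
  has_cofinal_curve s -> has_cofinal_curve (dsort_prod s (dsort_base S)).
Proof.
move=> ccE T le dT dle [e0 Te0] tot tr.
have [[t0 H]|/forallNP nH] := pselect (exists t, forall e, T e -> exists w, T (w, t) /\ le e (w, t)).
  have [|||||c [G [dc cG]]] := ccE (fun w => T (w, t0)) (fun w w' => le (w, t0) (w', t0)).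
  - by definability.
  - by definability.
  - by have [w [Tw _]] := H _ Te0; exists w.
  - by move=> x y; apply: tot.
  - by move=> x y z; apply: tr.
  exists (fun t => (c t, t0)), G; split; first by definability.
  move=> e Te; have [w [Tw ew]] := H _ Te; apply: ev_mono (cG w Tw) => t [Tc wc].
  by split=> //; apply: tr ew wc.
pose R t e := T e /\ forall w, T (w, t) -> ~ le e (w, t).
have dR : ddef2 S R by rewrite /R; definability.
have [|g [dg gP]] := skolem sk dR.
  move=> t; have /existsNP[e /not_implyP[Te /forallNP eP]] := nH t.
  by exists e; split=> // w Tw ew; apply: (eP w).
have [||||G GP] := @chain_germ _ _ T (fun e t => le e (g t)) dT.
- by definability.
- by exists e0.
(* The set attached to (w, t) contains t, since [g t] is not below any point of the fibre over t and
   the preorder is total. *)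
- move=> [w t] Te; exists t; have [Tg nle] := gP t.
  by have [//|] := tot _ _ Te Tg => /nle; case.
- move=> e f Te Tf; have [ef|fe] := tot _ _ Te Tf; [right|left] => t; apply: tr => //; exact: (gP t).1.
exists g, G; split=> // e Te; apply: ev_mono (GP e Te) => t.
by split=> //; exact: (gP t).1.
Qed.

Lemma cofinal_curve_rV n : has_cofinal_curve (dsort_rV S n).
Proof.
elim: n => [|n /cofinal_curve_step]; last first.
  by apply: cofinal_curve_surj; [apply: dfun_rV_cons|apply: rV_cons_surj].
move=> T le dT dle [e0 Te0] tot tr; have [x _] := o_minimal_nonempty om.
exists (fun=> e0), (Pt x); split; first by definability.
move=> e Te /=; split=> //; have -> : e = e0 by apply/rowP => -[].
by case: (tot e0 e0 Te0 Te0).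
Qed.

(** This carries results proved for rows, by induction on their length, over to all sorts. *)
Lemma decode E (s : dsort S E) (e0 : E) :
  exists f : 'rV[M]_(dim s) -> E, dfun S f /\ forall e, f (enc e) = e.
Proof.
have denc := dfun_enc s.
pose R (w : 'rV[M]_(dim s)) (e : E) := forall e', enc e' = w -> e' = e.
have dR : ddef2 S R by rewrite /R; definability.
have [|f [df fP]] := skolem sk dR; last by exists f; split=> // e; apply/esym/fP.
move=> w; have [[e <-]|/forallNP nw] := pselect (exists e : E, enc e = w).
  by exists e => e' H; apply: enc_inj H.
by exists e0 => e' /nw.
Qed.

Lemma cofinal_curve E (s : dsort S E) : has_cofinal_curve s.
Proof.
move=> T le dT dle Tex; have [e0 _] := Tex; have [f [df fP]] := decode s e0.
apply: (cofinal_curve_surj df _ (@cofinal_curve_rV (dim s))) => // e.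
by exists (enc e).
Qed.

(* Definable types, given as properties of which only the values on definable sets
   matter. *)
Record dtype E (s : dsort S E) (alpha : (E -> Prop) -> Prop) : Prop := DType {
  dtype_T : alpha (fun=> True);
  dtype_0 : ~ alpha (fun=> False);
  dtype_and : forall A B, alpha A -> alpha B -> alpha (fun x => A x /\ B x);
  dtype_mono : forall A B, alpha A -> ddef S B -> (forall x, A x -> B x) -> alpha B;
  dtype_ultra : forall A, ddef S A -> alpha A \/ alpha (fun x => ~ A x);
  dtype_def : forall F (t : dsort S F) (R : F -> E -> Prop),
    ddef2 S R -> ddef S (fun f => alpha (R f)) }.

Section TypeTheory.
Context E (s : dsort S E) (alpha : (E -> Prop) -> Prop) (da : dtype s alpha).

Lemma dtype_ex A : alpha A -> exists x, A x.
Proof.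
move=> aA; apply: contrapT => /forallNP nA; apply: (dtype_0 da).
by apply: (dtype_mono da aA) => //; exact: ddef_const.
Qed.

Lemma dtype_forall_ord k (A : 'I_k -> E -> Prop) : (forall i, ddef S (A i)) ->
  (forall i, alpha (A i)) -> alpha (fun x => forall i, A i x).
Proof.
elim: k A => [|k IH] A dA aA.
  by apply: (dtype_mono da (dtype_T da)); [definability|move=> x _ []].
have := dtype_and da (aA ord0) (IH _ (fun i => dA (lift ord0 i)) (fun i => aA (lift ord0 i))).
move=> H; apply: (dtype_mono da H); first by definability.
by move=> x [A0 AS] i; have [j ->|->] := unliftP ord0 i.
Qed.

End TypeTheory.

Lemma ord_max_ex k (P : 'I_k -> Prop) (f : 'I_k -> M) i0 : P i0 ->
  exists i, P i /\ forall j, P j -> dle true (f j) (f i).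
Proof.
move=> P0; pose A v := exists i, P i /\ v = f i.
have kA : card_le k A.
  rewrite /A; elim: k P f {i0 P0 A} => [|k IH] P f /=; first by move=> t [[]].
  exists (f ord0); apply: card_le_mono (IH (fun i => P (lift ord0 i)) (fun i => f (lift ord0 i))).
  move=> t [[i [Pi ->]] fi]; have [j ij|i0] := unliftP ord0 i; last by case: fi; rewrite i0.
  by exists j; rewrite -ij.
have [_ [[i [Pi ->]] mP]] := card_le_max true kA (t0 := f i0) (ex_intro _ i0 (conj P0 erefl)).
by exists i; split=> // j Pj; apply: mP; exists j.
Qed.

(** * Limits of push-forwards of definable types *)

Section Limits.
Context X (sX : dsort S X) W (sW : dsort S W) (U : W -> X -> Prop) (dU : ddef2 S U).
Hypothesis lim_curve : forall f : M -> X, dfun S f -> forall b o,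
  exists z, forall w, U w z -> near b o (fun t => U w (f t)).

Lemma lim_germ (f : M -> X) G : dfun S f -> exists z, forall w, U w z -> ev G (fun t => U w (f t)).
Proof. by case: G => [x|b o] df /=; [exists (f x)|apply: lim_curve]. Qed.

(** Only the family U stands for the topology of X. Push-forwards along h are considered, rather
    than types on X, so that the induction can run on the length of rows in E. *)
Definition has_limits E (s : dsort S E) := forall alpha, dtype s alpha ->
  forall h : E -> X, dfun S h -> exists z, forall w, U w z -> alpha (fun e => U w (h e)).

Lemma has_limits_surj E F (s : dsort S E) (t : dsort S F) (f : F -> E) (g : E -> F) :
  dfun S f -> dfun S g -> (forall e, f (g e) = e) -> has_limits t -> has_limits s.
Proof.
move=> df dg fg lF alpha da h dh.
have db : dtype t (fun B => alpha (fun e => B (g e))).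
  split.
  - exact: dtype_T da.
  - exact: dtype_0 da.
  - by move=> A B; apply: dtype_and da _ _.
  - by move=> A B aA dB AB; apply: (dtype_mono da aA); [definability|move=> x; apply: AB].
  - by move=> A dA; apply: (dtype_ultra da (A := fun e => A (g e))); definability.
  - by move=> G u R dR; apply: (dtype_def da (R := fun x e => R x (g e))); definability.
have [|z zP] := lF _ db (fun x => h (f x)); first by definability.
by exists z => w /zP aU; apply: (dtype_mono da aU); [definability|move=> x; rewrite fg].
Qed.

Section Step.
Context E (s : dsort S E) (limE : has_limits s).
Context (alpha : (E * M -> Prop) -> Prop) (da : dtype (dsort_prod s (dsort_base S)) alpha).
Context (h : E * M -> X) (dh : dfun S h).

Let beta (B : E -> Prop) := alpha (fun z => B z.1).

Lemma proj_dtype : dtype s beta.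
Proof.
split.
- exact: dtype_T da.
- exact: dtype_0 da.
- by move=> A B; apply: dtype_and da _ _.
- by move=> A B aA dB AB; apply: (dtype_mono da aA); [definability|move=> x; apply: AB].
- by move=> A dA; apply: (dtype_ultra da (A := fun z : E * M => A z.1)); definability.
- by move=> G u R dR; apply: (dtype_def da (R := fun x (z : E * M) => R x z.1)); definability.
Qed.

Lemma lim_section (f : E -> M) : dfun S f -> alpha (fun z => z.2 = f z.1) ->
  exists z, forall w, U w z -> alpha (fun e => U w (h e)).
Proof.
move=> df af; have [|z zP] := limE proj_dtype (h := fun y => h (y, f y)); first by definability.
exists z => w /zP bU; apply: (dtype_mono da (dtype_and da af bU)); first by definability.
by move=> [y t] /= [-> ].
Qed.

Hypothesis nolim : forall z, exists w, U w z /\ ~ alpha (fun e => U w (h e)).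

Lemma not_graph f : dfun S f -> ~ alpha (fun z => z.2 = f z.1).
Proof. by move=> df /(lim_section df)[z zP]; have [w [/zP]] := nolim z. Qed.

Lemma no_limit_absurd : False.
Proof.
have da_h : ddef S (fun w => alpha (fun e => U w (h e))).
  by apply: (dtype_def da (R := fun w e => U w (h e))); definability.
have [||wf [dwf wfP]] := skolem sk (R := fun z w => U w z /\ ~ alpha (fun e => U w (h e))).
- by definability; exact: (ddef_comp (dfun_snd (dfun_id _)) da_h).
- exact: nolim.
(* [U (wf x)] is the set U_x. *)
pose C x y t := ~ U (wf x) (h (y, t)).
have dC : ddef3 S C by rewrite /C; definability.
have aC x : alpha (fun z => C x z.1 z.2).
  have dUx : ddef S (fun z => U (wf x) (h z)) by definability.
  have [] := dtype_ultra da dUx; first by have [] := wfP x.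
  move=> H; apply: (dtype_mono da H); first by definability.
  by move=> [y t].
(* The boundary of the fibre of C over (x, y). By uniform finiteness it is covered by finitely many
   definable functions [fs i], among which p_x(y) is chosen. *)
pose Bd (xy : X * E) t := ~ (nbd t (C xy.1 xy.2) \/ nbd t (fun t' => ~ C xy.1 xy.2 t')).
have dBd : ddef2 S Bd by rewrite /Bd /nbd; definability.
have fBd xy : fin (Bd xy).
  have dB : ddef S (fun t => Bd xy t) by definability.
  apply: (no_interval_fin om (b := true) dB) => p q pq.
  have dCxy : ddef S (fun t => C xy.1 xy.2 t) by definability.
  by have [] := near_dich om true (Some p) dCxy => /(near_nbd om) nC;
    have [t [pt [tq Ct]]] := near_pick om nC (c := q) pq;
    exists t; do 2!split=> //; apply; [left|right].
have [k kBd] := uniform_finiteness om sk dBd fBd.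
have [fs [dfs fsP]] := card_le_cover sk dBd kBd.
(* [fs i (x, y)] is below t almost everywhere. If this holds for no i, then p_x
   is -oo. *)
pose Low i x := alpha (fun z => dlt true (fs i (x, z.1)) z.2).
have dLow i : ddef S (Low i).
  have dfi := dfs i.
  by apply: (dtype_def da (R := fun x (z : E * M) => dlt true (fs i (x, z.1)) z.2)); definability.
(* Equality almost everywhere would be the case of a graph, which [not_graph] excludes. *)
have nLow i x : ~ Low i x -> alpha (fun z => dlt true z.2 (fs i (x, z.1))).
  have dfi := dfs i.
  have dl : ddef S (fun z : E * M => dlt true (fs i (x, z.1)) z.2) by definability.
  have de : ddef S (fun z : E * M => z.2 = fs i (x, z.1)) by definability.
  have dfx : dfun S (fun y => fs i (x, y)) by definability.
  move=> nL; have [//|a1] := dtype_ultra da dl.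
  have [/(not_graph dfx)//|a2] := dtype_ultra da de.
  apply: (dtype_mono da (dtype_and da a1 a2)); first by definability.
  move=> [y t] /= [h1 h2]; have [//|[//|h3]] := dlt_total true t (fs i (x, y)).
  by case: h1.
pose T1 x := exists i, Low i x.
have dT1 : ddef S T1 by rewrite /T1; definability; exact: dLow.
pose Rp (xy : X * E) v := T1 xy.1 -> exists i, [/\ Low i xy.1, v = fs i xy &
  forall j, Low j xy.1 -> dle true (fs j xy) v].
have dRp : ddef2 S Rp.
  apply: (ddef_iff (P := fun z : X * E * M => T1 z.1.1 -> exists i, Low i z.1.1 /\
     (z.2 = fs i z.1 /\ forall j, Low j z.1.1 -> dle true (fs j z.1) z.2))).
    by move=> z; split=> H /H [i]; [move=> [? [? ?]]|move=> [? ? ?]]; exists i.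
  by definability.
have [m0 _] := o_minimal_nonempty om.
have [|p [dp pP]] := skolem sk dRp.
  move=> [x y]; have [[i0 L0]|nT] := pselect (T1 x); last by exists m0 => /nT.
  have [i [Li iP]] := ord_max_ex (P := fun i => Low i x) (fun i => fs i (x, y)) L0.
  by exists (fs i (x, y)) => _; exists i.
pose G x (z : E * M) := forall j, Low j x /\ dlt true (fs j (x, z.1)) z.2 \/
  ~ Low j x /\ dlt true z.2 (fs j (x, z.1)).
have aG x : alpha (G x).
  apply: (dtype_forall_ord da) => j; first by definability.
  have [Lj|nLj] := pselect (Low j x).
    by apply: (dtype_mono da Lj) => [|z ?]; [definability|left].
  by apply: (dtype_mono da (nLow _ _ nLj)) => [|z ?]; [definability|right].
have Gp x y t : T1 x -> G x (y, t) -> dlt true (p (x, y)) t.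
  by move=> /(pP (x, y))[i [Li -> _]] /(_ i)[[]//|[]].
(* Real induction downwards from t: the fibre of C cannot be left without meeting its boundary. If
   [T1 x] fails, every e up to t is allowed. *)
have GC x y t e : G x (y, t) -> C x y t -> dle true e t ->
    (T1 x -> dlt true (p (x, y)) e) -> C x y e.
  move=> Gx Cx et pe.
  have dCx : ddef S (fun t => C x y t) by definability.
  have nB t' : dle true e t' -> dle true t' t -> nbd t' (C x y) \/ nbd t' (fun t => ~ C x y t).
    move=> et' t't; apply: contrapT => /(fsP (x, y))[j t'E].
    have [[Lj ft]|[nLj tf]] := Gx j; last by rewrite -t'E in tf; ord.
    have [_ [_ _ /(_ j Lj)]] := pP (x, y) (ex_intro _ j Lj).
    by have := pe (ex_intro _ j Lj); rewrite -t'E => ? ?; ord.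
  apply: (connected_ind om (b := false) dCx (p := t) (q := e)) => //; try exact: dlexx.
    move=> t' tt' t'e Ct'; have [||[_ N]|[nC _]//] := nB t'; [ord|ord|exact: N].
  move=> t' tt' t'e H; have [||[]//|[_ N]] := nB t'; [ord|ord|].
  have tt2 : dlt false t t' by [].
  have [u [tu [ut' nCu]]] := near_pickN om (N (~~ false)) tt2.
  by case: nCu; apply: H => //; apply: dltW.
pose RK (xy : X * E) z := forall w, U w z ->
  (T1 xy.1 -> near true (Some (p xy)) (fun e => U w (h (xy.2, e)))) /\
  (~ T1 xy.1 -> near true None (fun e => U w (h (xy.2, e)))).
have dRK : ddef2 S RK by rewrite /RK; definability.
have [|K [dK KP]] := skolem sk dRK.
  move=> [x y]; have dhy : dfun S (fun e => h (y, e)) by definability.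
  have [T1x|nT] := pselect (T1 x).
    by have [z zP] := lim_curve dhy true (Some (p (x, y))); exists z => w /zP.
  by have [z zP] := lim_curve dhy true None; exists z => w /zP.
pose RZ x z := forall w, U w z -> alpha (fun e => U w (K (x, e.1))).
have dRZ : ddef2 S RZ.
  have dA : ddef S (fun xw : X * W => alpha (fun e => U xw.2 (K (xw.1, e.1)))).
    by apply: (dtype_def da (R := fun (xw : X * W) (e : E * M) => U xw.2 (K (xw.1, e.1)))); definability.
  rewrite /RZ; definability.
  by apply: (ddef_comp (f := fun z : X * X * W => (z.1.1, z.2)) _ dA); definability.
have [|Z [dZ ZP]] := skolem sk dRZ.
  by move=> x; apply: (limE proj_dtype (h := fun y => K (x, y))); definability.
pose lp x x' := alpha (fun z => dle true (p (x, z.1)) (p (x', z.1))).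
have dlp : ddef2 S lp.
  by apply: (dtype_def da (R := fun (xx : X * X) (z : E * M) =>
    dle true (p (xx.1, z.1)) (p (xx.2, z.1)))); definability.
(* Failure of [T1 x] means that p_x is -oo, so such x come first. *)
pose le x x' := ~ T1 x \/ (T1 x' /\ lp x x').
have dle_ : ddef2 S le by rewrite /le; definability.
(* If [Z x'] were in U_x, then so would be [K (x', y)] almost everywhere, hence also h(y, e) for e
   just after p_x'(y). Such e can be taken before t, and they come after p_x(y), where [GC] keeps
   h(y, e) outside U_x. *)
have ZC x x' : le x x' -> ~ U (wf x) (Z x').
  move=> lex UZ.
  have a1 := dtype_and da (dtype_and da (ZP _ _ UZ) (aC x)) (dtype_and da (aG x) (aG x')).
  have [[y t] [[/= UK Cx] [Gx Gx']] pxx'] : exists2 z,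
     (U (wf x) (K (x', z.1)) /\ C x z.1 z.2) /\ (G x z /\ G x' z) &
     T1 x -> dle true (p (x, z.1)) (p (x', z.1)).
    case: lex => [nT|[Tx' lpx]]; first by have [z zP] := dtype_ex da a1; exists z.
    by have [z [zP ?]] := dtype_ex da (dtype_and da a1 lpx); exists z.
  have [KT KnT] := KP (x', y) _ UK.
  have [Tx'|nTx'] := pselect (T1 x').
    have [e [/= pe [et Ue]]] := near_pick om (KT Tx') (c := t) (Gp _ _ _ Tx' Gx').
    by case: (GC x y t e) => //; [ord|move=> /pxx' ?; ord].
  have [e [_ [et Ue]]] := near_pick om (KnT nTx') (c := t) isT.
  case: (GC x y t e) => //; first by ord.
  by case: lex => [nTx /nTx//|[]].
have [e0 _] := dtype_ex da (dtype_T da).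
have [|||||c [Ga [dc cG]]] := @cofinal_curve _ sX (fun=> True) le.
- by definability.
- by [].
- by exists (h e0).
- move=> x x' _ _; have [Tx|nTx] := pselect (T1 x); last by left; left.
  have [Tx'|nTx'] := pselect (T1 x'); last by right; left.
  have dl : ddef S (fun z : E * M => dle true (p (x, z.1)) (p (x', z.1))) by definability.
  have [a1|a1] := dtype_ultra da dl; first by left; right.
  right; right; split=> //; apply: (dtype_mono da a1) => [|z ?]; [definability|ord].
- move=> x x' x'' _ _ _ [nT|[Tx' l1]]; first by left.
  move=> [//|[Tx'' l2]]; right; split=> //.
  by apply: (dtype_mono da (dtype_and da l1 l2)) => [|z [? ?]]; [definability|ord].
have [|z zP] := lim_germ Ga (f := fun t => Z (c t)); first by definability.
have [Uz _] := wfP z.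
have [t [Ut [_ /ZC]]] := ev_ex (ev_and (zP _ Uz) (cG z I)).
exact.
Qed.

End Step.

Lemma has_limits_step E (s : dsort S E) : has_limits s -> has_limits (dsort_prod s (dsort_base S)).
Proof.
move=> limE alpha da h dh; apply: contrapT => /forallNP nz.
apply: (no_limit_absurd limE da dh) => z.
by have /existsNP[w /not_implyP[Uz nU]] := nz z; exists w.
Qed.

Lemma has_limits_rV n : has_limits (dsort_rV S n).
Proof.
elim: n => [|n /has_limits_step]; last first.
  pose g (w : 'rV[M]_(n.+1)) := (rsubmx (w : 'rV_(1 + n)), w ord0 ord0).
  apply: (has_limits_surj (f := @rV_cons _ M n) (g := g)).
  - exact: dfun_rV_cons.
  - apply: dfun_pair; last exact: dfun_coord.
    by apply: dfun_bmap; exact: (@bmap_rsubmx _ _ _ 1 n).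
  move=> w; apply/esym; apply: (etrans (esym (@hsubmxK _ 1 1 n w))).
  by congr row_mx; apply/rowP => i; rewrite !mxE ord1; congr (w _ _); apply: val_inj.
move=> alpha da h dh; have [e0 _] := dtype_ex da (dtype_T da).
exists (h e0) => w Uw; apply: (dtype_mono da (dtype_T da)); first by definability.
by move=> e _; rewrite (_ : e = e0) //; apply/rowP => -[].
Qed.

Lemma dtype_limit E (s : dsort S E) : has_limits s.
Proof.
move=> alpha da; have [e0 _] := dtype_ex da (dtype_T da).
have [f [df fP]] := decode s e0.
exact: (has_limits_surj df (dfun_enc s) fP (@has_limits_rV (dim s)) da).
Qed.

End Limits.

End TypeLimits.

(** * Definable spaces *)

Section Topology.
Context d (M : orderTopologicalType d) (S : structure M).
Hypotheses (om : o_minimal S).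

Definition end_bound b (o : option M) : itv_bound M :=
  if o is Some x then BSide (~~ b) x else BInfty M b.

Lemma mem_end_bounds o o' (t : M) :
  (t \in Interval (end_bound true o) (end_bound false o')) = olt true o t && olt false o' t.
Proof. by case: o o' => [x|] [y|]; rewrite itv_boundlr /= ?bnd_simp. Qed.

Lemma open_ends_bounds (a b : itv_bound M) : itv_open_ends (Interval a b) ->
  exists o o', a = end_bound true o /\ b = end_bound false o'.
Proof.
have aE : itv_open_ends (Interval a b) -> exists o, a = end_bound true o.
  case: a => [c x|c]; first by move/itv_open_ends_lside => ->; exists (Some x).
  by move/itv_open_ends_linfty => ->; exists None.
have bE : itv_open_ends (Interval a b) -> exists o, b = end_bound false o.
  case: b {aE} => [c x|c]; first by move/itv_open_ends_rside => ->; exists (Some x).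
  by move/itv_open_ends_rinfty => ->; exists None.
by move=> oi; have [o ->] := aE oi; have [o' ->] := bE oi; exists o, o'.
Qed.

Lemma olt_shift b o (x : M) : olt b o x -> exists l, dlt b l x /\ forall t, dlt b l t -> olt b o t.
Proof.
case: o => [y|] /= H; first by exists y.
by have [y] := unbounded om (~~ b) x; rewrite dltN => yx; exists y.
Qed.

Lemma nbhs_base (x : M) (P : set M) :
  nbhs x P <-> exists l r, l < x < r /\ forall t, l < t < r -> P t.
Proof.
rewrite itv_nbhsE; split=> [[[a b] [oi xi] iP]|[l [r [lxr lrP]]]]; last first.
  by exists `]l, r[ => // t /=; rewrite in_itv /= => /lrP.
have [o [o' [aE bE]]] := open_ends_bounds oi; subst a b.
move: xi; rewrite mem_end_bounds => /andP[/olt_shift[l [lx lP]] /olt_shift[r [xr rP]]].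
exists l, r; split; first exact/andP.
by move=> t /andP[lt tr]; apply: iP => /=; rewrite mem_end_bounds lP ?rP.
Qed.

Lemma nbhs_rV n (v : 'rV[M]_n) (P : set 'rV[M]_n) :
  nbhs v P <-> exists l r : 'I_n -> M, (forall j, l j < v ord0 j < r j) /\
    forall w : 'rV[M]_n, (forall j, l j < w ord0 j < r j) -> P w.
Proof.
split=> [[Q vQ QP]|[l [r [lvr lrP]]]].
  have H j : exists lr : M * M, lr.1 < v ord0 j < lr.2 /\ forall t, lr.1 < t < lr.2 -> Q ord0 j t.
    by have /nbhs_base[l [r H]] := vQ ord0 j; exists (l, r).
  exists (fun j => (sval (cid (H j))).1), (fun j => (sval (cid (H j))).2); split.
    by move=> j; have [] := svalP (cid (H j)).
  move=> w lwr; apply: QP => i j; rewrite ord1.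
  by have [_ H'] := svalP (cid (H j)); apply: H'; apply: lwr.
exists (fun _ j => [set t | l j < t < r j]) => [i j|w H]; last by apply: lrP => j; apply: H.
by rewrite ord1; apply/nbhs_base; exists (l j), (r j).
Qed.

Lemma open_in_subspace (T : topologicalType) (A U : set T) : U `<=` A ->
  open (U : set (subspace A)) <-> forall x, U x -> nbhs x (fun y => A y -> U y).
Proof.
move=> UA; have E (x : T) (Ux : U x) : within A (nbhs x) U = nbhs (x : subspace A) U
  := congr1 (fun F : set_system T => F U) (nbhs_subspace_in (UA _ Ux)).
rewrite openE; split=> H x Ux.
  by have : nbhs (x : subspace A) U := H x Ux; rewrite -E.
suff : nbhs (x : subspace A) U by [].
by rewrite -E //; apply: H.
Qed.

Lemma nbhs_of_nbd x (P : M -> Prop) : nbd x P -> nbhs x P.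
Proof.
move=> [Px nP]; apply/nbhs_base.
have [r [xr rP]] := nP true; have [l [lx lP]] := nP false.
exists l, r; split; first by apply/andP; split.
move=> t /andP[lt tr]; have [tx|[->//|xt]] := dlt_total true t x.
  by apply: lP.
by apply: rP.
Qed.

End Topology.

Ltac definability_entry_step :=
  match goal with
  | |- dfun _ (fun x => fun_of_matrix (@?f x) ord0 ?j) =>
      refine (@dfun_comp _ _ _ _ _ _ _ _ _ f (fun w => w ord0 j) _ (dfun_coord _ j))
  end; cbv beta.
Ltac definability ::= repeat (first [definability_entry_step | definability_order_step | definability_step]).

Section NearFinite.
Context d (M : orderTopologicalType d) (S : structure M).
Hypotheses (om : o_minimal S).

Lemma near_forall_ord b o n (P : 'I_n -> M -> Prop) :
  (forall i, near b o (P i)) -> near b o (fun t => forall i, P i t).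
Proof.
elim: n P => [|n IH] P nP.
  by apply: near_all => [|t []//]; apply: (olt_ex om).
apply: near_mono (near_and (nP ord0) (IH _ (fun i => nP (lift ord0 i)))) => t _ [P0 PS] i.
by have [j ->|->] := unliftP ord0 i.
Qed.

Lemma nbd_forall_ord x n (P : 'I_n -> M -> Prop) :
  (forall i, nbd x (P i)) -> nbd x (fun t => forall i, P i t).
Proof.
by move=> nP; split=> [i|b]; [case: (nP i)|apply: near_forall_ord => i; case: (nP i)].
Qed.

Lemma near_exists_ord b o n (P : 'I_n -> M -> Prop) : (forall i, ddef S (P i)) ->
  (forall t, exists i, P i t) -> exists i, near b o (P i).
Proof.
move=> dP Pex; apply: contrapT => /forallNP nP.
have H i : near b o (fun t => ~ P i t) by have [/nP|] := near_dich om b o (dP i).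
have [t [_ nPt]] := near_ex om (near_forall_ord H).
by have [i] := Pex t; apply: nPt.
Qed.

Lemma after_near o (A : set M) : after (end_bound true o) A <-> near true o A.
Proof.
split=> [[c /= oc cA]|[c [oc cA]]]; exists c.
- split; first by case: o oc {cA} => [x|]//=; rewrite bnd_simp.
  by move=> t ot tc; apply: cA; rewrite /= (mem_end_bounds o (Some c)) ot.
- by case: o oc {cA} => [x|] //=; rewrite bnd_simp.
- by move=> t /=; rewrite (mem_end_bounds o (Some c)) => /andP[ot tc]; apply: cA.
Qed.

Lemma before_near o (A : set M) : before (end_bound false o) A <-> near false o A.
Proof.
split=> [[c /= oc cA]|[c [oc cA]]]; exists c.
- split; first by case: o oc {cA} => [x|]//=; rewrite bnd_simp.
  by move=> t ot tc; apply: cA; rewrite /= (mem_end_bounds (Some c) o) ot andbT.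
- by case: o oc {cA} => [x|] //=; rewrite bnd_simp.
- by move=> t /=; rewrite (mem_end_bounds (Some c) o) => /andP[tc ot]; apply: cA.
Qed.

End NearFinite.

(** * The points of a definable space as a sort *)

Section SpaceSort.
Context d (M : orderTopologicalType d) (S : structure M).
Hypotheses (om : o_minimal S) (sk : definable_skolem_functions S).
Context (X : definable_space S).

Let k := ncharts X.

(* Least charts make the encoding of points unique. *)
Definition first_chart (i : 'I_k) (x : X) :=
  chart_dom i x /\ forall j : 'I_k, (j < i)%N -> ~ chart_dom j x.

Lemma first_chart_ex x : exists i, first_chart i x.
Proof.
have [i0 _ di0] : (\bigcup_i @chart_dom _ _ _ X i) x by rewrite chart_cover.
pose P n := `[< exists2 i : 'I_k, i = n :> nat & chart_dom i x >].
have [|n /asboolP[i ein di] nmin] := @ex_minnP P.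
  by exists i0; apply/asboolP; exists i0.
exists i; split=> // j ji dj; have : (n <= j)%N by apply: nmin; apply/asboolP; exists j.
by rewrite leqNgt -ein ji.
Qed.

Lemma first_chart_inj i j x : first_chart i x -> first_chart j x -> i = j.
Proof.
move=> [di ni] [dj nj]; case: (ltngtP i j) => [ij|ji|/val_inj//].
  by case: (nj i ij).
by case: (ni j ji).
Qed.

Definition max_dim := (\max_(i < k) chart_dim i)%N.

Lemma chart_dim_max (i : 'I_k) : (chart_dim i <= max_dim)%N.
Proof. exact: (leq_bigmax (F := fun i => chart_dim i)). Qed.

Definition coord_in i (j : 'I_(chart_dim i)) : 'I_max_dim := widen_ord (chart_dim_max i) j.

Context (m0 m1 : M) (m01 : m0 <> m1).

(** Charts may differ in dimension while codes need a common length; the entries past the dimension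
    of the chart are [m0]. *)
Definition pad (i : 'I_k) (v : 'rV[M]_(chart_dim i)) : 'rV[M]_max_dim :=
  \row_l (if insub (val l) is Some j then v ord0 j else m0).

(** The index of a chart is encoded by the position of [m1], which takes only two distinct elements
    of M. *)
Definition code (i : 'I_k) : 'rV[M]_k := \row_l (if l == i then m1 else m0).

Lemma pad_coord i v j : pad v ord0 (@coord_in i j) = v ord0 j.
Proof. by rewrite mxE /= valK. Qed.

Lemma pad_inj i : injective (@pad i).
Proof. by move=> v w e; apply/rowP => j; rewrite -!pad_coord e. Qed.

Lemma code_inj : injective code.
Proof.
by move=> i j /rowP/(_ i); rewrite !mxE eqxx; case: eqP => // _ e; case: m01.
Qed.

Lemma dfun_pad i : dfun S (@pad i).
Proof.
apply: dfun_row => l.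
have -> : (fun x => (@pad i) x ord0 l) =
    fun v => if insub (val l) is Some j then v ord0 j else m0.
  by apply: funext => v; rewrite mxE.
by case: insub => [j|]; [apply: dfun_coord|definability].
Qed.

Definition space_code (i : 'I_k) (v : 'rV[M]_(chart_dim i)) : 'rV[M]_(k + max_dim) :=
  row_mx (code i) (pad v).

Lemma dfun_space_code i : dfun S (@space_code i).
Proof. by apply: dfun_row_mx; [definability|apply: dfun_pad]. Qed.

Definition chart_index x := sval (cid (first_chart_ex x)).

Lemma chart_indexP x : first_chart (chart_index x) x.
Proof. exact: svalP (cid (first_chart_ex x)). Qed.

Definition enc_space (x : X) := space_code (chart (chart_index x) x).

Lemma enc_spaceP i x (v : 'rV[M]_(chart_dim i)) :
  enc_space x = space_code v <-> first_chart i x /\ chart i x = v.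
Proof.
rewrite /enc_space; split.
  move=> /eq_row_mx[/code_inj e]; move: v; rewrite -e => v /pad_inj <-.
  by split=> //; apply: chart_indexP.
move=> [/(first_chart_inj (chart_indexP x)) e]; move: v; rewrite -e => v ->.
by [].
Qed.

Lemma chart_injP i x y : chart_dom i x -> @chart_dom _ _ _ X i y -> chart i x = chart i y -> x = y.
Proof. by move=> xi yi; apply: (@chart_inj _ _ _ X i); rewrite inE. Qed.

Lemma enc_space_inj : injective enc_space.
Proof.
move=> x y; rewrite {2}/enc_space => /enc_spaceP[[xi _] e].
by have [yi _] := chart_indexP y; apply: chart_injP e.
Qed.

Lemma ddef_of_definable n (A : set 'rV[M]_n) : definable S A -> ddef S A.
Proof. by move/definableP. Qed.

Lemma ddef_relP m n (R : 'rV[M]_m -> 'rV[M]_n -> Prop) :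
  definable S [set z : 'rV[M]_(m + n) | R (lsubmx z) (rsubmx z)] <-> ddef2 S R.
Proof.
split=> [/definableP dR|dR].
  apply: (ddef_iff (P := fun z : 'rV[M]_m * 'rV[M]_n =>
    R (lsubmx (row_mx z.1 z.2)) (rsubmx (row_mx z.1 z.2)))).
    by move=> z; rewrite row_mxKl row_mxKr.
  apply: (ddef_comp (f := fun z : 'rV[M]_m * 'rV[M]_n => row_mx z.1 z.2) _ dR).
  by apply: dfun_row_mx; definability.
apply/definableP.
have dl : dfun S (lsubmx : 'rV[M]_(m + n) -> 'rV[M]_m) by apply/dfun_bmap/bmap_lsubmx.
have dr : dfun S (rsubmx : 'rV[M]_(m + n) -> 'rV[M]_n) by apply/dfun_bmap/bmap_rsubmx.
by rewrite /mkset; definability.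
Qed.

Lemma ddef_mapP m n (A : set 'rV[M]_m) (f : 'rV[M]_m -> 'rV[M]_n) :
  definable_map S A f <-> ddef2 S (fun x y => A x /\ y = f x).
Proof. exact: (ddef_relP (fun x y => A x /\ y = f x)). Qed.

Lemma ddef_first_image i : ddef S (chart i @` [set x | first_chart i x]).
Proof.
have dA := ddef_of_definable (chart_definable i).
have dB j := ddef_of_definable (overlap_definable i j).
pose B j := chart i @` (chart_dom i `&` chart_dom j).
have {}dB j : ddef S (B j) := dB j.
pose A := chart i @` @chart_dom _ _ _ X i.
have {}dA : ddef S A := dA.
apply: (ddef_iff (P := fun v => A v /\ forall j : 'I_k, (j < i)%N -> ~ B j v)); last by definability.
move=> v; split=> [[[x xi <-] nB]|[x [xi nx] <-]].
  by exists x => //; split=> // j ji xj; apply: (nB j ji); exists x.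
split; first by exists x.
move=> j ji [y [yi yj] e]; apply: (nx j ji).
by rewrite (chart_injP xi yi).
Qed.

Lemma enc_space_range : definable S (range enc_space).
Proof.
apply/definableP.
have dF := ddef_first_image; have dc := dfun_space_code.
apply: (ddef_iff (P := fun w => exists i, exists v : 'rV[M]_(chart_dim i),
    (chart i @` [set x | first_chart i x]) v /\ w = space_code v)).
  move=> w; split=> [[i [v [[x xi <-] ->]]]|[x _ <-]].
    by exists x => //; apply/enc_spaceP.
  exists (chart_index x), (chart (chart_index x) x); split=> //.
  by exists x => //; apply: chart_indexP.
definability.
Qed.

#[local] Instance dsort_space : dsort S X := DSort enc_space_inj enc_space_range.

Definition in_chart i (x : X) (v : 'rV[M]_(chart_dim i)) := chart_dom i x /\ chart i x = v.

(** A point is encoded through its least chart j, so its coordinates in chart i are read off by the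
    transition map from j to i. *)
Lemma ddef_in_chart i : ddef2 S (@in_chart i).
Proof.
pose GR j (v' : 'rV[M]_(chart_dim j)) v :=
  exists x, [/\ chart_dom j x, chart_dom i x, chart j x = v' & chart i x = v].
have dGR j : ddef2 S (GR j).
  have [g [gE dg _]] := @transition_homeo _ _ _ X j i.
  move/ddef_mapP: dg; apply: ddef_iff => -[v' v] /=; split.
    by move=> [[x [xj xi] <-] ->]; exists x; split=> //; rewrite gE.
  by move=> [x [xj xi <- <-]]; split; [exists x|rewrite gE].
have denc := dfun_enc dsort_space; have dc := dfun_space_code.
apply: (ddef_iff (P := fun z : X * 'rV[M]_(chart_dim i) => exists j, exists v' : 'rV[M]_(chart_dim j),
    enc z.1 = space_code v' /\ GR j v' z.2)); last first.
  by definability.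
move=> [x v] /=; split=> [[j [v' [/enc_spaceP[[xj _] <-]]]]|[xi <-]].
  by move=> [y [yj yi /(chart_injP yj xj) <- <-]].
exists (chart_index x), (chart (chart_index x) x); split=> //.
by exists x; split=> //; have [] := chart_indexP x.
Qed.

Lemma ddef_subsetP (A : set X) : definable_subset A <-> ddef S A.
Proof.
have dC := ddef_in_chart; split=> [dA|dA i].
  apply: (ddef_iff (P := fun x => exists i, exists v, in_chart x v /\ (chart i @` (A `&` chart_dom i)) v)).
    move=> x; split=> [[i [v [[xi <-] [y [Ay yi]]]]]|Ax].
      by move=> /(chart_injP yi xi) <-.
    by have [i [xi _]] := first_chart_ex x; exists i, (chart i x); split=> //; exists x.
  have {}dA i := ddef_of_definable (dA i).
  definability.
apply/definableP.
apply: (ddef_iff (P := fun v => exists x, A x /\ in_chart (i := i) x v)).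
  move=> v; split=> [[x [Ax [xi <-]]]|[x [Ax xi] <-]]; by exists x.
definability.
Qed.

Lemma ddef_uniform m (R : 'rV[M]_m -> X -> Prop) : ddef2 S R -> uniformly_definable_in setT R.
Proof.
have dC := ddef_in_chart; move=> dR; split.
  by apply/definableP; apply: ddef_const.
move=> i; apply/(ddef_relP (fun t v => setT t /\ (chart i @` (R t `&` chart_dom i)) v)).
apply: (ddef_iff (P := fun z : 'rV[M]_m * 'rV[M]_(chart_dim i) => exists x, R z.1 x /\ in_chart x z.2)).
  by move=> [t v] /=; split=> [[x [Rx [xi <-]]]|[_ [x [Rx xi] <-]]]; [split=> //|]; exists x.
by definability.
Qed.

Lemma uniform_ddef m (T : set 'rV[M]_m) (F : 'rV[M]_m -> set X) :
  uniformly_definable_in T F -> ddef2 S (fun t x => T t /\ F t x).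
Proof.
have dC := ddef_in_chart; move=> [_ dF].
pose Q i t v := T t /\ (chart i @` (F t `&` @chart_dom _ _ _ X i)) v.
have {}dF i : ddef2 S (Q i) := (ddef_relP (Q i)).1 (dF i).
apply: (ddef_iff (P := fun z : 'rV[M]_m * X => exists i, exists v, in_chart z.2 v /\ Q i z.1 v)).
  move=> [t x] /=; split=> [[i [v [[xi <-] [Tt [y [Fy yi]]]]]]|[Tt Fx]].
    by move=> /(chart_injP yi xi) <-.
  by have [i [xi _]] := first_chart_ex x; exists i, (chart i x); split=> //; split=> //; exists x.
definability.
Qed.

Lemma ddef_chart_dom i : ddef S (@chart_dom _ _ _ X i).
Proof.
have dC := ddef_in_chart.
apply: (ddef_iff (P := fun x => exists v, in_chart (i := i) x v)); last by definability.
by move=> x; split=> [[v []]//|xi]; exists (chart i x).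
Qed.

Lemma ddef_first_chart i : ddef S (first_chart i).
Proof. by have dD := ddef_chart_dom; rewrite /first_chart; definability. Qed.

(* The point w.1 only serves to designate a chart. *)
Definition basic (w : X * ('rV[M]_max_dim * 'rV[M]_max_dim)) (x : X) :=
  exists i, first_chart i w.1 /\ exists v, in_chart (i := i) x v /\
    forall j, w.2.1 ord0 (coord_in j) < v ord0 j /\ v ord0 j < w.2.2 ord0 (coord_in j).

Lemma ddef_basic : ddef2 S basic.
Proof. by have dC := ddef_in_chart; have dF := ddef_first_chart; rewrite /basic; definability. Qed.

Lemma basic_definable w : definable_subset (basic w).
Proof. by apply/ddef_subsetP; have dB := ddef_basic; have : ddef S (fun x => basic w x) by definability. Qed.

Lemma openXE (O : set X) : open O <-> space_open O.
Proof. by []. Qed.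

(** The box lives in one chart i, but openness is tested in every chart j: the overlap is open
    there, and the transition map pulls the box back continuously. *)
Lemma basic_open w : open (basic w).
Proof.
apply/openXE => j.
have sub : chart j @` (basic w `&` chart_dom j) `<=` chart j @` chart_dom j.
  by move=> _ [x [_ xj] <-]; exists x.
apply/(open_in_subspace sub) => _ [x [[i [wi [_ [[xi <-] box]]]] xj] <-].
have sub' : chart j @` (chart_dom j `&` chart_dom i) `<=` chart j @` @chart_dom _ _ _ X j.
  by move=> _ [y [yj _] <-]; exists y.
have N1 := (open_in_subspace sub').1 (@overlap_open _ _ _ X j i) (chart j x).
have {}N1 := N1 (ex_intro2 _ _ x (conj xj xi) erefl).
have [g [gE _ /subspace_continuousP/(_ (chart j x))]] := @transition_homeo _ _ _ X j i.
move=> /(_ (ex_intro2 _ _ x (conj xj xi) erefl)). rewrite /from_subspace gE // => gc.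
have N2 := gc [set v | forall a, w.2.1 ord0 (coord_in a) < v ord0 a < w.2.2 ord0 (coord_in a)].
have {}N2 : nbhs (chart j x) (fun v' => (chart j @` (chart_dom j `&` chart_dom i)) v' ->
    forall a, w.2.1 ord0 (coord_in a) < (g v') ord0 a < w.2.2 ord0 (coord_in a)).
  apply: N2; apply/(nbhs_rV om).
  exists (fun a => w.2.1 ord0 (coord_in a)), (fun a => w.2.2 ord0 (coord_in a)).
  by split=> // a; apply/andP; apply: box.
apply: filterS2 N1 N2 => v H1 H2 Av.
have Ov := H1 Av; have := H2 Ov; case: Ov => y [yj yi] <-; rewrite gE // => ybox.
exists y => //; split=> //; exists i; split=> //; exists (chart i y); split=> // a.
exact/andP.
Qed.

Lemma open_box i x (O : set X) : chart_dom i x -> open O -> O x ->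
  exists l r : 'I_(chart_dim i) -> M, (forall j, l j < chart i x ord0 j /\ chart i x ord0 j < r j) /\
   forall y, chart_dom i y -> (forall j, l j < chart i y ord0 j /\ chart i y ord0 j < r j) -> O y.
Proof.
move=> xi /openXE/(_ i) oO Ox.
have sub : chart i @` (O `&` chart_dom i) `<=` chart i @` chart_dom i.
  by move=> _ [y [_ yj] <-]; exists y.
have /(nbhs_rV om)[l [r [xlr lrO]]] :=
  (open_in_subspace sub).1 oO (chart i x) (ex_intro2 _ _ x (conj Ox xi) erefl).
exists l, r; split=> [j|y yi ylr]; first exact/andP.
have [||z [Oz zi] /(chart_injP zi yi) <- //] := lrO (chart i y); last by exists y.
by move=> j; apply/andP.
Qed.

Lemma basic_base x (O : set X) : open O -> O x ->
  exists w, basic w x /\ forall y, basic w y -> O y.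
Proof.
move=> oO Ox; have [i xi] := first_chart_ex x.
have [l [r [xlr lrO]]] := open_box xi.1 oO Ox.
exists (x, (pad (\row_j l j), pad (\row_j r j))); split.
  exists i; split=> //; exists (chart i x); split=> [|j /=]; first by split=> //; case: xi.
  by rewrite !pad_coord !mxE.
move=> y [i' [/= /(first_chart_inj xi) e]]; subst i' => -[v [[yi <-] ylr]].
by apply: lrO => // j; have := ylr j; rewrite !pad_coord !mxE.
Qed.

Lemma mem_near_itv b o e (t : M) :
  (t \in Interval (end_bound true (if b then o else Some e)) (end_bound false (if b then Some e else o)))
  <-> (olt b o t /\ dlt b t e).
Proof.
rewrite mem_end_bounds; case: b => /=; split=> [/andP[]|[? ?]] //; exact/andP.
Qed.

(** Although f need not be continuous, close enough to the germ it stays in one chart and its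
    finitely many coordinates are continuous. On a short interval it is thus a definable curve, to
    which compactness applies. *)
Lemma curve_limit : definably_compact X -> forall f : M -> X, dfun S f -> forall b o,
  exists z, forall w, basic w z -> near b o (fun t => basic w (f t)).
Proof.
move=> cX f df b o.
have dF := ddef_first_chart; have dC := ddef_in_chart.
have [i ni] : exists i, near b o (fun t => first_chart i (f t)).
  apply: (@near_exists_ord _ _ _ om b o _ (fun i t => first_chart i (f t))); first by move=> i; definability.
  by move=> t; apply: first_chart_ex.
(* The coordinates of f in chart i are extended by arbitrary values to functions on all of M, so
   that [near_cont] applies to them. *)
pose R j t v := first_chart i (f t) -> exists vv, in_chart (i := i) (f t) vv /\ v = vv ord0 j.
have dR j : ddef2 S (R j) by rewrite /R; definability.
have Rex j t : exists v, R j t v.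
  have [H|nH] := pselect (first_chart i (f t)); last by exists t.
  by exists (chart i (f t) ord0 j) => _; exists (chart i (f t)); split=> //; split=> //; case: H.
have H j := cid (skolem sk (dR j) (Rex j)).
pose c j := projT1 (H j).
have dc j : dfun S (c j) := (projT2 (H j)).1.
have cE j t : first_chart i (f t) -> chart i (f t) ord0 j = c j t.
  by move=> /((projT2 (H j)).2 t)[_ [[_ <-] <-]].
have [e [oe eP]] := near_nbd om (near_and ni
  (near_forall_ord om (fun j => near_cont om sk b o (dc j)))).
pose o1 := if b then o else Some e; pose o2 := if b then Some e else o.
have cf : definable_curve (end_bound true o1) (end_bound false o2) f.
  have [t0 [ot0 t0e]] := olt_dense om oe.
  have : t0 \in Interval (end_bound true o1) (end_bound false o2) by apply/mem_near_itv.
  rewrite itv_boundlr => /andP[h1 h2]; split.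
  - by rewrite /o1 /o2; case: (b) (o) => [] [].
  - by apply: le_lt_trans h1 (lt_le_trans _ h2); rewrite bnd_simp.
  - apply/subspace_continuousP => t /= /mem_near_itv[ot te].
    have nt := eP t ot te; have [[xi cc] _] := nt.
    move=> O; rewrite nbhsE => -[O' [oO' O'ft] O'O].
    suff : nbhs t (fun s => O (f s)) by apply: filterS => s Os _.
    have [l [r [lr lrO]]] := open_box xi.1 oO' O'ft.
    apply: (nbhs_of_nbd om).
    have nl j : nbd t (fun s => dlt true (l j) (c j s) /\ dlt true (c j s) (r j)).
      have [lj rj] := lr j; rewrite cE // in lj rj.
      by apply: nbd_and; [apply: (cont_nbd (c := false) (cc j))|apply: (cont_nbd (c := true) (cc j))].
    apply: nbd_mono (nbd_and nt (nbd_forall_ord om nl)) => s [[si _] slr].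
    by apply: O'O; apply: lrO => [|j]; [case: si|rewrite cE //; exact: (slr j)].
  move=> j; apply/ddef_mapP.
  have dI : ddef S (fun x : 'rV[M]_1 => olt b o (x ord0 ord0) /\ dlt b (x ord0 ord0) e).
    by case: (o) => [a|] /=; definability.
  apply: (ddef_iff (P := fun z : 'rV[M]_1 * 'rV[M]_(chart_dim j) =>
     (olt b o (z.1 ord0 ord0) /\ dlt b (z.1 ord0 ord0) e) /\ in_chart (i := j) (f (z.1 ord0 ord0)) z.2)).
    move=> [x v] /=; rewrite -mem_near_itv.
    by split=> [[xI [xj <-]]|[[xI xj] ->]].
  apply: ddef_and; first exact: (ddef_comp (dfun_fst (dfun_id _)) dI).
  by have dCj := dC j; definability.
have [l1 l2] := cX _ _ _ cf.
have [z zP] : exists z : X, forall O : set X, nbhs z O -> near b o (fun t => O (f t)).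
  rewrite /o1 /o2 in l1 l2; case: (b) l1 l2 => [[z zP] _|_ [z zP]]; exists z => O Oz.
    by apply/after_near; apply: zP.
  by apply/before_near; apply: zP.
exists z => w wz; apply: zP; apply: open_nbhs_nbhs; split=> //; exact: basic_open.
Qed.

Lemma compact_limits : definably_compact X ->
  forall alpha : set_system X, definable_type alpha -> exists x : X, is_limit alpha x.
Proof.
move=> cX alpha [ta da].
have dta : dtype dsort_space alpha.
  split.
  - exact: type_setT ta.
  - exact: type_set0 ta.
  - by move=> A B; apply: type_setI ta _ _.
  - by move=> A B aA /ddef_subsetP dB AB; apply: (type_subset ta aA).
  - by move=> A /ddef_subsetP; apply: type_ultra ta _.
  move=> F t R dR; have denc := dfun_enc t.
  (* The families in [definable_type] are indexed by rows, so parameters are replaced by their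
     codes. *)
  pose R' (w : 'rV[M]_(dim t)) x := exists y, enc y = w /\ R y x.
  have dR' : ddef2 S R' by rewrite /R'; definability.
  have [Ta [_ /definableP dTa TaE]] := da _ _ _ (ddef_uniform dR').
  apply: (ddef_iff (P := fun y => Ta (enc y))); last by definability.
  move=> y; rewrite -TaE //; suff -> : R' (enc y) = R y by [].
  by apply: funext => x; apply: propext; split=> [[y' [e Ry]]|Ry]; [rewrite -(enc_inj e)|exists y].
have [z zP] := dtype_limit om sk ddef_basic (curve_limit cX) dta (h := fun x => x) (dfun_id _).
exists z => O oO dO Oz; have [w [wz wO]] := basic_base oO Oz.
by apply: (type_subset ta (zP _ wz) dO) => y; apply: wO.
Qed.

(** The germ type is definable because [near] is a first-order condition. Its limit is a limit of f
    because the basic open sets are definable and form a base. *)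
Lemma germ_type_limit (I : M -> Prop) (f : M -> X) b o :
  (forall alpha : set_system X, definable_type alpha -> exists x : X, is_limit alpha x) ->
  ddef2 S (fun t x => I t /\ x = f t) -> near b o I ->
  exists x : X, forall O : set X, nbhs x O -> near b o (fun t => O (f t)).
Proof.
move=> lim dF nI.
pose alpha (A : set X) := definable_subset A /\ near b o (fun t => A (f t)).
(* Definability of f is known only on I, so conditions on [f t] are expressed through this graph. *)
pose Fr t x := I t /\ x = f t.
have {}dF : ddef2 S Fr := dF.
have FrE (A : set X) : near b o (fun t => A (f t)) <-> near b o (fun t => exists x, Fr t x /\ A x).
  split=> nA; apply: near_mono (near_and nI nA) => t _ [It].
    by move=> Af; exists (f t).
  by move=> [x [[_ ->]]].
have nT : near b o (fun=> True) by apply: near_mono nI.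
have ta : is_type alpha.
  split.
  - by move=> A [].
  - by split=> //; apply/ddef_subsetP; apply: ddef_const.
  - by move=> [_ n0]; apply: (near_contra om nT); apply: near_mono n0.
  - move=> A B [/ddef_subsetP dA nA] [/ddef_subsetP dB nB]; split; last exact: near_and.
    by apply/ddef_subsetP; apply: ddef_and.
  - by move=> A B [_ nA] dB AB; split=> //; apply: near_mono nA => t _; apply: AB.
  move=> A /[dup] dA0 /ddef_subsetP dA.
  have dFA : ddef S (fun t => exists x, Fr t x /\ A x) by definability.
  have [nA|nA] := near_dich om b o dFA; [left; split=> //; exact/FrE|right; split].
    by apply/ddef_subsetP; apply: ddef_not.
  apply: near_mono (near_and nI nA) => t _ [It nx].
  by suff : ~ A (f t) by []; move=> Af; apply: nx; exists (f t).
have da : definable_type alpha.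
  split=> // m T F TF; have dTF := uniform_ddef TF.
  have /definableP dT := TF.1.
  pose Q t x := T t /\ F t x.
  have dQ : ddef2 S Q := dTF.
  exists (fun t => T t /\ near b o (fun s => exists x, Fr s x /\ Q t x)); split.
  - by move=> t [].
  - apply/definableP; apply: ddef_and => //.
    have dFQ : ddef2 S (fun t s => exists x, Fr s x /\ Q t x) by definability.
    by case: (o) => [a|]; definability.
  move=> t Tt; split=> [[dFt nF]|[_ nF]].
    split=> //; apply: near_mono (near_and nI nF) => s _ [Is Ff].
    by exists (f s).
  have dFt : ddef S (F t).
    have : ddef S (fun x => Q t x) by definability.
    by apply: ddef_iff => x; split=> [[]|].
  split; first exact/ddef_subsetP.
  by apply: near_mono nF => s _ [x [[_ ->] []]].
have [x xP] := lim _ da; exists x => O; rewrite nbhsE => -[O' [oO' O'x] O'O].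
have [w [wx wO']] := basic_base oO' O'x.
have [_ nw] := xP _ (@basic_open w) (@basic_definable w) wx.
by apply: near_mono nw => t _ wt; apply: O'O; apply: wO'.
Qed.

Lemma limits_compact :
  (forall alpha : set_system X, definable_type alpha -> exists x : X, is_limit alpha x) ->
  definably_compact X.
Proof.
move=> lim a b f [oi ab _ df].
have [o [o' [aE bE]]] := open_ends_bounds oi; subst a b.
pose I t := olt true o t /\ olt false o' t.
have dI : ddef2 S (fun t x => I t /\ x = f t).
  have dC := ddef_in_chart.
  pose Q j (x : 'rV[M]_1) (v : 'rV[M]_(chart_dim j)) :=
    (I (x ord0 ord0) /\ @chart_dom _ _ _ X j (f (x ord0 ord0))) /\ v = chart j (f (x ord0 ord0)).
  have dQ j : ddef2 S (Q j).
    apply: ddef_iff ((ddef_mapP _ _).1 (df j)) => -[x v] /=.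
    split=> -[[xI xj] ->]; split=> //; split=> //.
      by apply/andP; rewrite -mem_end_bounds.
    by have /andP := xI; rewrite -mem_end_bounds.
  have dc := dfun_const_mx S 1.
  apply: (ddef_iff (P := fun z : M * X => exists j, exists v, in_chart (i := j) z.2 v /\
     Q j (const_mx z.1) v)); last by definability.
  move=> [t x]; rewrite /Q /= mxE; split.
    by move=> [j [v [[xj <-] [[It fj] /(chart_injP xj fj) ->]]]].
  move=> [It ->]; have [j [fj _]] := first_chart_ex (f t).
  by exists j, (chart j (f t)).
have nr : near true o I.
  move: ab; case: o' @I {oi df dI} => [y|] /= ab.
    have : olt true o y by case: o ab => [x|] //=; rewrite bnd_simp.
    by move/near_olt; apply: near_mono => t _ [].
  have [c oc] := olt_ex om true o.
  by apply: near_mono (near_olt oc) => t ot _; split.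
have nl : near false o' I.
  move: ab; case: o @I {oi df dI nr} => [y|] /= ab.
    have : olt false o' y by case: o' ab => [x|] //=; rewrite bnd_simp.
    by move/near_olt; apply: near_mono => t _ [].
  have [c oc] := olt_ex om false o'.
  by apply: near_mono (near_olt oc) => t ot _; split.
split.
  have [z zP] := germ_type_limit lim dI nr; exists z => O /zP nO.
  by apply/after_near.
have [z zP] := germ_type_limit lim dI nl; exists z => O /zP nO.
by apply/before_near.
Qed.

End SpaceSort.

Theorem theorem5p2 (d : Order.disp_t) (M : orderTopologicalType d)
    (S : structure M) (X : definable_space S) :
  o_minimal S -> definable_skolem_functions S -> hausdorff_space X ->
  (definably_compact X <->
   forall alpha : set_system X,
     definable_type alpha -> exists x : X, is_limit alpha x).
Proof.
move=> om sk _.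
have [m0 _] := o_minimal_nonempty om; have [m1 m01] := o_minimal_no_max om m0.
have m0m1 : m0 <> m1 by move=> e; rewrite e ltxx in m01.
by split; [apply: (compact_limits om sk m0m1)|apply: (limits_compact om m0m1)].
Qed.
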